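(* If either $f\in BV(\mathbb{R}^n)$ or $f\in BV_{\rm loc}(\mathbb{R}^n)\cap L^\infty(\mathbb{R}^n)$, then $$D^\alpha f\rightharpoonup Df\quad\text{as }\alpha\to1^-.$$
   Context: Here $n\in\mathbb{N}$, $n\ge 1$, and $Df$ is the distributional gradient measure of $f$. For $\alpha\in(0,1)$ let $\mu_{n,\alpha}:=2^\alpha\pi^{-n/2}\,\Gamma\big(\tfrac{n+\alpha+1}{2}\big)/\Gamma\big(\tfrac{1-\alpha}{2}\big)$, and for $\varphi\in \mathrm{Lip}_c(\mathbb{R}^n;\mathbb{R}^n)$ (Lipschitz with compact support) let $$\mathrm{div}^\alpha\varphi(x):=\mu_{n,\alpha}\int_{\mathbb{R}^n}\frac{(y-x)\cdot(\varphi(y)-\varphi(x))}{|y-x|^{n+\alpha+1}}\,dy,\qquad x\in\mathbb{R}^n,$$ which belongs to $L^1(\mathbb{R}^n)\cap L^\infty(\mathbb{R}^n)$. For $f\in L^1(\mathbb{R}^n)$ or $f\in L^\infty(\mathbb{R}^n)$, $D^\alpha f$ denotes the (unique, if it exists) $\mathbb{R}^n$-valued locally finite Radon measure on $\mathbb{R}^n$ such that $\int_{\mathbb{R}^n} f\,\mathrm{div}^\alpha\varphi\,dx=-\int_{\mathbb{R}^n}\varphi\cdot dD^\alpha f$ for all $\varphi\in\mathrm{Lip}_c(\mathbb{R}^n;\mathbb{R}^n)$. For $f$ as in the claim, $D^\alpha f$ exists for every $\alpha\in(0,1)$. The convergence $\mu_\alpha\rightharpoonup\mu$ of $\mathbb{R}^n$-valued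 Radon measures means $\int\varphi\cdot d\mu_\alpha\to\int\varphi\cdot d\mu$ for every $\varphi\in C^0_c(\mathbb{R}^n;\mathbb{R}^n)$ (weak*-convergence). *)

(* Defs.v *)
From HB Require Import structures.
From mathcomp Require Import all_boot all_order all_algebra.
From mathcomp Require Import all_classical all_reals all_analysis.
From mathcomp Require Import measurable_realfun.

Set Implicit Arguments.
Unset Strict Implicit.
Unset Printing Implicit Defensive.

Import Order.TTheory GRing.Theory Num.Theory.
Import numFieldNormedType.Exports.

Local Open Scope classical_set_scope.
Local Open Scope ring_scope.

(** R^n is ['rV[R]_n].  Its library norm [`|x|] is the maximum norm; it is only
    used for topological notions (boundedness, compactness, continuity,
    Lipschitz continuity), which do not depend on the choice of the norm.  The
    Euclidean norm is [enorm] below.  The measurable sets are the Borel sets. *)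

Section borel_rV.
Variables (R : realType) (n : nat).

Definition borel_rV : set (set 'rV[R]_n) := <<s @open 'rV[R]_n >>.

Let borel0 : borel_rV set0. Proof. exact: sigma_algebra0. Qed.

Let borelC A : borel_rV A -> borel_rV (~` A).
Proof. exact: sigma_algebraC. Qed.

Let borel_bigcup (F : (set 'rV[R]_n)^nat) :
  (forall i, borel_rV (F i)) -> borel_rV (\bigcup_i F i).
Proof. exact: sigma_algebra_bigcup. Qed.

HB.instance Definition _ := @isMeasurable.Build default_measure_display
  'rV[R]_n borel_rV borel0 borelC borel_bigcup.

End borel_rV.

Section borel_rV_theory.
Variable R : realType.

Lemma open_measurable_rV n (A : set 'rV[R]_n) : open A -> measurable A.
Proof. by move=> oA; exact: sub_sigma_algebra. Qed.

Lemma closed_measurable_rV n (A : set 'rV[R]_n) : closed A -> measurable A.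
Proof.
by move=> /closed_openC /open_measurable_rV/measurableC; rewrite setCK.
Qed.

Lemma continuous_measurable_rV n (f : 'rV[R]_n -> R) :
  continuous f -> measurable_fun setT f.
Proof.
move=> /continuousP cf; apply: (measurability _ (RGenOpens.measurableE R)).
move=> _ [_ [a [b ->] <-]]; rewrite setTI.
by apply: open_measurable_rV; apply: cf; exact: interval_open.
Qed.

Lemma measurable_coord_rV n (i : 'I_n) :
  measurable_fun setT (fun v : 'rV[R]_n => v ord0 i).
Proof. by apply: continuous_measurable_rV; exact: coord_continuous. Qed.

Lemma measurable_fun_rV d (T : measurableType d) n (f : T -> 'rV[R]_n) :
  (forall i, measurable_fun setT (fun t => f t ord0 i)) ->
  measurable_fun setT f.
Proof.
move=> mf.
apply: (@measurability _ _ _ _ _ _ (@open 'rV[R]_n)) => //.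
move=> _ [U oU <-]; rewrite setTI.
pose r k : R := k.+1%:R^-1.
pose q2r (q : 'rV[rat]_n) : 'rV[R]_n := \row_i ratr (q ord0 i).
pose good (p : 'rV[rat]_n * nat) := `[< ball (q2r p.1) (r p.2) `<=` U >].
have -> : f @^-1` U = \bigcup_(p in [set p | good p])
    f @^-1` (ball (q2r p.1) (r p.2)).
  apply/seteqP; split => [t /= Uft|t [p /= /asboolP gp]]; last exact: gp.
  have /nbhs_ballP[e /= e0 eU] : nbhs (f t) U by exact: open_nbhs_nbhs.
  have [k rk] : exists k, r k < e / 2.
    near \oo => k; exists k; near: k.
    by apply: near_infty_natSinv_lt (PosNum (divr_gt0 e0 _)).
  have rk0 : 0 < r k by rewrite invr_gt0.
  have qP i : exists q : rat, ball (f t ord0 i) (r k) (ratr q : R).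
    have [|x [] bx [q _ qx]] :=
      @dense_rat R (ball (f t ord0 i) (r k)) _ (ball_open _ _).
      by exists (f t ord0 i); exact: ballxx.
    by exists q; rewrite qx.
  exists (\row_i (sval (cid (qP i))), k) => /=.
    apply/asboolP => x [_ bx]; apply: eU; split => // i j.
    have -> : e = e / 2 + e / 2 by rewrite -splitr.
    rewrite (ord1 i).
    apply: (ball_triangle (y := (ratr (sval (cid (qP j))) : R))).
      apply: le_ball (ltW rk) _ _; exact: (svalP (cid (qP j))).
    apply: le_ball (ltW rk) _ _.
    by have := bx ord0 j; rewrite !mxE.
  split => // i j; rewrite (ord1 i) !mxE; apply: ball_sym.
  exact: (svalP (cid (qP j))).
rewrite bigcup_mkcond; apply: countable_bigcupT_measurable => [|p].
  exact: countableP.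
case: ifPn => // _.
have [r0|r0] := leP (r p.2) 0; first by move: r0; rewrite leNgt invr_gt0 ltr0n.
have -> : f @^-1` ball (q2r p.1) (r p.2) =
    \bigcap_i ((fun t => f t ord0 i) @^-1` ball (q2r p.1 ord0 i) (r p.2)).
  apply/seteqP; split => [t [_ bt] i _|t bt]; first exact: bt.
  by split => // i j; rewrite (ord1 i); exact: bt.
rewrite -[X in measurable X]setCK setC_bigcap; apply: measurableC.
apply: countable_bigcupT_measurable => [|i]; first exact: countableP.
apply: measurableC; rewrite -[X in measurable X]setTI.
by apply: mf => //; apply: open_measurable; exact: ball_open.
Unshelve. all: by end_near. Qed.

End borel_rV_theory.

(** Lebesgue measure by recursion on the dimension: the measure on R^(n+1) is the image of the
    product of the measure on R and of the measure on R^n under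
    (x, v) |-> (x, v). *)

Section lebesgue_rV.
Variable R : realType.

Definition cons_rV n (p : measurableTypeR R * 'rV[R]_n) : 'rV[R]_n.+1 :=
  \row_i (if unlift ord0 i is Some j then p.2 ord0 j else p.1).

Definition uncons_rV n (v : 'rV[R]_n.+1) : measurableTypeR R * 'rV[R]_n :=
  (v ord0 ord0, \row_j v ord0 (lift ord0 j)).

Lemma cons_rVK n : cancel (@cons_rV n) (@uncons_rV n).
Proof.
move=> [x v]; congr (_, _); first by rewrite /= mxE unlift_none.
by apply/rowP => i; rewrite !mxE liftK.
Qed.

Lemma measurable_cons_rV n : measurable_fun setT (@cons_rV n).
Proof.
apply: measurable_fun_rV => i.
under eq_fun do rewrite mxE.
case: unliftP => [j _|_]; last exact: measurable_fst.
exact: (measurableT_comp (measurable_coord_rV j) measurable_snd).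
Qed.

Lemma measurable_uncons_rV n : measurable_fun setT (@uncons_rV n).
Proof.
apply: measurable_fun_pair; first exact: measurable_coord_rV.
apply: measurable_fun_rV => i.
by under eq_fun do rewrite mxE; exact: measurable_coord_rV.
Qed.

Section step.
Variables (n : nat) (m : {sigma_finite_measure set 'rV[R]_n -> \bar R}).

Definition lebesgue_rV_step : set 'rV[R]_n.+1 -> \bar R :=
  pushforward (lebesgue_measure \x m)%E (@cons_rV n).

Let measurable_preimage A : measurable A -> measurable (@cons_rV n @^-1` A).
Proof.
by move=> mA; rewrite -[X in measurable X]setTI; exact: measurable_cons_rV.
Qed.

Let lebesgue_rV_step0 : lebesgue_rV_step set0 = 0%E.
Proof. by rewrite /lebesgue_rV_step /pushforward preimage_set0 measure0. Qed.

Let lebesgue_rV_step_ge0 A : (0 <= lebesgue_rV_step A)%E.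
Proof. exact: (measure_ge0 (lebesgue_measure \x m)%E). Qed.

Let lebesgue_rV_step_sigma_additive : semi_sigma_additive lebesgue_rV_step.
Proof.
move=> F mF tF mUF; rewrite /lebesgue_rV_step /pushforward preimage_bigcup.
apply: measure_semi_sigma_additive.
- by move=> k; exact: measurable_preimage.
- apply/trivIsetP => /= i j _ _ ij; rewrite -preimage_setI.
  by move/trivIsetP : tF => /(_ _ _ _ _ ij) ->//; rewrite preimage_set0.
- by rewrite -preimage_bigcup; exact: measurable_preimage.
Qed.

HB.instance Definition _ := isMeasure.Build _ _ _ lebesgue_rV_step
  lebesgue_rV_step0 lebesgue_rV_step_ge0 lebesgue_rV_step_sigma_additive.

Let lebesgue_rV_step_sigma_finite : sigma_finite setT lebesgue_rV_step.
Proof.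
have /sigma_finiteP[F [FT ndF Foo]] := sigma_finiteT (@lebesgue_measure R).
have /sigma_finiteP[G [GT ndG Goo]] := sigma_finiteT m.
exists (fun k => @uncons_rV n @^-1` (F k `*` G k)).
  rewrite -preimage_bigcup (_ : \bigcup_k _ = setT) ?preimage_setT//.
  apply/seteqP; split => // -[x v] _.
  have [i _ Fx] : (\bigcup_i F i) x by rewrite -FT.
  have [j _ Gv] : (\bigcup_i G i) v by rewrite -GT.
  exists (maxn i j) => //; split => /=.
    by move: x Fx; exact/subsetPset/ndF/leq_maxl.
  by move: v Gv; exact/subsetPset/ndG/leq_maxr.
move=> k; have [mF Fk] := Foo k; have [mG Gk] := Goo k.
have mFG : measurable (F k `*` G k) by exact: measurableX.
split.
  by rewrite -[X in measurable X]setTI; exact: measurable_uncons_rV.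
rewrite /lebesgue_rV_step /pushforward -comp_preimage.
rewrite (_ : _ \o _ = id); last by rewrite funeqE => p /=; rewrite cons_rVK.
by rewrite preimage_id product_measure1E// lte_mul_pinfty// ge0_fin_numE.
Qed.

HB.instance Definition _ := Measure_isSigmaFinite.Build _ _ _
  lebesgue_rV_step lebesgue_rV_step_sigma_finite.

End step.

Fixpoint lebesgue_rV n : {sigma_finite_measure set 'rV[R]_n -> \bar R} :=
  match n with
  | 0 => \d_(0 : 'rV[R]_0)
  | n'.+1 => lebesgue_rV_step (lebesgue_rV n')
  end.

Lemma lebesgue_rV_box n (A : 'I_n -> set R) :
  (forall i, measurable (A i)) ->
  lebesgue_rV n [set v | forall i, A i (v ord0 i)] =
  (\prod_(i < n) lebesgue_measure (A i))%E.
Proof.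
elim: n A => [|n IH] A mA.
  rewrite big_ord0 /= diracE mem_set//= => -[].
  by [].
have mB : measurable [set v : 'rV[R]_n | forall i, A (lift ord0 i) (v ord0 i)].
  have -> : [set v : 'rV[R]_n | forall i, A (lift ord0 i) (v ord0 i)] =
      \bigcap_i ((fun v : 'rV[R]_n => v ord0 i) @^-1` A (lift ord0 i)).
    by apply/seteqP; split => v Av i; [move=> _|]; exact: Av.
  rewrite -[X in measurable X]setCK setC_bigcap; apply: measurableC.
  apply: countable_bigcupT_measurable => [|i]; first exact: countableP.
  apply: measurableC; rewrite -[X in measurable X]setTI.
  exact: measurable_coord_rV.
rewrite big_ord_recl -IH// -product_measure1E//=; last exact: mA.
rewrite /lebesgue_rV_step /pushforward; congr (_ _).
apply/seteqP; split => [[x v] /= Av|[x v] /= [Ax Av] i].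
  split => /=; first by have := Av ord0; rewrite mxE unlift_none.
  by move=> i; have := Av (lift ord0 i); rewrite mxE liftK.
by rewrite mxE; case: unliftP => [j ->|->] /=.
Qed.

End lebesgue_rV.

Section euclidean.
Variables (R : realType) (n : nat).
Implicit Types x y : 'rV[R]_n.

Definition dotv x y : R := \sum_(i < n) x ord0 i * y ord0 i.

Definition enorm x : R := Num.sqrt (dotv x x).

End euclidean.

(** A locally finite R^n-valued Radon measure is a countably additive set function on the bounded Borel
    sets; it need not extend to all Borel sets.  The values of [vmeas] on sets
    that are not bounded Borel sets are irrelevant. *)

Record radon_vmeasure (R : realType) (n : nat) := RadonVMeasure {
  vmeas :> set 'rV[R]_n -> 'rV[R]_n ;
  vmeas_sigma_additive : forall F : (set 'rV[R]_n)^nat,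
    (forall k, measurable (F k)) -> trivIset setT F ->
    bounded_set (\bigcup_k F k) ->
    (fun N => \sum_(0 <= k < N) vmeas (F k)) @ \oo --> vmeas (\bigcup_k F k) }.

Section radon_vmeasure_theory.
Variables (R : realType) (n : nat).
Implicit Types mu : radon_vmeasure R n.

Lemma vmeas0 mu : mu set0 = 0.
Proof.
have := @vmeas_sigma_additive R n mu (fun=> set0).
rewrite bigcup0// => /(_ (fun=> measurable0)) H.
have {}H : (fun N => \sum_(0 <= k < N) mu set0) @ \oo --> mu set0.
  apply: H; first exact: trivIset_set0.
  by exists 0; split => // M M0 x [].
have H1 : (fun N => \sum_(0 <= k < N.+1) mu set0) @ \oo --> mu set0.
  by move: H; rewrite -(cvg_shiftS (fun N => \sum_(0 <= k < N) mu set0)).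
have H2 : (fun N => \sum_(0 <= k < N.+1) mu set0) @ \oo -->
    mu set0 + mu set0.
  under eq_fun do rewrite big_nat_recr//=.
  by apply: cvgD => //; exact: cvg_cst.
have H3 : mu set0 = mu set0 + mu set0.
  exact: (cvg_unique (@norm_hausdorff _ _) H1 H2).
by apply: (addrI (mu set0)); rewrite addr0 -H3.
Qed.

(** The sets [F k] are bounded but their union need not be, so that this is the
    total variation of [mu] on the whole of R^n. *)
Definition vtotal_variation mu : \bar R :=
  ereal_sup [set (\sum_(0 <= k <oo) (enorm (mu (F k)))%:E)%E |
    F in [set F : (set 'rV[R]_n)^nat |
      [/\ forall k, measurable (F k), forall k, bounded_set (F k) &
          trivIset setT F]]].

Definition cube (k : nat) : set 'rV[R]_n := [set x | `|x| <= k%:R].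

Lemma measurable_cube k : measurable (cube k).
Proof.
apply: closed_measurable_rV.
rewrite (_ : cube k = Num.norm @^-1` [set t : R | t <= k%:R])//.
apply: closed_comp; last exact: closed_le.
by move=> x _; exact: norm_continuous.
Qed.

Lemma bounded_cube k : bounded_set (cube k).
Proof. by exists k%:R; split => // M kM x /= xk; exact: le_trans xk (ltW kM). Qed.

(** A component of [mu] becomes a finite charge on all Borel sets only after
    restriction to a bounded set. *)
Definition vcharge mu (k : nat) (i : 'I_n) : set 'rV[R]_n -> \bar R :=
  fun A => (mu (A `&` cube k) ord0 i)%:E.

Section vcharge.
Variables (mu : radon_vmeasure R n) (k : nat) (i : 'I_n).

Let vcharge0 : vcharge mu k i set0 = 0%E.
Proof. by rewrite /vcharge set0I vmeas0 mxE. Qed.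

Let vcharge_fin A : measurable A -> vcharge mu k i A \is a fin_num.
Proof. by []. Qed.

Let vcharge_sigma_additive : semi_sigma_additive (vcharge mu k i).
Proof.
move=> F mF tF mUF; rewrite /vcharge setI_bigcupl.
under eq_fun do rewrite sumEFin.
apply: cvg_EFin; first exact: nearW.
rewrite (_ : _ \o _ = (fun v : 'rV[R]_n => v ord0 i) \o
    (fun N => \sum_(0 <= j < N) mu (F j `&` cube k))); last first.
  by apply/funext => N /=; rewrite summxE.
apply: continuous_cvg; first exact: coord_continuous.
apply: vmeas_sigma_additive.
- by move=> j; apply: measurableI => //; exact: measurable_cube.
- by apply: trivIset_setIr.
- have [M [Mr Mc]] := bounded_cube k; exists M; split => // x Mx y [j _ [_ yk]].
  exact: Mc.
Qed.

HB.instance Definition _ := isCharge.Build _ _ _ (vcharge mu k i)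
  vcharge0 vcharge_fin vcharge_sigma_additive.

End vcharge.

End radon_vmeasure_theory.

Section integration.
Variable R : realType.

Section charge_integral.
Context d (T : measurableType d) (nu : {charge set T -> \bar R}).

Definition hahn_set_pos : set T := sval (cid (Hahn_decomposition nu)).

Definition hahn_set_neg : set T :=
  sval (cid (svalP (cid (Hahn_decomposition nu)))).

Lemma hahn_setP : hahn_decomposition nu hahn_set_pos hahn_set_neg.
Proof. exact: svalP (cid (svalP (cid (Hahn_decomposition nu)))). Qed.

(** The positive and negative parts do not depend on the choice of the Hahn
    decomposition. *)
Definition charge_integral (g : T -> R) : R :=
  \int[jordan_pos hahn_setP]_x g x - \int[jordan_neg hahn_setP]_x g x.

End charge_integral.

(** Integral of phi . dmu, for phi with compact support: the sequence under the
    limit is eventually constant. *)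
Definition vintegral n (mu : radon_vmeasure R n) (phi : 'rV[R]_n -> 'rV[R]_n)
    : R :=
  limn (fun k =>
    \sum_(i < n) charge_integral (vcharge mu k i) (fun x => phi x ord0 i)).

End integration.

Section test_functions.
Variables (R : realType) (n : nat).
Implicit Types (phi : 'rV[R]_n -> 'rV[R]_n) (g : 'rV[R]_n -> R).

Definition compact_support phi : Prop := compact (closure [set x | phi x != 0]).

Definition Cc0 phi : Prop := continuous phi /\ compact_support phi.

Definition Lipc phi : Prop := lipschitz phi /\ compact_support phi.

Definition partial (i : 'I_n) g : 'rV[R]_n -> R :=
  fun x => 'D_(delta_mx ord0 i) g x.

Fixpoint Ck (k : nat) g : Prop :=
  continuous g /\
  if k is k'.+1 then
    forall i : 'I_n, (forall x, derivable g x (delta_mx ord0 i)) /\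
                     Ck k' (partial i g)
  else True.

Definition Ccoo phi : Prop :=
  (forall k (i : 'I_n), Ck k (fun x => phi x ord0 i)) /\ compact_support phi.

Definition divergence phi : 'rV[R]_n -> R :=
  fun x => \sum_(i < n) partial i (fun y => phi y ord0 i) x.

End test_functions.

Section fractional.
Variables (R : realType) (n : nat).

Definition Gamma (x : R) : R :=
  \int[lebesgue_measure]_(t in `]0, +oo[) (t `^ (x - 1) * expR (- t)).

Definition frac_const (a : R) : R :=
  2 `^ a * pi `^ (- (n%:R / 2)) *
  (Gamma ((n%:R + a + 1) / 2) / Gamma ((1 - a) / 2)).

(** The integrand vanishes at y = x, where the numerator is 0. *)
Definition frac_div (a : R) (phi : 'rV[R]_n -> 'rV[R]_n) : 'rV[R]_n -> R :=
  fun x => frac_const a *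
    \int[lebesgue_rV R n]_y
      (dotv (y - x) (phi y - phi x) / enorm (y - x) `^ (n%:R + a + 1)).

End fractional.

Section bounded_variation.
Variables (R : realType) (n : nat).
Implicit Types (f : 'rV[R]_n -> R) (mu : radon_vmeasure R n).

Definition is_gradient f mu : Prop :=
  forall phi, Ccoo phi ->
    \int[lebesgue_rV R n]_x (f x * divergence phi x) = - vintegral mu phi.

Definition is_frac_gradient (a : R) f mu : Prop :=
  forall phi, Lipc phi ->
    \int[lebesgue_rV R n]_x (f x * frac_div a phi x) = - vintegral mu phi.

Definition L1 f : Prop := (lebesgue_rV R n).-integrable setT (EFin \o f).

Definition L1loc f : Prop :=
  forall K : set 'rV[R]_n, compact K ->
    (lebesgue_rV R n).-integrable K (EFin \o f).

Definition Loo f : Prop :=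
  measurable_fun setT f /\ finite_norm (lebesgue_rV R n) +oo f.

Definition BV f : Prop :=
  L1 f /\ exists2 mu, is_gradient f mu & (vtotal_variation mu < +oo)%E.

Definition BVloc f : Prop := L1loc f /\ exists mu, is_gradient f mu.

End bounded_variation.

Definition weak_star_cvg (R : realType) n (mu_ : R -> radon_vmeasure R n)
    (F : set_system R) (mu : radon_vmeasure R n) : Prop :=
  forall phi, Cc0 phi ->
    vintegral (mu_ a) phi @[a --> F] --> vintegral mu phi.

(* Main.v *)
(** Write s = (n + a + 1) / 2 and h(u) = max(0, 1 - u).  The kernel of [frac_div] is a
    superposition of Lipschitz kernels with compact support,
      q^(-s) / (s (s + 1)) = \int_0^oo t^(s - 1) h(t q) dt    with q = |z|^2.
    The part t >= 1 carries all the mass as a -> 1: an integration by parts in z turns it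
    into the divergence of a weighted average of the translates of phi, with a nonnegative
    weight supported in |z| <= 1.  The total weight [near_mass] tends to 1, because the
    integral of h^2 is explicit (Gamma functions) and Gamma x ~ 1 / x at 0; the first
    moment of the weight tends to 0.  The part t < 1 is a convolution against an integrable
    weight, multiplied by the constant [kscale] which tends to 0 like 1 - a.  Hence
    D^a f (phi) = Df (average of phi) + o(1) for smooth phi, with a bound on |D^a f (phi)|
    by sup |phi| uniform in a; density of smooth functions concludes.  The far part is
    paired with f in L^1 by its supremum, and with f in L^oo by its L^1 norm. *)

From HB Require Import structures.
Require Import Defs.
From mathcomp Require Import all_boot all_order all_algebra.
From mathcomp Require Import all_classical all_reals all_analysis.
From mathcomp Require Import measurable_realfun ess_sup_inf ring lra.

Set Implicit Arguments.
Unset Strict Implicit.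
Unset Printing Implicit Defensive.

Import Order.TTheory GRing.Theory Num.Theory.
Import numFieldNormedType.Exports.

Local Open Scope classical_set_scope.
Local Open Scope ring_scope.

(** * Changes of variables in R^n *)

(** Integrating the whole kernel by parts would give a Riesz potential of div phi. Its kernel is not
    compactly supported, whereas Df is finite only on bounded sets when f is in BV_loc; and a sharp
    cutoff would leave boundary terms. At a fixed scale t the hat kernel avoids both: z h(t |z|^2)
    is -1 / (2t) times the gradient of a C^1 function with compact support, and its integrals over z
    scale exactly in t. The factor 1 / (2t) lowers the power of t by one, so the mass of the near
    weight contains the integral of t^((a - 3) / 2) over t >= 1, that is 2 / (1 - a): this pole
    compensates the decay of [kscale].

    The averaged field stays in one fixed cube for all a, where Df acts as a finite measure. The far
    part spreads over all of R^n, but it is never tested against Df: it is paired with f itself and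
    involves no derivative of phi.

    A last obstacle: the bound uniform in a is available on smooth fields, while each D^a f has on a
    cube a finite norm that may depend on a. The bound passes to continuous fields by choosing, for
    every a separately, an approximation fine enough for that norm. *)

Definition pushforward_measure d d' (T : measurableType d)
    (T' : measurableType d') (R : realType) (m : {measure set T -> \bar R})
    (f : T -> T') (mf : measurable_fun setT f) : {measure set T' -> \bar R} :=
  measure_function_pushforward__canonical__measure_function_Measure m mf.

Section affine_change.
Variable R : realType.
Notation mu := (@lebesgue_measure R).

(** The image of Lebesgue measure under the affine map, multiplied by l, agrees with Lebesgue
    measure on half-open intervals, and these determine it. *)
Lemma lebesgue_measure_affine (l b : R) (A : set (measurableTypeR R)) :
  0 < l -> measurable A ->
  mu A = (l%:E * mu ((fun x : R => l * x + b)%R @^-1` A))%E.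
Proof.
move=> l0 mA.
pose mphi := (fun x : measurableTypeR R => l * x + b : measurableTypeR R).
have mm : measurable_fun setT mphi.
  by apply: measurable_funD => //; apply: measurable_funM.
pose HBm := pushforward_measure mu mm.
pose l' := NngNum (ltW l0).
pose m := [the {measure set (measurableTypeR R) -> \bar R} of mscale l' HBm].
rewrite (lebesgue_measure_unique (mu := m))//= => _ [[a c]] _ <-.
rewrite /mscale/= /pushforward.
have -> : mphi @^-1` `]a, c]%classic = `](a - b) / l, (c - b) / l]%classic.
  apply/seteqP; split => x /=; rewrite !in_itv/= /mphi.
    by rewrite ltr_pdivrMr// ler_pdivlMr// ltrBlDr lerBrDr mulrC.
  by rewrite ltr_pdivrMr// ler_pdivlMr// ltrBlDr lerBrDr mulrC.
rewrite !lebesgue_measure_itv/= !lte_fin ltr_pM2r ?invr_gt0// ltrD2r.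
case: ifPn => _; last by rewrite mule0.
rewrite -!EFinB -EFinM; congr EFin.
by field; rewrite gt_eqF.
Qed.

Lemma ge0_integral_affine (l b : R) (q : measurableTypeR R -> \bar R) :
  0 < l -> measurable_fun setT q -> (forall x, (0 <= q x)%E) ->
  (\int[mu]_x q (l * x + b)%R = (l^-1)%:E * \int[mu]_x q x)%E.
Proof.
move=> l0 mq q0.
pose mphi := (fun x : measurableTypeR R => l * x + b : measurableTypeR R).
have mm : measurable_fun setT mphi.
  by apply: measurable_funD => //; apply: measurable_funM.
pose HBm := pushforward_measure mu mm.
pose l' := NngNum (ltW l0).
have li : 0 <= l^-1 by rewrite invr_ge0 ltW.
have -> : (\int[mu]_x q x = \int[mscale l' HBm]_x q x)%E.
  apply: eq_measure_integral => A mA _.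
  exact: (lebesgue_measure_affine b l0 mA).
rewrite ge0_integral_mscale//= ge0_integral_pushforward//=.
rewrite preimage_setT muleA -EFinM mulVf ?gt_eqF// mul1e.
by [].
Qed.

Lemma ge0_integral_rVS n (q : 'rV[R]_n.+1 -> \bar R) :
  measurable_fun setT q -> (forall x, (0 <= q x)%E) ->
  (\int[lebesgue_rV R n.+1]_x q x =
   \int[mu]_x \int[lebesgue_rV R n]_v q (cons_rV (x, v)))%E.
Proof.
move=> mq q0.
have mc := @measurable_cons_rV R n.
pose m := pushforward_measure (mu \x lebesgue_rV R n)%E mc.
transitivity (\int[m]_x q x)%E; first exact: eq_measure_integral.
rewrite ge0_integral_pushforward//= preimage_setT fubini_tonelli1//=.
exact: measurableT_comp.
Qed.

(** A homothety acts on each coordinate separately, so induction on n peels off one one-dimensional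
    change of variables per coordinate. The case l = 1 gives translations; b = 0 with l a square
    root gives the rescaling of radial kernels. *)
Lemma ge0_integral_rV_affine n (l : R) (b : 'rV[R]_n) (q : 'rV[R]_n -> \bar R) :
  0 < l -> measurable_fun setT q -> (forall x, (0 <= q x)%E) ->
  (\int[lebesgue_rV R n]_x q (l *: x + b)%R =
   (l ^- n)%:E * \int[lebesgue_rV R n]_x q x)%E.
Proof.
move=> l0; elim: n b q => [|n IH] b q mq q0.
  rewrite expr0 invr1 mul1e; apply: eq_integral => x _.
  by congr q; apply/rowP => -[].
have lb_mf : measurable_fun setT (fun x : 'rV[R]_n.+1 => l *: x + b).
  apply: measurable_fun_rV => i; under eq_fun do rewrite !mxE.
  apply: measurable_funD => //; apply: measurable_funM => //.
  exact: measurable_coord_rV.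
have mc := @measurable_cons_rV R n.
rewrite ge0_integral_rVS//; last exact: measurableT_comp.
pose b' : 'rV[R]_n := \row_j b ord0 (lift ord0 j).
have E x v : l *: cons_rV (x, v) + b =
    cons_rV (l * x + b ord0 ord0 : measurableTypeR R, l *: v + b').
  apply/rowP => i; rewrite !mxE/=.
  by case: unliftP => [j ->|->] /=; rewrite ?mxE.
under eq_integral => x _.
  under eq_integral do rewrite E.
  rewrite (IH b' (fun v => q (cons_rV (l * x + b ord0 ord0 : measurableTypeR R, v))))//; last first.
    by apply: measurableT_comp => //; apply: measurableT_comp => //.
  over.
have mF : measurable_fun setT (fun x : measurableTypeR R =>
    \int[lebesgue_rV R n]_v q (cons_rV (x, v)))%E.
  apply: (measurable_fun_fubini_tonelli_F (fun p => q (cons_rV p))) => //.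
  exact: measurableT_comp.
rewrite ge0_integralZl//=; last 3 first.
- by apply: (measurableT_comp mF); apply: measurable_funD => //; apply: measurable_funM.
- by move=> x _; exact: integral_ge0.
- by rewrite lee_fin invr_ge0 exprn_ge0// ltW.
rewrite (@ge0_integral_affine l (b ord0 ord0) (fun x => \int[lebesgue_rV R n]_v q (cons_rV (x, v)))%E)//; last first.
  by move=> x; exact: integral_ge0.
rewrite muleA -EFinM -invfM -exprSr; congr (_ * _)%E.
by rewrite ge0_integral_rVS.
Qed.
End affine_change.

Section rV_facts.
Variables (R : realType) (n : nat).
Notation lam := (lebesgue_rV R n).
Implicit Types x : 'rV[R]_n.

Lemma normr_rV_le x (r : R) : 0 <= r -> (`|x| <= r) <-> (forall i, `|x ord0 i| <= r).
Proof.
move=> r0; rewrite /Num.Def.normr/= mx_normrE; split => [xr i|xr].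
  by apply: le_trans xr; exact: (le_bigmax _ (fun i => `|x i.1 i.2|) (ord0, i)).
apply: bigmax_le => [|[k i] _ /=]; first exact: r0.
by rewrite (ord1 k); exact: xr.
Qed.

Lemma normr_coord_le x i : `|x ord0 i| <= `|x|.
Proof. by have /normr_rV_le := lexx `|x|; apply. Qed.

Lemma measurable_fun_addrV (b : 'rV[R]_n) :
  measurable_fun setT (fun x : 'rV[R]_n => x + b).
Proof.
apply: measurable_fun_rV => i; under eq_fun do rewrite !mxE.
by apply: measurable_funD => //; exact: measurable_coord_rV.
Qed.

(** Positive and negative parts are shifted separately, so that integrability can be deduced from
    this identity instead of being assumed. *)
Lemma integral_rV_shift (b : 'rV[R]_n) (q : 'rV[R]_n -> \bar R) :
  measurable_fun setT q ->
  (\int[lam]_x q (x + b)%R = \int[lam]_x q x)%E.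
Proof.
move=> mq; rewrite integralE [RHS]integralE.
have H (p : 'rV[R]_n -> \bar R) : measurable_fun setT p ->
    (forall x, 0 <= p x)%E -> (\int[lam]_x p (x + b)%R = \int[lam]_x p x)%E.
  move=> mp p0; have := @ge0_integral_rV_affine R n 1 b p ltr01 mp p0.
  under eq_integral do rewrite scale1r.
  by rewrite expr1n invr1 mul1e.
congr (_ - _)%E.
  rewrite -(H q^\+%E)//; last exact: measurable_funepos mq.
  by apply: eq_integral => x _; rewrite !funeposE.
rewrite -(H q^\-%E)//; last exact: measurable_funeneg mq.
by apply: eq_integral => x _; rewrite !funenegE.
Qed.

Lemma integrable_rV_shift (b : 'rV[R]_n) (q : 'rV[R]_n -> \bar R) :
  lam.-integrable setT q -> lam.-integrable setT (fun x => q (x + b)).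
Proof.
move=> /integrableP[mq qoo]; apply/integrableP; split.
  exact: (measurableT_comp mq (measurable_fun_addrV b)).
by rewrite (integral_rV_shift b (q := abse \o q)) //; exact: measurableT_comp.
Qed.

Lemma Rintegral_rV_shift (b : 'rV[R]_n) (q : 'rV[R]_n -> R) :
  measurable_fun setT q -> \int[lam]_x q (x + b) = \int[lam]_x q x.
Proof.
move=> mq; congr fine; apply: (integral_rV_shift b (q := EFin \o q)).
exact/measurable_EFinP.
Qed.

Lemma lebesgue_rV_cube k : (lam (@cube R n k) < +oo)%E.
Proof.
have -> : @cube R n k = [set v | forall i : 'I_n, `[- k%:R, k%:R]%classic (v ord0 i)].
  apply/seteqP; split => x /=.
    by move=> /normr_rV_le xk i; rewrite in_itv/= -ler_norml; exact: xk.
  by move=> xk; apply/normr_rV_le => // i; have := xk i; rewrite in_itv/= -ler_norml.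
rewrite (@lebesgue_rV_box R n (fun=> `[- k%:R, k%:R]%classic))//.
rewrite lebesgue_measure_itv/=.
set c := (if _ then _ else _).
have -> : c = (fine c)%:E by rewrite fineK// /c; case: ifP.
by rewrite prodEFin ltry.
Qed.
End rV_facts.

(** * Differential calculus in R^n *)

Section calculus_rV.
Variables (R : realType) (n : nat).
Notation lam := (lebesgue_rV R n).
Notation "''e_' i" := (delta_mx ord0 i : 'rV[R]_n) (at level 8, i at level 2).
Implicit Types (x y v : 'rV[R]_n) (g : 'rV[R]_n -> R).

(** The radius is taken in the maximum norm, to match [cube]; radii then add up under
    translations. *)
Definition supported (r : R) g := forall x, r < `|x| -> g x = 0.

Definition C1c (r : R) g : Prop :=
  [/\ supported r g, continuous g &
      forall i, (forall x, derivable g x 'e_i) /\ continuous (partial i g)].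

(** Restriction to a line turns directional derivatives into derivatives in one variable, where the
    mean value theorem and the chain rule apply. *)
Lemma is_derive_line g v x (t : R) : derivable g (t *: v + x) v ->
  is_derive t 1 (fun h : R => g (h *: v + x)) ('D_v g (t *: v + x)).
Proof.
move=> dg.
have E : (fun h : R => h^-1 *: (((fun h : R => g (h *: v + x)) \o shift t) (h *: 1)
    - g (t *: v + x))) =
  (fun h : R => h^-1 *: ((g \o shift (t *: v + x)) (h *: v) - g (t *: v + x))).
  by apply/funext => h /=; rewrite [h%:A]mulr1 scalerDl addrA.
split; last by rewrite /derive; move: E => /= ->.
by rewrite /derivable; move: E => /= ->.
Qed.

Lemma MVT_line g v x (h M : R) : (forall y, derivable g y v) ->
  (forall y, `|'D_v g y| <= M) -> `|g (h *: v + x) - g x| <= M * `|h|.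
Proof.
move=> dg gM; pose f (t : R) := g (t *: v + x).
have df (t : R) : is_derive t 1 f ('D_v g (t *: v + x)) by exact: is_derive_line.
have cf : continuous f.
  by move=> t; apply/differentiable_continuous/derivable1_diffP; have [] := df t.
have -> : g x = f 0 by rewrite /f scale0r add0r.
rewrite -/(f h).
wlog h0 : h / 0 <= h.
  move=> wl; have [h0|/ltW h0] := leP 0 h; first exact: wl.
  have [c _ E] := @MVT_segment R f (fun t => 'D_v g (t *: v + x)) h 0 h0
    (fun t _ => df t) (continuous_subspaceT cf).
  by rewrite distrC E sub0r normrM normrN ler_wpM2r.
have [c _ ->] := @MVT_segment R f (fun t => 'D_v g (t *: v + x)) 0 h h0
  (fun t _ => df t) (continuous_subspaceT cf).
by rewrite subr0 normrM ler_wpM2r.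
Qed.

(** A staircase from x to y changes one coordinate at a time, so each step is a mean value estimate
    along a basis vector. Only partial derivatives enter, at the price of the factor n. *)
Lemma partial_lipschitz g (M : R) : 0 <= M ->
  (forall i x, derivable g x 'e_i) -> (forall i x, `|partial i g x| <= M) ->
  forall x y, `|g y - g x| <= n%:R * M * `|y - x|.
Proof.
move=> M0 dg gM x y.
pose p (k : nat) : 'rV[R]_n := \row_j (if (j < k)%N then y ord0 j else x ord0 j).
have p0 : p 0%N = x by apply/rowP => j; rewrite mxE.
have pn : p n = y by apply/rowP => j; rewrite mxE ltn_ord.
have -> : g y - g x = \sum_(k < n) (g (p k.+1) - g (p k)).
  rewrite -(big_mkord xpredT (fun k => g (p k.+1) - g (p k))).
  by rewrite telescope_sumr// p0 pn.
apply: le_trans (ler_norm_sum _ _ _) _.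
rewrite -mulrA -[X in X%:R]card_ord mulr_natl -sumr_const.
apply: ler_sum => k _.
have -> : p k.+1 = (y ord0 k - x ord0 k) *: 'e_k + p k.
  apply/rowP => j; rewrite !mxE eqxx/= ltnS.
  have [->|jk] := eqVneq j k; first by rewrite leqnn ltnn mulr1 subrK.
  by rewrite mulr0 add0r (ltn_neqAle j k) jk.
apply: le_trans (MVT_line _ _ (dg k) (gM k)) _.
rewrite ler_wpM2l//.
by have := normr_coord_le (y - x) k; rewrite !mxE.
Qed.

Lemma compact_cube k : compact (@cube R n k).
Proof.
apply: bounded_closed_compact; first exact: bounded_cube.
rewrite (_ : @cube R n k = Num.norm @^-1` [set t : R | t <= k%:R])//.
apply: preimage_closed; last exact: closed_le.
by move=> x _; exact: norm_continuous.
Qed.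

Lemma supported_bounded g r : supported r g -> continuous g ->
  exists2 M, 0 <= M & forall x, `|g x| <= M.
Proof.
move=> sg cg.
have [k rk] : exists k : nat, r <= k%:R.
  exists (Num.truncn `|r|).+1; apply/ltW/(le_lt_trans (ler_norm r)).
  by rewrite Num.Theory.truncnS_gt.
have := continuous_compact (continuous_subspaceT cg) (@compact_cube k).
move=> /compact_bounded[M [_ HM]].
exists (`|M| + 1) => [|x]; first by rewrite addr_ge0.
have [xk|kx] := leP `|x| k%:R.
  apply: (HM (`|M| + 1)); last by exists x.
  by rewrite (le_lt_trans (ler_norm _))// ltrDl.
by rewrite sg ?normr0 ?addr_ge0// (le_lt_trans rk).
Qed.

Lemma normrZ_delta_le (i : 'I_n) (h : R) : `|h *: 'e_i : 'rV[R]_n| <= `|h|.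
Proof.
apply/normr_rV_le => // j; rewrite !mxE eqxx/=.
by case: (j == i); rewrite ?mulr1 ?mulr0 ?normr0.
Qed.

Lemma supported_partial r g i : supported r g -> supported r (partial i g).
Proof.
move=> sg x rx; rewrite /partial /derive; apply: cvg_lim => //.
(* The strict inequality r < |x| leaves room: the difference quotient vanishes identically for |h| <
   |x| - r. *)
apply: (@cvg_trans _ (@cst R R 0 h @[h --> 0^'])); last exact: cvg_cst.
apply: near_eq_cvg; near=> h; rewrite /= [g x]sg// sg ?subrr ?scaler0//.
have hr : `|h| < `|x| - r by near: h; apply: dnbhs0_lt; rewrite subr_gt0.
have he := normrZ_delta_le i h.
have := ler_normB (h *: 'e_i + x) (h *: 'e_i); rewrite addrC addKr => H.
by move: H he hr; lra.
Unshelve. all: by end_near. Qed.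

Lemma C1c_bounds r g : C1c r g ->
  exists2 M, 0 <= M & (forall x, `|g x| <= M) /\ (forall i x, `|partial i g x| <= M).
Proof.
move=> [sg cg dg]; have [M M0 gM] := supported_bounded sg cg.
have /choice[N HN] i : exists N, 0 <= N /\ forall x, `|partial i g x| <= N.
  have [N N0 gN] := supported_bounded (@supported_partial r g i sg) (dg i).2.
  by exists N.
exists (M + \sum_i N i).
  by rewrite addr_ge0// sumr_ge0// => i _; have [] := HN i.
split => [x|i x]; first by rewrite ler_wpDr ?gM// sumr_ge0// => i _; have [] := HN i.
rewrite ler_wpDl// (bigD1 i)//= ler_wpDr//; last exact: (HN i).2.
by rewrite sumr_ge0// => j _; have [] := HN j.
Qed.

Lemma C1c_lipschitz r g : C1c r g ->
  exists2 L, 0 <= L & forall x y, `|g y - g x| <= L * `|y - x|.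
Proof.
move=> C; have [_ _ dg] := C; have [M M0 [_ gM]] := C1c_bounds C.
exists (n%:R * M); first by rewrite mulr_ge0.
by apply: partial_lipschitz => // i; exact: (dg i).1.
Qed.

Lemma radius_lt_nat (r : R) : exists k : nat, r <= k%:R.
Proof.
exists (Num.truncn `|r|).+1; apply/ltW/(le_lt_trans (ler_norm r)).
by rewrite Num.Theory.truncnS_gt.
Qed.

Lemma integrable_indic_cube (M : R) k :
  lam.-integrable setT (fun x => (M * \1_(@cube R n k) x)%:E).
Proof.
have mk := @measurable_cube R n k.
under eq_fun do rewrite EFinM.
apply: integrableZl => //; apply/integrableP; split; first exact/measurable_EFinP.
under eq_integral do rewrite gee0_abs ?lee_fin//.
by rewrite integral_indic// setIT lebesgue_rV_cube.
Qed.

Lemma bounded_supported_le r g (M : R) k : 0 <= M -> r <= k%:R ->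
  supported r g -> (forall x, `|g x| <= M) ->
  forall x, `|g x| <= M * \1_(@cube R n k) x.
Proof.
move=> M0 rk sg gM x; rewrite indicE; have [xk|kx] := boolP (x \in @cube R n k).
  by rewrite mulr1.
rewrite mulr0 sg ?normr0//; apply: le_lt_trans rk _.
by move/negP : kx => kx; rewrite ltNge; apply/negP => xk; apply: kx; rewrite inE.
Qed.

Lemma bounded_supported_integrable r g (M : R) : measurable_fun setT g ->
  supported r g -> (forall x, `|g x| <= M) -> lam.-integrable setT (EFin \o g).
Proof.
move=> mg sg gM; have [k rk] := radius_lt_nat r.
have M0 : 0 <= M by apply: le_trans (gM 0).
apply: le_integrable (integrable_indic_cube M k) => //; first exact/measurable_EFinP.
move=> x _ /=; rewrite lee_fin (le_trans _ (ler_norm _))//.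
exact: (bounded_supported_le M0 rk sg gM).
Qed.

Lemma supported_integrable r g : supported r g -> continuous g ->
  lam.-integrable setT (EFin \o g).
Proof.
move=> sg cg; have [M M0 gM] := supported_bounded sg cg.
exact: (bounded_supported_integrable (continuous_measurable_rV cg) sg gM).
Qed.

(** The difference quotients have integral 0 by translation invariance, and dominated convergence
    passes this to the derivative. *)
Lemma Rintegral_partial r g i : C1c r g -> \int[lam]_x partial i g x = 0.
Proof.
move=> C; have [sg cg dg] := C; have [M M0 [_ gM]] := C1c_bounds C.
pose h k : R := k.+1%:R^-1.
pose f_ k x := (h k)^-1 * (g (h k *: 'e_i + x) - g x).
have mg : measurable_fun setT g by exact: continuous_measurable_rV.
have [k rk] : exists k : nat, r + 1 <= k%:R.
  exists (Num.truncn `|r + 1|).+1; apply/ltW/(le_lt_trans (ler_norm (r+1))).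
  by rewrite Num.Theory.truncnS_gt.
have mk := @measurable_cube R n k.
have h0 j : 0 < h j by rewrite invr_gt0.
have h1 j : h j <= 1 by rewrite invf_le1// ler1n.
have mgs j : measurable_fun setT (fun x => g (h j *: 'e_i + x)).
  under eq_fun do rewrite addrC.
  exact: (measurableT_comp mg (measurable_fun_addrV _)).
have mf j : measurable_fun setT (f_ j).
  by apply: measurable_funM => //; exact: measurable_funB.
have ig := supported_integrable sg cg.
have f0 j : \int[lam]_x f_ j x = 0.
  have igs : lam.-integrable setT (EFin \o (fun x => g (h j *: 'e_i + x))).
    have := integrable_rV_shift (h j *: 'e_i) ig.
    by under eq_fun do rewrite addrC.
  rewrite RintegralZl ?RintegralB//.
    under eq_Rintegral do rewrite addrC.
    by rewrite Rintegral_rV_shift// subrr mulr0.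
  by have := integrableB measurableT igs ig; apply: eq_integrable.
(* Since h j <= 1, all difference quotients are supported within radius r + 1 <= k, and the mean
   value theorem bounds them by M. *)
pose G x := M * \1_(@cube R n k) x.
have fG j x : `|f_ j x| <= G x.
  apply: (@bounded_supported_le (r + 1)) => // {}x.
    move=> rx; rewrite /f_ [g x]sg; last by rewrite (lt_trans _ rx)// ltrDl.
    rewrite sg ?subrr ?mulr0//.
    have := normrZ_delta_le i (h j); rewrite gtr0_norm// => he.
    have := ler_normB (h j *: 'e_i + x) (h j *: 'e_i); rewrite addrC addKr => H.
    by move: H he (h1 j) rx; lra.
  rewrite normrM gtr0_norm ?invr_gt0// ler_pdivrMl//.
  rewrite mulrC -[X in _ * X]gtr0_norm//.
  exact: (MVT_line _ _ (dg i).1 (gM i)).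
have cf x : f_ j x @[j --> \oo] --> partial i g x.
  have := (dg i).1 x; rewrite /derivable => /cvg_ex[l] dl.
  have -> : partial i g x = l by rewrite /partial /derive; exact/cvg_lim.
  move/cvgr_dnbhsP : dl => /(_ h); apply => //.
    by split => [j|]; [rewrite gt_eqF|exact: cvg_harmonic].
have := @dominated_cvg _ _ _ lam setT measurableT (fun j => EFin \o f_ j)
  (EFin \o partial i g) (EFin \o G).
move=> H; have {}H : (\int[lam]_x (f_ j x)%:E)%E @[j --> \oo] -->
    (\int[lam]_x (partial i g x)%:E)%E.
  apply: H => //.
  - by move=> j; exact/measurable_EFinP.
  - by move=> x _; apply: cvg_EFin; [exact: nearW|exact: cf].
  - exact: integrable_indic_cube.
  - by move=> j x _; rewrite lee_fin.
have {}H : (fun j => \int[lam]_x f_ j x) @ \oo --> \int[lam]_x partial i g x.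
  apply: fine_cvg; rewrite fineK//; apply: integrable_fin_num => //.
  have [_ spg] := (C, supported_partial i sg).
  exact: (supported_integrable spg (dg i).2).
move: H; rewrite (_ : (fun j => _) = cst 0); last exact/funext.
by move=> H; apply/esym; apply: cvg_unique H; [exact: norm_hausdorff|exact: cvg_cst].
Qed.

End calculus_rV.

(** * Smooth functions *)

Section smooth_functions.
Variables (R : realType) (n : nat).
Notation "''e_' i" := (delta_mx ord0 i : 'rV[R]_n) (at level 8, i at level 2).
Implicit Types (x : 'rV[R]_n) (g : 'rV[R]_n -> R).

Definition smooth g := forall k, Ck k g.

Lemma smooth_continuous g : smooth g -> continuous g.
Proof. by move=> /(_ 0)[]. Qed.

Lemma smooth_derivable g i x : smooth g -> derivable g x 'e_i.
Proof. by move=> /(_ 1)[_ /(_ i)[]]. Qed.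

Lemma smooth_partial g i : smooth g -> smooth (partial i g).
Proof. by move=> sg k; have [_ /(_ i)[]] := sg k.+1. Qed.

(** Coinduction principle: smoothness follows from membership in any class of continuous functions
    stable under partial derivatives, without an induction on the order in each application. *)
Lemma smooth_coind (S : set ('rV[R]_n -> R)) :
  (forall g, S g -> continuous g /\
    forall i, (forall x, derivable g x 'e_i) /\ S (partial i g)) ->
  forall g, S g -> smooth g.
Proof.
move=> HS g Sg k; elim: k g Sg => [|k IH] g /HS[cg dg]; first by split.
by split => // i; have [dgi Si] := dg i; split => //; exact: IH.
Qed.

Lemma smooth_C1c r g : smooth g -> supported r g -> C1c r g.
Proof.
move=> sg rg; split => //; first exact: smooth_continuous.
move=> i; split; first by move=> x; exact: smooth_derivable.
exact/smooth_continuous/smooth_partial.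
Qed.

End smooth_functions.

Lemma integrableM_bounded d (T : measurableType d) (R : realType)
    (m : {measure set T -> \bar R}) (w b : T -> R) (M : R) :
  m.-integrable setT (EFin \o w) -> measurable_fun setT b ->
  (forall t, `|b t| <= M) ->
  m.-integrable setT (EFin \o (fun t => w t * b t)).
Proof.
move=> iw mb bM; have mw : measurable_fun setT w.
  exact/measurable_EFinP/(measurable_int m).
have iMw : m.-integrable setT (fun t => M%:E * (EFin \o w) t)%E by exact: integrableZl.
apply: (le_integrable measurableT _ _ iMw) => /=.
  by apply/measurable_EFinP; exact: measurable_funM.
move=> t _; rewrite lee_fin !normrM mulrC ler_wpM2r//.
by rewrite (le_trans (bM t))// ler_norm.
Qed.

Lemma lipschitz_fun_continuous (R : realType) (V : normedModType R) (g : V -> R) L :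
  (forall x y, `|g y - g x| <= L * `|y - x|) -> continuous g.
Proof.
move=> gL x; apply/cvgrPdist_le => e e0.
have L0 : 0 < `|L| + 1 by rewrite ltr_wpDl.
near=> y; rewrite distrC (le_trans (gL _ _))//.
apply: (@le_trans _ _ ((`|L| + 1) * `|y - x|)).
  by rewrite ler_wpM2r// (le_trans (ler_norm L))// lerDl.
rewrite mulrC -ler_pdivlMr// distrC; apply: ltW.
near: y; apply/nbhs_normP; exists (e / (`|L| + 1)) => //=.
by rewrite divr_gt0.
Unshelve. all: by end_near. Qed.

(** * Superpositions of translates *)

Section convolution.
Context d (T : measurableType d) (R : realType) (n : nat).
Variables (m : {measure set T -> \bar R}) (w : T -> R) (Z : T -> 'rV[R]_n).
Hypothesis iw : m.-integrable setT (EFin \o w).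
Hypothesis mZ : measurable_fun setT Z.
Notation "''e_' i" := (delta_mx ord0 i : 'rV[R]_n) (at level 8, i at level 2).
Implicit Types (x y : 'rV[R]_n) (g : 'rV[R]_n -> R).

(** One notion for three uses: the near and the far average, where T consists of pairs (z, t) and Z
    is the first projection, and mollification, where the weight w is the function to be smoothed, Z
    y = - y and g is the bump. *)
Definition superpose g x : R := \int[m]_t (w t * g (x + Z t)).

Lemma measurable_superpose g x : measurable_fun setT g ->
  measurable_fun setT (fun t => g (x + Z t)).
Proof.
move=> mg; under eq_fun do rewrite addrC.
exact: (measurableT_comp mg (measurableT_comp (measurable_fun_addrV x) mZ)).
Qed.

Lemma integrable_superpose g M x : measurable_fun setT g ->
  (forall y, `|g y| <= M) ->
  m.-integrable setT (EFin \o (fun t => w t * g (x + Z t))).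
Proof.
move=> mg gM; apply: (integrableM_bounded (M := M)) => //.
exact: measurable_superpose.
Qed.

Lemma superpose_lipschitz g M L : continuous g -> (forall y, `|g y| <= M) ->
  (forall x y, `|g y - g x| <= L * `|y - x|) ->
  forall x y, `|superpose g y - superpose g x| <=
    (\int[m]_t `|w t|) * L * `|y - x|.
Proof.
move=> cg gM gL x y; have mg := continuous_measurable_rV cg.
have iy := integrable_superpose y mg gM; have ix := integrable_superpose x mg gM.
rewrite /superpose -RintegralB//.
have iB := integrableB measurableT iy ix.
apply: le_trans (le_normr_Rintegral measurableT _) _.
  by apply: eq_integrable iB.
have iaw : m.-integrable setT (EFin \o (fun t => `|w t|)) by exact: integrable_norm iw.
rewrite -mulrA -RintegralZr//; apply: le_Rintegral => //.
- by apply: integrable_norm; apply: eq_integrable iB.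
- by under eq_fun do rewrite mulrC; exact: (integrableZl measurableT (L * `|y - x|) iaw).
move=> t _; rewrite -mulrBr normrM ler_wpM2l//.
by apply: le_trans (gL _ _) _; rewrite opprD addrACA subrr addr0.
Qed.

(** Differentiation under the integral along the line through x, dominated by M |w|. The derivative
    falls on g, so integrability is all that is asked of w. *)
Lemma superpose_is_derive r g i x : C1c r g ->
  derivable (superpose g) x 'e_i /\
  partial i (superpose g) x = superpose (partial i g) x.
Proof.
move=> C; have [sg cg dg] := C; have [M M0 [gM pM]] := C1c_bounds C.
have mg := continuous_measurable_rV cg.
pose f (h : R) t := w t * g (h *: 'e_i + (x + Z t)).
have df (h : R) t : is_derive h 1 (f ^~ t) (w t * partial i g (h *: 'e_i + (x + Z t))).
  apply: is_deriveZ; apply: is_derive_line; exact: (dg i).1.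
have dv (h : R) t : 'D_1 (f ^~ t) h = w t * partial i g (h *: 'e_i + (x + Z t)).
  by have D := df h t; rewrite derive_val.
have iaw : m.-integrable setT (EFin \o (fun t => `|w t|)) by exact: integrable_norm iw.
have H := @cvg_differentiation_under_integral R _ T m f setT measurableT 0 (-1) 1.
have {}H : (h : R)^-1 *: ((\int[m]_t f (h + 0) t) - \int[m]_t f 0 t) @[h --> 0^'] -->
    \int[m]_t (partial1of2 f) 0 t.
  apply: (H _ _ _ (fun t => M * `|w t|)) => //.
  - by rewrite /= in_itv/= ltrN10 ltr01.
  - move=> h _; rewrite /f.
    under eq_fun do rewrite addrA; exact: integrable_superpose gM.
  - by move=> t; rewrite mulr_ge0.
  - exact: (integrableZl measurableT M iaw).
  - move=> h t _ _; rewrite /partial1of2 derive1E dv.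
    by rewrite normrM mulrC ler_wpM2r.
have cF : h^-1 *: (superpose g (h *: 'e_i + x) - superpose g x) @[h --> 0^'] -->
    superpose (partial i g) x.
  have -> : superpose (partial i g) x = \int[m]_t (partial1of2 f) 0 t.
    apply: eq_Rintegral => t _; rewrite /partial1of2 derive1E dv.
    by rewrite scale0r add0r.
  move: H; rewrite [X in X @ _](_ : _ =
    (fun h => h^-1 *: (superpose g (h *: 'e_i + x) - superpose g x)))//.
  apply/funext => h; rewrite addr0 /superpose /f; congr (_ *: (_ - _)).
    by apply: eq_Rintegral => t _; rewrite addrA.
  by apply: eq_Rintegral => t _; rewrite scale0r add0r.
split; last by rewrite /partial /derive; exact/cvg_lim.
by apply/cvg_ex; exists (superpose (partial i g) x).
Qed.

Lemma superpose_smooth r g : smooth g -> supported r g -> smooth (superpose g).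
Proof.
(* Superpositions of smooth functions with this support form a class stable under partial
   derivatives, because the derivative is again the superposition of a member. *)
move=> sg rg; pose S : set ('rV[R]_n -> R) :=
  [set superpose h | h in [set h | smooth h /\ supported r h]].
suff HS h : S h -> continuous h /\
    forall i, (forall x, derivable h x 'e_i) /\ S (partial i h).
  by apply: (smooth_coind HS); exists g.
move=> [{}g [{}sg {}rg] <-{h}]; have C := smooth_C1c sg rg.
have [M _ [gM _]] := C1c_bounds C; have [L _ gL] := C1c_lipschitz C.
split.
  apply: lipschitz_fun_continuous.
  exact: (superpose_lipschitz (smooth_continuous sg) gM gL).
move=> i; split => [x|]; first by have [] := superpose_is_derive i x C.
exists (partial i g).
  by split; [exact: smooth_partial|exact: supported_partial].
by apply/funext => x; have [_ ->] := superpose_is_derive i x C.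
Qed.

Lemma superpose_supported r rho g : supported r g ->
  (forall t, w t != 0 -> `|Z t| <= rho) -> supported (r + rho) (superpose g).
Proof.
move=> rg wZ x rx; rewrite /superpose (@eq_Rintegral _ _ _ _ _ (fun=> 0)).
  by rewrite Rintegral_cst// mul0r.
move=> t _; have [->|wt] := eqVneq (w t) 0; first by rewrite mul0r.
rewrite rg ?mulr0//.
have := wZ t wt; have := ler_normB (x + Z t) (Z t); rewrite addrK.
by move: rx; lra.
Qed.
End convolution.

(** * Smooth bumps *)

Section bump.
Variable R : realType.

(* The flat function exp (- 1 / x) divided by x^m: up to polynomial factors the family is
   stable under differentiation. *)
Definition flat (m : nat) (x : R) : R :=
  if 0 < x then x ^- m * expR (- x^-1) else 0.

Lemma flat_ge0 m x : 0 <= flat m x.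
Proof.
rewrite /flat; case: ifPn => // x0.
by rewrite mulr_ge0 ?expR_ge0// invr_ge0 exprn_ge0// ltW.
Qed.

(** One term of the exponential series, of order m + 1 in 1 / x, absorbs the factor x^(-m) and
    leaves one power of x. This gives the derivative at 0. *)
Lemma flat_le m (x : R) : flat m x <= m.+1`!%:R * `|x|.
Proof.
rewrite /flat; case: ifPn => [x0|_]; last by rewrite mulr_ge0.
have xi : 0 <= x^-1 by rewrite invr_ge0 ltW.
have := expR_ge1Dxn m xi; rewrite expRN => /(le_trans _ ) H.
have {}H : (x^-1) ^+ m.+1 / m.+1`!%:R <= expR x^-1 by apply: H; rewrite lerDr.
have f0 : 0 < (m.+1`!%:R : R) by rewrite ltr0n fact_gt0.
rewrite ler_pdivrMr ?expR_gt0// gtr0_norm// mulrAC.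
have := ler_wpM2l (mulr_ge0 (ltW f0) (ltW x0)) H.
rewrite mulrA (mulrAC _ (expR _)) => /(le_trans _); apply.
rewrite exprVn exprS invfM -mulrA mulrCA.
rewrite (_ : _ * _ = x ^- m)//; field.
by rewrite !gt_eqF// exprn_gt0.
Qed.

Lemma is_derive_flat m (x : R) :
  is_derive x 1 (flat m) (flat m.+2 x - m%:R * flat m.+1 x).
Proof.
have [x0|x0|<-] := ltgtP 0 x.
- have xn : x != 0 by rewrite gt_eqF.
  have dV : is_derive x 1 (fun y : R => y^-1) (- x ^- 2 *: 1).
    exact: (is_deriveV (f := id)).
  (* In the variable u = 1 / x the function is u^m exp (- u); its derivative is transported back by
     the chain rule. *)
  have dg (u : R) : is_derive u 1 (fun u : R => u ^+ m * expR (- u))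
      (m%:R * u ^+ m.-1 * expR (- u) - u ^+ m * expR (- u)).
    have d1 : is_derive u 1 (fun u : R => u ^+ m) (m%:R * u ^+ m.-1).
      have E : (id : R -> R) ^+ m = (fun u : R => u ^+ m).
        by apply/funext => y; rewrite exprfctE.
      have := @is_deriveX R R id m u 1 1 (is_derive_id u 1).
      by rewrite E /= [_ *: _]mulr1.
    have d2 : is_derive u 1 (fun u : R => expR (- u)) (- expR (- u)).
      have := @is_derive1_comp R expR -%R u _ _ (is_derive_expR (- u)) (is_deriveNid u 1).
      by rewrite mulrN1.
    have := is_deriveM d1 d2; rewrite (_ : _ *: _ + _ = m%:R * u ^+ m.-1 * expR (- u) -
        u ^+ m * expR (- u))//.
    by rewrite /GRing.scale/=; ring.
  have := @is_derive1_comp _ _ _ x _ _ (dg x^-1) dV.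
  rewrite (_ : _ * _ = flat m.+2 x - m%:R * flat m.+1 x); last first.
    rewrite /flat x0 /GRing.scale/= mulr1 -!exprVn mulrN mulrBl opprB.
    congr (_ - _); first by rewrite mulrAC -exprD addn2.
    case: m {dg} => [|m]; first by rewrite !mul0r.
    rewrite mulrAC -[_ * _ * _ ^+ 2]mulrA -exprD addn2 /= -!mulrA; congr (_ * (_ * _)).
  apply: near_eq_is_derive; near=> y.
  have y0 : 0 < y by near: y; exact: lt_nbhsr.
  by rewrite /flat y0 /= exprVn.
- have := is_derive_cst (0 : R) x (1 : R).
  rewrite (_ : flat m.+2 x - _ = 0); last first.
    by rewrite /flat ltNge (ltW x0)/= mulr0 subr0.
  apply: near_eq_is_derive; near=> y.
  have y0 : y <= 0 by near: y; exact: lt_le_nbhsl.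
  by rewrite /flat ltNge y0.
have -> : flat m.+2 0 - m%:R * flat m.+1 0 = 0 by rewrite /flat ltxx mulr0 subr0.
suff H : h^-1 *: (flat m (h *: 1 + 0) - flat m 0) @[h --> (0:R)^'] --> (0:R).
  by split; [apply/cvg_ex; exists 0|exact/cvg_lim].
(* At 0 the difference quotient of [flat m] is [flat m.+1] itself, which tends to 0 by the linear
   bound [flat_le]. *)
have -> : (fun h : R => h^-1 *: (flat m (h *: 1 + 0) - flat m 0)) = flat m.+1.
  apply/funext => h; rewrite addr0 [_%:A]mulr1 /flat ltxx subr0.
  by case: ifPn => h0; rewrite ?scaler0// /GRing.scale/= mulrA exprS invfM.
apply/cvgrPdist_le => e e0; near=> h.
rewrite sub0r normrN ger0_norm ?flat_ge0// (le_trans (flat_le _ _))//.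
rewrite mulrC -ler_pdivlMr ?ltr0n ?fact_gt0//.
by near: h; apply: dnbhs0_le; rewrite divr_gt0// ltr0n fact_gt0.
Unshelve. all: by end_near. Qed.

Lemma continuous_flat m : continuous (flat m).
Proof.
move=> x; apply/differentiable_continuous/derivable1_diffP.
by have [] := is_derive_flat m x.
Qed.

End bump.

Section continuous_arith.
Variables (T : topologicalType) (R : realType).
Implicit Types f g : T -> R.

Lemma continuous_addr f g : continuous f -> continuous g ->
  continuous (fun x => f x + g x).
Proof. by move=> cf cg x; apply: cvgD; [exact: cf|exact: cg]. Qed.

Lemma continuous_subr f g : continuous f -> continuous g ->
  continuous (fun x => f x - g x).
Proof. by move=> cf cg x; apply: cvgB; [exact: cf|exact: cg]. Qed.

Lemma continuous_mulr f g : continuous f -> continuous g ->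
  continuous (fun x => f x * g x).
Proof. by move=> cf cg x; apply: cvgM; [exact: cf|exact: cg]. Qed.

Lemma continuous_cstr (c : R) : continuous (fun _ : T => c).
Proof. by move=> x; exact: cvg_cst. Qed.

Lemma continuous_sumr n (f : 'I_n -> T -> R) : (forall i, continuous (f i)) ->
  continuous (fun x => \sum_(i < n) f i x).
Proof. by move=> cf; apply: continuous_big => [|i _]; [exact: add_continuous|exact: cf]. Qed.

End continuous_arith.

Section mollification.
Variables (R : realType) (n : nat).
Notation "''e_' i" := (delta_mx ord0 i : 'rV[R]_n) (at level 8, i at level 2).
Implicit Types (x z : 'rV[R]_n) (g : 'rV[R]_n -> R).

Lemma continuous_dotv : continuous (fun z : 'rV[R]_n => dotv z z).
Proof.
by apply: continuous_sumr => i; apply: continuous_mulr; exact: coord_continuous.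
Qed.

(** The algebra generated by the radial bumps, the coordinates and the constants. It is stable under
    partial derivatives, which makes it a suitable class for [smooth_coind]. *)
Inductive flat_poly : ('rV[R]_n -> R) -> Prop :=
| flat_poly_flat m r : flat_poly (fun z => flat m (r - dotv z z))
| flat_poly_coord i : flat_poly (fun z => z ord0 i)
| flat_poly_cst c : flat_poly (fun=> c)
| flat_polyD g h : flat_poly g -> flat_poly h -> flat_poly (fun z => g z + h z)
| flat_polyM g h : flat_poly g -> flat_poly h -> flat_poly (fun z => g z * h z).

Lemma is_derive_of_line g x v (l : R) :
  is_derive (0 : R) 1 (fun h : R => g (h *: v + x)) l -> is_derive x v g l.
Proof.
move=> [dg dl].
have dgv : derivable g x v by apply/derivable1P.
split => //; rewrite -dl.
have := @is_derive_line R n g v x 0; rewrite scale0r add0r => /(_ dgv) D.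
by rewrite derive_val.
Qed.

Lemma is_derive_coord x i j : is_derive x 'e_i (fun z : 'rV[R]_n => z ord0 j) ((j == i)%:R).
Proof.
apply: is_derive_of_line.
rewrite (_ : (fun h : R => _) = (fun h : R => (j == i)%:R * h + x ord0 j)); last first.
  by apply/funext => h; rewrite !mxE eqxx/= mulrC.
have d1 : is_derive (0:R) 1 (fun h : R => (j == i)%:R * h) ((j == i)%:R).
  by have := @is_deriveZ R R R id (j == i)%:R 0 1 1 (is_derive_id (0 : R) 1); rewrite [_ *: 1]mulr1.
by have := is_deriveD d1 (is_derive_cst (x ord0 j) (0:R) (1:R)); rewrite addr0.
Qed.

Lemma is_derive_dotv x i : is_derive x 'e_i (fun z : 'rV[R]_n => dotv z z) (2 * x ord0 i).
Proof.
have := is_derive_sum (fun j : 'I_n => is_deriveM (is_derive_coord x i j) (is_derive_coord x i j)).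
rewrite (_ : \sum_(j < n) _ = fun z => dotv z z); last first.
  by apply/funext => z; rewrite fct_sumE.
rewrite (_ : \sum_(j < n) _ = 2 * x ord0 i)//.
rewrite (bigD1 i)//= big1 ?addr0 => [|j ji].
  by rewrite eqxx [_ *: _]mulr1 mulr_natl mulr2n.
by rewrite (negbTE ji) scaler0 addr0.
Qed.

Lemma is_derive_comp_dotv (F : R -> R) (dF r : R) x i :
  is_derive (r - dotv x x) 1 F dF ->
  is_derive x 'e_i (fun z => F (r - dotv z z)) (- (2 * x ord0 i * dF)).
Proof.
move=> DF; apply: is_derive_of_line.
have [d1 _] := is_derive_dotv x i.
have d2 : is_derive (0:R) 1 (fun h : R => r - dotv (h *: 'e_i + x) (h *: 'e_i + x))
    (0 - 2 * x ord0 i).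
  apply: is_deriveB.
  have := @is_derive_line R n (fun z => dotv z z) 'e_i x 0.
  rewrite scale0r add0r => /(_ d1).
  by have D := is_derive_dotv x i; rewrite derive_val.
have DF' : is_derive (r - dotv (0 *: 'e_i + x) (0 *: 'e_i + x)) 1 F dF.
  by rewrite scale0r add0r.
have := @is_derive1_comp R F _ 0 _ _ DF' d2.
by rewrite sub0r mulrN mulrC.
Qed.

Lemma flat_poly_derive g : flat_poly g -> continuous g /\
  forall i, (forall x, derivable g x 'e_i) /\ flat_poly (partial i g).
Proof.
have H g' (g'' : 'I_n -> 'rV[R]_n -> R) : (forall i x, is_derive x 'e_i g' (g'' i x)) ->
    (forall i, flat_poly (g'' i)) ->
    forall i, (forall x, derivable g' x 'e_i) /\ flat_poly (partial i g').
  move=> dg fg i; split; first by move=> x; have [] := dg i x.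
  by rewrite (_ : partial i g' = g'' i)//; apply/funext => x; have [] := dg i x.
elim => {g} [m r|j|c|g h fg [cg dg] fh [ch dh]|g h fg [cg dg] fh [ch dh]]; split.
- move=> z; apply: (continuous_comp (f := fun z => r - dotv z z)).
    by apply: continuous_subr; [exact: continuous_cstr|exact: continuous_dotv].
  exact: continuous_flat.
- apply: (H _ (fun i z => ((- 2) * z ord0 i) *
      (flat m.+2 (r - dotv z z) + (- m%:R) * flat m.+1 (r - dotv z z)))).
    move=> i x; have := is_derive_comp_dotv i (is_derive_flat m (r - dotv x x)).
    by rewrite !mulNr.
  move=> i; apply: flat_polyM.
    by apply: flat_polyM; [exact: flat_poly_cst|exact: flat_poly_coord].
  apply: flat_polyD; first exact: flat_poly_flat.
  by apply: flat_polyM; [exact: flat_poly_cst|exact: flat_poly_flat].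
- exact: coord_continuous.
- apply: (H _ (fun i z => (j == i)%:R)) => [i x|i]; last exact: flat_poly_cst.
  exact: is_derive_coord.
- exact: continuous_cstr.
- by apply: (H _ (fun i z => 0)) => i; exact: flat_poly_cst.
- exact: continuous_addr.
- apply: (H _ (fun i z => partial i g z + partial i h z)) => [i x|i].
    by apply: is_deriveD; apply: DeriveDef => //; [exact: (dg i).1|exact: (dh i).1].
  by apply: flat_polyD; [exact: (dg i).2|exact: (dh i).2].
- exact: continuous_mulr.
- apply: (H _ (fun i z => g z * partial i h z + h z * partial i g z)) => [i x|i].
    by apply: is_deriveM; apply: DeriveDef => //; [exact: (dg i).1|exact: (dh i).1].
  by apply: flat_polyD; apply: flat_polyM => //; [exact: (dh i).2|exact: (dg i).2].
Qed.

Lemma flat_poly_smooth g : flat_poly g -> smooth g.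
Proof. exact: (smooth_coind flat_poly_derive). Qed.

End mollification.

(** * Integration against vector measures *)

Section charge_integral_theory.
Context d (T : measurableType d) (R : realType).
Variable nu : {charge set T -> \bar R}.

Let fin_integrable (m : {finite_measure set T -> \bar R}) (g : T -> R) (M : R) :
  measurable_fun setT g -> (forall x, `|g x| <= M) ->
  m.-integrable setT (EFin \o g).
Proof.
move=> mg gM; have ic : m.-integrable setT (EFin \o (cst M : T -> R)).
  exact: finite_measure_integrable_cst.
apply: le_integrable ic => //; first exact/measurable_EFinP.
by move=> x _ /=; rewrite lee_fin (le_trans (gM x))// ler_norm.
Qed.

Lemma charge_integralB (g h : T -> R) (M : R) :
  measurable_fun setT g -> measurable_fun setT h ->
  (forall x, `|g x| <= M) -> (forall x, `|h x| <= M) ->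
  charge_integral nu g - charge_integral nu h =
  charge_integral nu (fun x => g x - h x).
Proof.
move=> mg mh gM hM; rewrite /charge_integral.
have ig (m : {finite_measure set T -> \bar R}) := fin_integrable m mg gM.
have ih (m : {finite_measure set T -> \bar R}) := fin_integrable m mh hM.
by rewrite !RintegralB//; solve [ring | exact: ig | exact: ih].
Qed.

Lemma charge_integral_le : exists2 C : R, 0 <= C & forall (g : T -> R) (e : R),
  measurable_fun setT g -> (forall x, `|g x| <= e) ->
  `|charge_integral nu g| <= C * e.
Proof.
pose p := jordan_pos (hahn_setP nu); pose q := jordan_neg (hahn_setP nu).
exists (fine (p setT) + fine (q setT)).
  by rewrite addr_ge0// fine_ge0.
move=> g e mg ge; rewrite /charge_integral mulrDl.
apply: le_trans (ler_normB _ _) _.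
have H (m : {finite_measure set T -> \bar R}) : `|\int[m]_x g x| <= fine (m setT) * e.
  apply: le_trans (le_normr_Rintegral _ _) _ => //.
    exact: (fin_integrable _ mg ge).
  rewrite mulrC -Rintegral_cst//; apply: le_Rintegral => //.
    by apply: integrable_norm; exact: (fin_integrable _ mg ge).
  exact: finite_measure_integrable_cst.
by apply: lerD; exact: H.
Qed.

End charge_integral_theory.

Section vintegral_theory.
Variables (R : realType) (n : nat).
Implicit Types (mu : radon_vmeasure R n) (phi psi : 'rV[R]_n -> 'rV[R]_n).

(** Fixing the cube that contains the support turns [vintegral] into a finite sum of integrals
    against finite charges, and allows constants that depend on the field through k only. *)
Definition Cck (k : nat) phi : Prop := forall i : 'I_n,
  supported k%:R (fun x => phi x ord0 i) /\ continuous (fun x => phi x ord0 i).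

(** The charge of the small cube is the charge of the large one restricted to the small cube, so a
    Hahn decomposition for the large cube also serves the small one. *)
Let vcharge_hahn mu k l i : (k <= l)%N ->
  hahn_decomposition (vcharge mu k i) (hahn_set_pos (vcharge mu l i))
    (hahn_set_neg (vcharge mu l i)).
Proof.
move=> kl; have [[mP P0] [mN N0] PN1 PN2] := hahn_setP (vcharge mu l i).
have kE E : vcharge mu k i E = vcharge mu l i (E `&` @cube R n k).
  rewrite /vcharge -setIA (_ : @cube R n k `&` @cube R n l = @cube R n k)//.
  by apply: setIidl => x /= /le_trans; apply; rewrite ler_nat.
have mk := @measurable_cube R n k.
split => //; split => // E mE EP.
  suff : (0 <= vcharge mu k i E)%E by [].
  by rewrite kE; apply: P0; [exact: measurableI|move=> x [/EP]].
suff : (vcharge mu k i E <= 0)%E by [].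
by rewrite kE; apply: N0; [exact: measurableI|move=> x [/EP]].
Qed.

(** By uniqueness of the Jordan parts, those of the two charges agree on subsets of the small cube,
    outside of which g vanishes. Hence the sequence that defines [vintegral] is eventually
    constant. *)
Lemma charge_integral_vcharge mu k l i g : (k <= l)%N -> supported k%:R g ->
  charge_integral (vcharge mu l i) g = charge_integral (vcharge mu k i) g.
Proof.
move=> kl sg; have H := vcharge_hahn mu i kl.
have mk := @measurable_cube R n k.
have [[mPl _] [mNl _] _ _] := hahn_setP (vcharge mu l i).
have [[mPk _] [mNk _] _ _] := hahn_setP (vcharge mu k i).
have sE : g = g \_ (@cube R n k).
  apply/funext => x; rewrite patchE; case: ifPn => // /negP xk; apply: sg.
  by rewrite ltNge; apply/negP => xk'; apply: xk; rewrite inE.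
have lE E : E `<=` @cube R n k -> vcharge mu l i E = vcharge mu k i E.
  move=> Ek; rewrite /vcharge !setIidl//.
  by apply: subset_trans Ek _ => x /= /le_trans; apply; rewrite ler_nat.
rewrite /charge_integral; congr (_ - _).
  rewrite sE -!Rintegral_mkcond; congr fine; apply: eq_measure_integral => A mA Ak.
  rewrite /= !jordan_posE !cjordan_posE /= /crestr0 !mem_set// /crestr lE; last first.
    by move=> x [/Ak].
  exact: (Hahn_decomposition_uniq H (hahn_setP _) mA).1.
rewrite sE -!Rintegral_mkcond; congr fine; apply: eq_measure_integral => A mA Ak.
rewrite /= !jordan_negE !cjordan_negE /= /crestr0 !mem_set// /crestr lE; last first.
  by move=> x [/Ak].
congr oppe.
exact: (Hahn_decomposition_uniq H (hahn_setP _) mA).2.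
Qed.

Lemma vintegralE mu k phi : Cck k phi ->
  vintegral mu phi =
  \sum_(i < n) charge_integral (vcharge mu k i) (fun x => phi x ord0 i).
Proof.
move=> Cphi; apply: cvg_lim => //; apply: cvg_near_cst.
near=> l; apply: eq_bigr => i _; apply: charge_integral_vcharge; last exact: (Cphi i).1.
by near: l; exact: nbhs_infty_ge.
Unshelve. all: by end_near. Qed.

Lemma Cck_le k l phi : (k <= l)%N -> Cck k phi -> Cck l phi.
Proof.
move=> kl Cphi i; split; last exact: (Cphi i).2.
by move=> x lx; apply: (Cphi i).1; rewrite (le_lt_trans _ lx)// ler_nat.
Qed.

Lemma CckB k phi psi : Cck k phi -> Cck k psi -> Cck k (fun x => phi x - psi x).
Proof.
move=> Cphi Cpsi i; have [sphi cphi] := Cphi i; have [spsi cpsi] := Cpsi i.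
split=> [x kx|]; first by rewrite !mxE sphi// spsi// subrr.
under eq_fun do rewrite !mxE; exact: continuous_subr.
Qed.

Lemma vintegralB mu k phi psi : Cck k phi -> Cck k psi ->
  vintegral mu phi - vintegral mu psi = vintegral mu (fun x => phi x - psi x).
Proof.
move=> Cphi Cpsi; rewrite !(@vintegralE _ k)//; last exact: CckB.
rewrite -sumrB; apply: eq_bigr => i _.
have [M1 M10 HM1] := supported_bounded (Cphi i).1 (Cphi i).2.
have [M2 M20 HM2] := supported_bounded (Cpsi i).1 (Cpsi i).2.
rewrite (@charge_integralB _ _ _ _ _ _ (M1 + M2))//.
- by congr charge_integral; apply/funext => x; rewrite !mxE.
- exact: continuous_measurable_rV (Cphi i).2.
- exact: continuous_measurable_rV (Cpsi i).2.
- by move=> x; rewrite ler_wpDr.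
- by move=> x; rewrite ler_wpDl.
Qed.

Lemma vintegral_le mu k : exists2 C : R, 0 <= C & forall phi (e : R), Cck k phi ->
  (forall x i, `|phi x ord0 i| <= e) -> `|vintegral mu phi| <= C * e.
Proof.
have /choice[C HC] (i : 'I_n) : exists C : R, 0 <= C /\
    forall (g : 'rV[R]_n -> R) (e : R),
    measurable_fun setT g -> (forall x, `|g x| <= e) ->
    `|charge_integral (vcharge mu k i) g| <= C * e.
  by have [C] := charge_integral_le (vcharge mu k i); exists C.
exists (\sum_i C i) => [|phi e Cphi phie].
  by apply: sumr_ge0 => i _; have [] := HC i.
rewrite !(@vintegralE mu k)// mulr_suml (le_trans (ler_norm_sum _ _ _))//.
apply: ler_sum => i _; apply: (HC i).2 => //.
exact: continuous_measurable_rV (Cphi i).2.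
Qed.

Lemma vintegral_dist mu k : exists2 C : R, 0 <= C &
  forall phi psi (e : R), Cck k phi -> Cck k psi ->
    (forall x i, `|phi x ord0 i - psi x ord0 i| <= e) ->
    `|vintegral mu phi - vintegral mu psi| <= C * e.
Proof.
have [C C0 HC] := vintegral_le mu k; exists C => // phi psi e Cphi Cpsi pe.
rewrite (vintegralB _ Cphi Cpsi); apply: HC; first exact: CckB.
by move=> x i; rewrite !mxE.
Qed.

End vintegral_theory.

(** * Density of smooth test fields *)

Section density.
Variables (R : realType) (n : nat).
Notation lam := (lebesgue_rV R n).
Implicit Types (x y z : 'rV[R]_n) (g : 'rV[R]_n -> R).

Lemma supported_unif_continuous r g : supported r g -> continuous g ->
  forall e : R, 0 < e -> exists2 d : R, 0 < d &
    forall x y, `|y - x| <= d -> `|g y - g x| <= e.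
Proof.
(* The margin 1 is for points outside the cube: a point within distance 1 of them is still beyond
   the radius r, so g vanishes at both. *)
move=> sg cg e e0; have [k rk] := radius_lt_nat (r + 1).
have e20 : 0 < e / 2 by rewrite divr_gt0.
pose P (d : R) x := forall y, `|y - x| <= d -> `|g y - g x| <= e.
have := compact_cube (R := R) (n := n) (k := k).
move=> /compact_near_coveringP/(_ R (nbhs (0:R)^'+) P _).
case=> [x _|d /= d0 Hd].
  have /(@cvgrPdist_lt _ _ _ (nbhs x) _ g (g x))/(_ _ e20) := cg x.
  move=> /nbhs_normP[eta /= eta0 Heta].
  exists (ball x (eta / 2), [set d : R | d < eta / 2]).
    split => /=; first by apply: nbhsx_ballx; rewrite divr_gt0.
    by apply: nbhs_right_lt; rewrite divr_gt0.
  move=> [x' d] /= [xx' dd] y yx'.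
  rewrite -ball_normE/= in xx'.
  have h1 : `|g x - g x'| < e / 2.
    by apply: Heta => /=; apply: lt_trans xx' _; lra.
  have h2 : `|g x - g y| < e / 2.
    apply: Heta => /=; have := ler_distD x' x y; move: xx' yx' dd.
    by rewrite (distrC y x'); lra.
  have := ler_distD (g x) (g y) (g x'); rewrite (distrC (g y) (g x)).
  by move: h1 h2; lra.
(* Compactness yields an open range of admissible radii below d, which contains d / 2; the bound 1
   is the margin chosen above. *)
pose d' := Num.min (d / 2) 1.
have d'0 : 0 < d' by rewrite lt_min ltr01 divr_gt0.
exists d' => // x y xy.
have dd' : d' < d by rewrite gt_min; apply/orP; left; lra.
have [xk|kx] := leP `|x| k%:R.
  by apply: (Hd d') => //=; rewrite sub0r normrN gtr0_norm.
have yx1 : `|y - x| <= 1 by apply: le_trans xy _; rewrite ge_min lexx orbT.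
rewrite !sg ?subrr ?normr0 ?ltW//.
  by apply: lt_trans kx; apply: lt_le_trans rk; rewrite ltrDl.
by have := ler_distD y x 0; rewrite !subr0 distrC; move: kx rk yx1; lra.
Qed.

Definition mollifier (d : R) (z : 'rV[R]_n) : R := flat 0 (d ^+ 2 - dotv z z).

Lemma smooth_mollifier d c : smooth (fun z => c * mollifier d z).
Proof.
apply: flat_poly_smooth; apply: flat_polyM; first exact: flat_poly_cst.
exact: flat_poly_flat.
Qed.

Lemma dotv_ge0 z : 0 <= dotv z z.
Proof. by apply: sumr_ge0 => i _; rewrite -expr2 sqr_ge0. Qed.

Lemma sqr_coord_le_dotv z i : z ord0 i ^+ 2 <= dotv z z.
Proof.
rewrite /dotv (bigD1 i)//= -expr2 lerDl; apply: sumr_ge0 => j _.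
by rewrite -expr2 sqr_ge0.
Qed.

Lemma sqr_normr_le_dotv z : `|z| ^+ 2 <= dotv z z.
Proof.
rewrite -[leRHS]sqr_sqrtr ?dotv_ge0// ler_pXn2r ?nnegrE ?sqrtr_ge0//.
apply/normr_rV_le; first exact: sqrtr_ge0.
by move=> i; rewrite -sqrtr_sqr ler_sqrt ?dotv_ge0// sqr_coord_le_dotv.
Qed.

Lemma supported_mollifier d : 0 <= d -> supported d (mollifier d).
Proof.
move=> d0 z dz; rewrite /mollifier /flat ifF//; apply/negbTE.
rewrite -leNgt subr_le0; apply: le_trans (sqr_normr_le_dotv z).
by rewrite ler_pXn2r ?nnegrE// ltW.
Qed.

Lemma mollifier_even d z : mollifier d (- z) = mollifier d z.
Proof.
by rewrite /mollifier /dotv; under eq_bigr do rewrite !mxE mulrNN.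
Qed.

Lemma mollifier_integral_gt0 d : 0 < d -> 0 < \int[lam]_z mollifier d z.
Proof.
move=> d0; have cm : continuous (mollifier d).
  apply: smooth_continuous; have := smooth_mollifier d 1.
  by under eq_fun do rewrite mul1r.
have im := supported_integrable (supported_mollifier (ltW d0)) cm.
(* On the cube of half-side d / N the squared Euclidean norm is at most n d^2 / N^2 <= d^2 / 2, so
   the bump is at least its value there; n + 1 keeps N positive for n = 0. *)
pose N := (2 * n.+1)%:R : R.
have N0 : 0 < N by rewrite ltr0n.
pose eta := d / N.
have eta0 : 0 < eta by rewrite divr_gt0.
pose B := [set z : 'rV[R]_n | forall i : 'I_n, `[- eta, eta]%classic (z ord0 i)].
have mB : measurable B.
  rewrite (_ : B = [set z : 'rV[R]_n | `|z| <= eta]).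
    apply: closed_measurable_rV.
    rewrite (_ : [set z | _] = Num.norm @^-1` [set t : R | t <= eta])//.
    apply: preimage_closed; last exact: closed_le.
    by move=> x _; exact: norm_continuous.
  apply/seteqP; split => x /=.
    move=> xB; apply/normr_rV_le; first exact: ltW.
    by move=> i; have : x ord0 i \in `[- eta, eta] := xB i; rewrite in_itv/= -ler_norml.
  by move=> /normr_rV_le H i; rewrite /= in_itv/= -ler_norml; apply: H; exact: ltW.
have lB : lam B = ((eta *+ 2) ^+ n)%:E.
  rewrite /B (@lebesgue_rV_box R n (fun=> `[- eta, eta]%classic))//.
  rewrite lebesgue_measure_itv/= lte_fin ifT; last by lra.
  rewrite (_ : (eta%:E - (- eta)%:E)%E = (eta *+ 2)%:E); last first.
    by rewrite -EFinB opprK mulr2n.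
  by rewrite prodEFin prodr_const card_ord.
have dB z : B z -> dotv z z <= d ^+ 2 / 2.
  move=> zB; rewrite /dotv.
  apply: (@le_trans _ _ (\sum_(i < n) eta ^+ 2)).
    apply: ler_sum => i _; have : z ord0 i \in `[- eta, eta] := zB i; rewrite in_itv/= -ler_norml => H.
    rewrite -expr2 -real_normK ?num_real//.
    by rewrite ler_pXn2r ?nnegrE// ltW.
  rewrite sumr_const card_ord /eta expr_div_n -[_ *+ n]mulr_natl.
  rewrite mulrCA ler_pM2l ?exprn_gt0// ler_pdivrMr ?exprn_gt0//.
  rewrite mulrC ler_pdivlMr// /N expr2 -!natrM ler_nat.
  by rewrite !mulnA mulnC leq_mul// (leq_trans (leqnSn n))// -mulnA leq_pmulr.
pose c := flat 0 (d ^+ 2 / 2).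
have c0 : 0 < c by rewrite /c /flat divr_gt0 ?exprn_gt0// mulr_gt0 ?expR_gt0// invr_gt0 expr0.
have cM z : c * \1_B z <= mollifier d z.
  rewrite indicE; have [/set_mem zB|_] := boolP (z \in B); last first.
    by rewrite mulr0 flat_ge0.
  have hz : d ^+ 2 / 2 <= d ^+ 2 - dotv z z by have := dB z zB; lra.
  have d20 : 0 < d ^+ 2 / 2 by rewrite divr_gt0 ?exprn_gt0.
  have hz0 : 0 < d ^+ 2 - dotv z z by exact: lt_le_trans hz.
  rewrite mulr1 /mollifier /c /flat d20 hz0 !expr0 invr1 !mul1r ler_expR lerN2.
  by rewrite lef_pV2.
apply: (@lt_le_trans _ _ (c * (eta *+ 2) ^+ n)).
  by rewrite mulr_gt0// exprn_gt0// mulrn_wgt0.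
have iB : lam.-integrable setT (EFin \o (\1_B : 'rV[R]_n -> R)).
  apply/integrableP; split; first exact/measurable_EFinP.
  under eq_integral do rewrite gee0_abs ?lee_fin//.
  rewrite integral_indic// setIT [X in (X < _)%E](_ : _ = ((eta *+ 2) ^+ n)%:E) ?ltry//.
have -> : c * (eta *+ 2) ^+ n = \int[lam]_z (c * \1_B z).
  rewrite RintegralZl// /Rintegral integral_indic// setIT.
  by rewrite [X in fine X](_ : _ = ((eta *+ 2) ^+ n)%:E).
apply: le_Rintegral => //.
exact: (integrableZl measurableT c iB).
Qed.

(** Convolution of each component with a normalized bump. Its radius is dictated by uniform
    continuity and capped by 1, so the support grows by at most one cube. *)
Lemma mollify k (phi : 'rV[R]_n -> 'rV[R]_n) (e : R) : 0 < e -> Cck k phi ->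
  exists psi : 'rV[R]_n -> 'rV[R]_n,
    [/\ forall i, smooth (fun x => psi x ord0 i), Cck k.+1 psi &
        forall x i, `|psi x ord0 i - phi x ord0 i| <= e].
Proof.
move=> e0 Cphi.
have /choice[D HD] (i : 'I_n) : exists d : R, 0 < d /\
    forall x y, `|y - x| <= d -> `|phi y ord0 i - phi x ord0 i| <= e.
  have [d d0 Hd] := supported_unif_continuous (Cphi i).1 (Cphi i).2 e0.
  by exists d.
have iphi i := supported_integrable (Cphi i).1 (Cphi i).2.
pose d i := Num.min (D i) 1.
have d0 i : 0 < d i by rewrite lt_min ltr01 (HD i).1.
pose I i := \int[lam]_z mollifier (d i) z.
have I0 i : 0 < I i by exact: mollifier_integral_gt0.
pose rho i z := (I i)^-1 * mollifier (d i) z.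
have srho i : smooth (rho i) by exact: smooth_mollifier.
have sprho i : supported (d i) (rho i).
  by move=> z dz; rewrite /rho supported_mollifier ?mulr0// ltW.
have crho i := smooth_continuous (srho i).
have irho i := supported_integrable (sprho i) (crho i).
have rho1 i : \int[lam]_z rho i z = 1.
  rewrite /rho RintegralZl//; first by rewrite mulVf// gt_eqF.
  apply: supported_integrable (supported_mollifier (ltW (d0 i))) _.
  apply: smooth_continuous; have := smooth_mollifier (d i) 1.
  by under eq_fun do rewrite mul1r.
have mN : measurable_fun setT (fun y : 'rV[R]_n => - y).
  apply: measurable_fun_rV => i; under eq_fun do rewrite !mxE.
  by apply: measurableT_comp => //; exact: measurable_coord_rV.
(* The component of phi is the weight and the bump is the translated function, so that derivatives
   fall on the bump. *)
pose psi x : 'rV[R]_n := \row_i superpose lam (fun y => phi y ord0 i) (fun y => - y) (rho i) x.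
have psiE i : (fun x => psi x ord0 i) =
    superpose lam (fun y => phi y ord0 i) (fun y => - y) (rho i).
  by apply/funext => x; rewrite mxE.
have spsi i : smooth (fun x => psi x ord0 i).
  by rewrite psiE; exact: (superpose_smooth (iphi i) mN (srho i) (sprho i)).
exists psi; split => //.
  move=> i; split; last exact: smooth_continuous.
  rewrite psiE => x kx.
  apply: (@superpose_supported _ _ _ _ lam _ _ (d i) k%:R (rho i)) => //.
    move=> y yn; rewrite normrN leNgt; apply/negP => ky.
    by move: yn; rewrite (Cphi i).1 ?eqxx.
  apply: le_lt_trans kx; rewrite -natr1 addrC lerD2l.
  by rewrite ge_min lexx orbT.
move=> x i; have := psiE i => /(congr1 (fun h => h x))/= ->.
have [M M0 HM] := supported_bounded (Cphi i).1 (Cphi i).2.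
have mphi := continuous_measurable_rV (Cphi i).2.
have mps : measurable_fun setT (fun z : 'rV[R]_n => phi (z + x) ord0 i).
  exact: (measurableT_comp mphi (measurable_fun_addrV x)).
have i1 := integrableM_bounded (irho i) mps (fun z => HM (z + x)).
have i2 := integrableM_bounded (irho i) (measurable_cst (phi x ord0 i))
  (fun=> HM x).
(* A translation and the evenness of the bump exchange the roles: the value is now an average of phi
   near x, comparable with phi x. *)
have -> : superpose lam (fun y => phi y ord0 i) (fun y => - y) (rho i) x =
    \int[lam]_z (rho i z * phi (z + x) ord0 i).
  rewrite /superpose -(@Rintegral_rV_shift R n x); last first.
    apply: measurable_funM => //; apply: (measurableT_comp (continuous_measurable_rV (crho i))).
    under eq_fun do rewrite addrC.
    exact: (measurableT_comp (measurable_fun_addrV x) mN).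
  apply: eq_Rintegral => z _; rewrite mulrC opprD addrCA subrr addr0.
  by rewrite /rho mollifier_even.
have -> : phi x ord0 i = \int[lam]_z (rho i z * phi x ord0 i).
  by rewrite RintegralZr// rho1 mul1r.
rewrite -RintegralB//.
have iB := integrableB measurableT i1 i2.
apply: le_trans (le_normr_Rintegral measurableT _) _.
  by apply: eq_integrable iB.
rewrite -[leRHS]mul1r -(rho1 i) -RintegralZr//; apply: le_Rintegral => //.
- by apply: integrable_norm; apply: eq_integrable iB.
- by under eq_fun do rewrite mulrC; exact: (integrableZl measurableT e (irho i)).
move=> z _; rewrite -mulrBr normrM.
have rho0 : 0 <= rho i z by rewrite mulr_ge0 ?flat_ge0// invr_ge0 ltW.
rewrite ger0_norm//.
have [dz|zd] := ltP (d i) `|z|; first by rewrite sprho// !mul0r.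
rewrite ler_wpM2l//; apply: (HD i).2; rewrite addrK.
by apply: le_trans zd _; rewrite ge_min lexx.
Qed.

End density.

(** * The Gamma function *)

Section power_integrals.
Variable R : realType.
Notation mu := (@lebesgue_measure R).

Lemma powRN_cvgy (q : R) : 0 < q -> t `^ (- q) @[t --> +oo] --> 0.
Proof.
move=> q0; apply/cvgrPdist_le => e e0.
near=> t.
have t0 : 0 < t by near: t; apply: nbhs_pinfty_gt; exact: num_real.
rewrite sub0r normrN ger0_norm ?powR_ge0// powRN.
rewrite -[leRHS]invrK lef_pV2 ?posrE ?powR_gt0// ?invr_gt0//.
have -> : e^-1 = (e^-1 `^ q^-1) `^ q.
  by rewrite -powRrM mulVf ?gt_eqF// powRr1// invr_ge0 ltW.
have te : e^-1 `^ q^-1 <= t.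
  by apply: ltW; near: t; apply: nbhs_pinfty_gt; exact: num_real.
by apply: ge0_ler_powR => //; rewrite ?nnegrE ?powR_ge0 ?ltW.
Unshelve. all: by end_near. Qed.

Lemma continuous_powR_gt0 (q t : R) : 0 < t -> {for t, continuous (fun u => u `^ q)}.
Proof.
move=> t0; apply/differentiable_continuous/derivable1_diffP.
by have [] := is_derive1_powR q t0.
Qed.

Lemma integral_powR_1y (p : R) : 1 < p ->
  (\int[mu]_(t in `[1%R, +oo[) (t `^ (- p))%:E = ((p - 1)^-1)%:E)%E.
Proof.
move=> p1; have q0 : 0 < p - 1 by rewrite subr_gt0.
pose F (t : R) := (- (p - 1)^-1) * t `^ (- (p - 1)).
rewrite (@ge0_continuous_FTC2y R (fun t => t `^ (- p)) F 1 0).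
- by rewrite /F powR1 mulr1 -EFinB sub0r opprK.
- by move=> x _; exact: powR_ge0.
- apply: continuous_in_subspaceT => t; rewrite inE/= in_itv/= andbT => t1.
  by apply: continuous_powR_gt0; exact: lt_le_trans t1.
- rewrite -(mulr0 (- (p - 1)^-1)); apply: cvgM; first exact: cvg_cst.
  exact: powRN_cvgy.
- move=> x x1; apply: derivableM; first exact: derivable_cst.
  by have [] := is_derive1_powR (- (p - 1)) (lt_trans ltr01 x1).
- apply: cvgM; first exact: cvg_cst.
  by apply: cvg_at_right_filter; exact: continuous_powR_gt0.
- move=> t; rewrite in_itv/= andbT => t1; have t0 := lt_trans ltr01 t1.
  have D := is_derive1_powR (- (p - 1)) t0.
  rewrite derive1E (_ : F = (- (p - 1)^-1) *: (fun t : R => t `^ (- (p - 1))))//.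
  rewrite derive_val /GRing.scale/= mulrA mulrNN mulVf ?gt_eqF// mul1r.
  by congr (_ `^ _); ring.
Qed.

(** For p < 1 the integrand is unbounded at 0, so the fundamental theorem is applied on compact
    intervals away from 0 and monotone convergence does the rest. *)
Lemma integral_powR_0c (p c : R) : 0 < p -> 0 < c ->
  (\int[mu]_(t in `]0%R, c[) (t `^ (p - 1))%:E = (c `^ p / p)%:E)%E.
Proof.
move=> p0 c0.
have mf : measurable_fun setT (fun t : R => t `^ (p - 1)) by exact: measurable_powR.
rewrite integral_itv_bndo_bndc//; last first.
  by apply/measurable_EFinP; apply: measurable_funTS.
(* The denominator i + 2 makes the left end strictly smaller than c already for i = 0. *)
pose F (i : nat) : set R := `[c / i.+2%:R, c]%classic.
have UF : \bigcup_i F i = `]0%R, c]%classic.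
  apply/seteqP; split => [t [i _]|t].
    rewrite /F /= !in_itv/= => /andP[it ->]; rewrite andbT.
    by apply: lt_le_trans it; rewrite divr_gt0.
  rewrite /= in_itv/= => /andP[t0 tc].
  exists (Num.truncn (c / t)) => //; rewrite /F/= in_itv/= tc andbT.
  rewrite ler_pdivrMr// mulrC -ler_pdivrMr//.
  apply: ltW; apply: lt_trans (truncnS_gt _) _.
  by rewrite ltr_nat.
have := @ge0_nondecreasing_set_cvg_integral _ (measurableTypeR R) R F (fun t => (t `^ (p - 1))%:E) mu.
rewrite UF => H.
have {}H : (\int[mu]_(x in F i) (x `^ (p - 1))%:E)%E @[i --> \oo] -->
   (\int[mu]_(x in `]0%R, c]) (x `^ (p - 1))%:E)%E.
  apply: H => //.
  - apply/nondecreasing_seqP => i; apply/subsetPset => t.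
    rewrite /F /= !in_itv/= => /andP[it ->]; rewrite andbT.
    by apply: le_trans it; rewrite ler_pM2l// lef_pV2 ?posrE// ler_nat.
  - by move=> i; exact: measurable_itv.
  - by move=> i; apply/measurable_EFinP; apply: measurable_funTS.
  - by move=> i x _; rewrite lee_fin powR_ge0.
pose P (t : R) := p^-1 * t `^ p.
have cP (t : R) : 0 < t -> {for t, continuous P}.
  by move=> t0; apply: cvgM; [exact: cvg_cst|exact: continuous_powR_gt0].
have dP (t : R) : 0 < t -> is_derive t 1 P (t `^ (p - 1)).
  move=> t0; have D := is_derive1_powR p t0.
  have := is_deriveZ p^-1 D; rewrite /GRing.scale/= mulrA mulVf ?gt_eqF// mul1r.
  by [].
have E i : (\int[mu]_(x in F i) (x `^ (p - 1))%:E)%E = (P c - P (c / i.+2%:R))%:E.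
  have i0 : 0 < c / i.+2%:R by rewrite divr_gt0.
  have ic : c / i.+2%:R < c by rewrite ltr_pdivrMr// ltr_pMr// ltr1n.
  rewrite EFinB /F; apply: continuous_FTC2 => //.
  - apply: continuous_in_subspaceT => t; rewrite inE/= in_itv/= => /andP[t1 _].
    by apply: continuous_powR_gt0; exact: lt_le_trans t1.
  - split.
    + move=> t; rewrite in_itv/= => /andP[t1 _].
      by have [] := dP t (lt_trans i0 t1).
    + by apply: cvg_at_right_filter; exact: cP.
    + by apply: cvg_at_left_filter; exact: cP.
  - move=> t; rewrite in_itv/= => /andP[t1 _].
    by have D := dP t (lt_trans i0 t1); rewrite derive1E derive_val.
have {}H : (P c - P (c / i.+2%:R))%:E @[i --> \oo] -->
    (\int[mu]_(x in `]0%R, c]) (x `^ (p - 1))%:E)%E.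
  by apply: cvg_trans H; apply: near_eq_cvg; apply: nearW => i; rewrite -E.
apply: (cvg_unique _ H) => //.
apply: cvg_EFin; first exact: nearW.
rewrite (_ : c `^ p / p = P c - p^-1 * 0); last by rewrite mulr0 subr0 mulrC.
apply: cvgB; first exact: cvg_cst.
apply: cvgM; first exact: cvg_cst.
have /cvg_at_rightP := @powR_cvg0 R p p0; apply; split => [i|].
  by rewrite divr_gt0.
rewrite -(mulr0 c); apply: cvgM; first exact: cvg_cst.
have := @cvg_harmonic R; rewrite -(cvg_shiftS (@harmonic R)).
exact.
Qed.

End power_integrals.

Section step_function.
Variable R : realType.
Notation mu := (@lebesgue_measure R).

(** The Heaviside function. Domains of integration are written as factors, so that every integral
    runs over the whole line and Tonelli applies also when the domain depends on the other
    variable. *)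
Definition step (t : R) : R := (0 < t)%R%:R.

Lemma step_ge0 t : 0 <= step t. Proof. exact: ler0n. Qed.

Lemma measurable_step : measurable_fun setT step.
Proof.
rewrite (_ : step = \1_(`]0, +oo[%classic : set R)); first exact: measurable_indic.
apply/funext => t; rewrite indicE /step; congr (_%:R).
by rewrite mem_setE in_itv/= andbT.
Qed.

Lemma integral_step (D : set R) (b : R -> bool) (f : R -> R) :
  (forall t, D t <-> b t) ->
  (\int[mu]_(t in D) (f t)%:E = \int[mu]_t ((b t)%:R * f t)%:E)%E.
Proof.
move=> Db; rewrite integral_mkcond; apply: eq_integral => t _.
rewrite patchE; case: ifPn => [|/negP tD].
  by rewrite inE => /Db ->; rewrite mul1r.
case: (boolP (b t)) => [/Db bt|_]; last by rewrite mul0r.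
by case: tD; rewrite inE.
Qed.

Lemma integral_step_powR (p c : R) : 0 < p ->
  (\int[mu]_t (step t * step (c - t) * t `^ (p - 1))%:E =
   (step c * (c `^ p / p))%:E)%E.
Proof.
move=> p0; have [c0|c0] := ltP 0 c.
  rewrite /step c0 mul1r -integral_powR_0c//.
  rewrite (@integral_step `]0, c[%classic (fun t => (0 < t) && (0 < c - t))).
    by apply: eq_integral => t _; rewrite -natrM mulnb.
  by move=> t; rewrite /= in_itv/= subr_gt0.
rewrite /step [0 < c]ltNge c0 mul0r; apply: integral0_eq => t _.
case: (ltP 0 t) => t0; last by rewrite mul0r mul0r.
by rewrite (_ : (0 < c - t) = false) ?mulr0 ?mul0r//; lra.
Qed.

Lemma expR_ge_pow (x : R) m : 0 <= x -> x ^+ m.+1 / m.+1`!%:R <= expR x.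
Proof. by move=> x0; apply: le_trans (expR_ge1Dxn m x0); rewrite lerDr. Qed.

Lemma integral_expRN (u : R) :
  (\int[mu]_t (step (t - u) * expR (- t))%:E = (expR (- u))%:E)%E.
Proof.
rewrite -(@integral_step `]u, +oo[%classic (fun t => 0 < t - u)); last first.
  by move=> t; rewrite /= in_itv/= andbT subr_gt0.
have dF (t : R) : is_derive t 1 (fun t : R => - expR (- t)) (expR (- t)).
  have := @is_derive1_comp R expR -%R t _ _ (is_derive_expR (- t)) (is_deriveNid t 1).
  by rewrite mulrN1 => /is_deriveN; rewrite opprK.
have ce : continuous (fun t : R => expR (- t)).
  by move=> t; apply: continuous_comp; [exact: opp_continuous|exact: continuous_expR].
rewrite integral_itv_obnd_cbnd//; last first.
  apply/measurable_EFinP/measurable_funTS; apply: measurableT_comp => //.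
rewrite (@ge0_continuous_FTC2y R (fun t => expR (- t)) (fun t => - expR (- t)) u 0).
- by rewrite -EFinB sub0r opprK.
- by move=> t _; exact: expR_ge0.
- exact: continuous_subspaceT.
- by rewrite -[X in _ --> X]oppr0; apply: cvgN; exact: cvgr_expR.
- by move=> t _; have [] := dF t.
- by apply: cvg_at_right_filter; apply: cvgN; exact: ce.
- by move=> t _; have D := dF t; rewrite derive1E derive_val.
Qed.

Lemma integral_sqr_expRN (u : R) :
  (\int[mu]_t (step (t - u) * ((t - u) ^+ 2 / 2) * expR (- t))%:E = (expR (- u))%:E)%E.
Proof.
under eq_integral do rewrite -mulrA.
rewrite -(@integral_step `]u, +oo[%classic (fun t => 0 < t - u)
  (fun t => (t - u) ^+ 2 / 2 * expR (- t))); last first.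
  by move=> t; rewrite /= in_itv/= andbT subr_gt0.
(* This polynomial minus its derivative is (t - u)^2 / 2, so that - q t exp (- t) is a primitive of
   the integrand. *)
pose q (t : R) := (t - u) ^+ 2 / 2 + (t - u) + 1.
have de (t : R) : is_derive t 1 (fun t : R => expR (- t)) (- expR (- t)).
  have := @is_derive1_comp R expR -%R t _ _ (is_derive_expR (- t)) (is_deriveNid t 1).
  by rewrite mulrN1.
have ds (t : R) : is_derive t 1 (fun t : R => t - u) 1.
  by have := is_deriveB (is_derive_id t (1:R)) (is_derive_cst u t (1:R)); rewrite subr0.
have dq (t : R) : is_derive t 1 q (t - u + 1).
  have d2 : is_derive t 1 (fun t : R => (t - u) ^+ 2 / 2) (t - u).
    have := is_deriveM (is_deriveM (ds t) (ds t)) (is_derive_cst (2^-1 : R) t (1 : R)).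
    rewrite (_ : _ *: _ + _ = t - u)//.
    by rewrite /GRing.scale/= ?fctE/=; field.
  have := is_deriveD (is_deriveD d2 (ds t)) (is_derive_cst (1 : R) t (1 : R)).
  by rewrite addr0.
pose F (t : R) := - (q t * expR (- t)).
have dF (t : R) : is_derive t 1 F ((t - u) ^+ 2 / 2 * expR (- t)).
  have := is_deriveN (is_deriveM (dq t) (de t)).
  rewrite [X in is_derive _ _ _ X -> _](_ : _ = (t - u) ^+ 2 / 2 * expR (- t))//.
  by rewrite /q /GRing.scale/=; ring.
have cF : continuous F.
  move=> t; apply/differentiable_continuous/derivable1_diffP.
  by have [] := dF t.
have cf : continuous (fun t : R => (t - u) ^+ 2 / 2 * expR (- t)).
  have cs : continuous (fun t : R => t - u).
    by move=> t; apply: cvgB; [exact: cvg_id|exact: cvg_cst].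
  move=> t; apply: cvgM.
    apply: cvgM; last exact: cvg_cst.
    by rewrite expr2; under eq_fun do rewrite expr2; apply: cvgM; exact: cs.
  by apply: (continuous_comp (f := -%R)); [exact: opp_continuous|exact: continuous_expR].
rewrite integral_itv_obnd_cbnd//; last first.
  by apply/measurable_EFinP/measurable_funTS; exact: continuous_measurable_fun.
rewrite (@ge0_continuous_FTC2y R (fun t => (t - u) ^+ 2 / 2 * expR (- t)) F u 0).
- rewrite -EFinB sub0r /F /q opprK subrr expr2 mulr0 mul0r !add0r mul1r.
  by [].
- by move=> t _; rewrite mulr_ge0 ?expR_ge0// divr_ge0// sqr_ge0.
- exact: continuous_subspaceT.
- rewrite -[X in _ --> X]oppr0; apply: cvgN.
  apply/cvgrPdist_le => e e0; near=> t.
  have t1 : 1 <= t - u.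
    rewrite lerBrDr; near: t; apply: nbhs_pinfty_ge; exact: num_real.
  (* For v >= 1 one has q v <= (5 / 2) v^3 = 15 (v^3 / 6) <= 15 exp v, whence the constant 15. *)
  have t2 : expR (- u) * 15 / e <= t - u.
    rewrite lerBrDr; near: t; apply: nbhs_pinfty_ge; exact: num_real.
  set v := t - u in t1 t2; have v0 : 0 < v by lra.
  have q0 : 0 <= q t by rewrite /q -/v; have := sqr_ge0 v; lra.
  rewrite sub0r normrN ger0_norm; last by rewrite mulr_ge0// expR_ge0.
  have -> : expR (- t) = expR (- u) / expR v.
    by rewrite -expRB; congr expR; rewrite /v; ring.
  have H := expR_ge_pow 2 (ltW v0).
  rewrite (_ : (2.+1`!%:R : R) = 6) in H; last by rewrite !factS fact0.
  have H2 : q t * v <= 15 * expR v.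
    apply: (@le_trans _ _ (15 * (v ^+ 3 / 6))); last by rewrite ler_pM2l.
    rewrite /q -/v; have v2 : v <= v ^+ 2 by rewrite expr2; nra.
    have v3 : v ^+ 2 <= v ^+ 3 by rewrite [v ^+ 3]exprS; have := sqr_ge0 v; nra.
    by nra.
  rewrite ler_pdivrMr// in t2.
  have Ev := expR_gt0 v; have au := expR_gt0 (- u).
  have : q t * (expR (- u) / expR v) <= e.
    rewrite mulrA ler_pdivrMr// -(ler_pM2r v0).
    have K1 : q t * v * expR (- u) <= 15 * expR v * expR (- u) by rewrite ler_pM2r.
    have K2 : expR v * (expR (- u) * 15) <= expR v * (v * e) by rewrite ler_pM2l// t2.
    by nra.
  by [].
- by move=> t _; have [] := dF t.
- by apply: cvg_at_right_filter; exact: cF.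
- by move=> t _; have D := dF t; rewrite derive1E derive_val.
Unshelve. all: by end_near. Qed.

End step_function.

Section gamma_function.
Variable R : realType.
Notation mu := (@lebesgue_measure R).

Definition gammad (x t : R) : R := step t * (t `^ (x - 1) * expR (- t)).

Lemma gammad_ge0 x t : 0 <= gammad x t.
Proof. by rewrite mulr_ge0 ?step_ge0// mulr_ge0 ?powR_ge0 ?expR_ge0. Qed.

Lemma measurable_gammad x : measurable_fun setT (gammad x).
Proof.
apply: measurable_funM; first exact: measurable_step.
apply: measurable_funM; first exact: measurable_powR.
exact: measurableT_comp.
Qed.

Lemma integral_gammad_lty x : 0 < x -> (\int[mu]_t (gammad x t)%:E < +oo)%E.
Proof.
(* For t >= 1 the exponential exceeds t^(m + 1) / (m + 1)! >= t^(x + 1) / (m + 1)!, so the integrand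
   is at most (m + 1)! t^(-2). The two majorants overlap between 1 and 2, which is harmless for an
   upper bound. *)
move=> x0; have [m xm] : exists m : nat, x + 1 <= m.+1%:R.
  by exists (Num.truncn (x + 1)); rewrite ltW// truncnS_gt.
pose A (t : R) := step t * step (2 - t) * t `^ (x - 1).
pose B (t : R) := (1 <= t)%R%:R * t `^ (- 2).
have mA : measurable_fun setT A.
  apply: measurable_funM; last exact: measurable_powR.
  apply: measurable_funM; first exact: measurable_step.
  apply: measurableT_comp; first exact: measurable_step.
  exact: measurable_funB.
have mB : measurable_fun setT B.
  apply: measurable_funM; last exact: measurable_powR.
  rewrite (_ : (fun t : R => _) = \1_(`[1, +oo[%classic : set R)).
    exact: measurable_indic.
  by apply/funext => t; rewrite indicE mem_setE in_itv/= andbT.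
have A0 t : 0 <= A t by rewrite mulr_ge0 ?powR_ge0// mulr_ge0 ?step_ge0.
have B0 t : 0 <= B t by rewrite mulr_ge0 ?powR_ge0.
apply: (@le_lt_trans _ _ (\int[mu]_t ((A t)%:E + (m.+1`!%:R)%:E * (B t)%:E))%E).
  apply: ge0_le_integral => //.
  - by move=> t _; rewrite lee_fin gammad_ge0.
  - by apply/measurable_EFinP; exact: measurable_gammad.
  - apply: emeasurable_funD; first exact/measurable_EFinP.
    by apply/measurable_EFinP; exact: measurable_funM.
  - move=> t _; rewrite -EFinM -EFinD lee_fin /gammad /step.
    case: (ltP 0 t) => t0; last first.
      by rewrite mul0r addr_ge0// mulr_ge0.
    have e1 : expR (- t) <= 1 by rewrite expR_le1 oppr_le0 ltW.
    rewrite mul1r; have [t1|t1] := leP 1 t; last first.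
      rewrite /A /step t0 (_ : 0 < 2 - t); last by lra.
      have X : t `^ (x - 1) * expR (- t) <= t `^ (x - 1) by rewrite ler_piMr ?powR_ge0.
      by rewrite !mul1r; apply: le_trans X _; rewrite lerDl mulr_ge0.
    apply: (@le_trans _ _ (m.+1`!%:R * B t)); last by rewrite lerDr.
    rewrite /B t1 mul1r powRN.
    have -> : t `^ 2 = t ^+ 2 by rewrite -powR_mulrn// ltW.
    rewrite ler_pdivlMr ?exprn_gt0// expRN mulrAC ler_pdivrMr ?expR_gt0//.
    rewrite -(powR_mulrn 2 (ltW t0)) -powRD; last by rewrite (gt_eqF t0) implybT.
    rewrite (_ : x - 1 + 2%:R = x + 1); last by ring.
    have H := expR_ge_pow m (ltW t0).
    rewrite ler_pdivrMr ?ltr0n ?fact_gt0// mulrC in H.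
    apply: le_trans H; rewrite -(powR_mulrn m.+1 (ltW t0)).
    by rewrite ler_powR.
rewrite ge0_integralD//; last 4 first.
  by move=> t _; rewrite lee_fin.
  exact/measurable_EFinP.
  by move=> t _; rewrite -EFinM lee_fin mulr_ge0.
  by apply/measurable_EFinP; exact: measurable_funM.
rewrite ge0_integralZl//; last 2 first.
  exact/measurable_EFinP.
  by move=> t _; rewrite lee_fin.
rewrite integral_step_powR// /B.
rewrite -(@integral_step R `[1, +oo[%classic (fun t => 1 <= t)); last first.
  by move=> t; rewrite /= in_itv/= andbT.
have p2 : (1 : R) < 2 by rewrite ltr1n.
rewrite (integral_powR_1y p2).
by rewrite -EFinM -EFinD ltry.
Qed.

Lemma integrable_gammad x : 0 < x -> mu.-integrable setT (EFin \o gammad x).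
Proof.
move=> x0; apply/integrableP; split.
  by apply/measurable_EFinP; exact: measurable_gammad.
under eq_integral => t _ do rewrite /= ger0_norm ?gammad_ge0//.
exact: integral_gammad_lty.
Qed.

Lemma GammaE (x : R) : Gamma x = \int[mu]_t gammad x t.
Proof.
congr fine; rewrite /gammad; apply: integral_step => t.
by rewrite /= in_itv/= andbT.
Qed.

Lemma integral_gammad (x : R) : 0 < x -> (\int[mu]_t (gammad x t)%:E)%E = (Gamma x)%:E.
Proof.
by move=> x0; rewrite GammaE /Rintegral fineK//; apply: integrable_fin_num => //;
  exact: integrable_gammad.
Qed.

Lemma Gamma1 : Gamma (1 : R) = 1.
Proof.
apply: EFin_inj; rewrite -integral_gammad//.
transitivity (\int[mu]_t (step (t - 0) * expR (- t))%:E)%E.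
  by apply: eq_integral => t _; rewrite /gammad subrr powRr0 mul1r subr0.
by rewrite integral_expRN oppr0 expR0.
Qed.

(** Tonelli takes the place of integration by parts: u^(x - 1) exp (- t) is integrated over 0 < u <
    t. Integrating in u first gives Gamma (x + 1) / x, integrating in t first gives Gamma x. *)
Lemma Gamma_rec (x : R) : 0 < x -> Gamma (x + 1) = x * Gamma x.
Proof.
move=> x0; have x10 : 0 < x + 1 by rewrite addr_gt0.
apply: EFin_inj; rewrite EFinM -!integral_gammad//.
pose K (p : measurableTypeR R * measurableTypeR R) : \bar R :=
  (step p.2 * step (p.1 - p.2) * p.2 `^ (x - 1) * expR (- p.1))%:E.
have K0 p : (0 <= K p)%E.
  by rewrite lee_fin mulr_ge0 ?expR_ge0// mulr_ge0 ?powR_ge0// mulr_ge0 ?step_ge0.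
have mstep : measurable_fun setT (@step R : measurableTypeR R -> measurableTypeR R).
  exact: measurable_step.
have mK : measurable_fun setT K.
  apply/measurable_EFinP; apply: measurable_funM; last first.
    by do 2 apply: measurableT_comp => //.
  apply: measurable_funM; last first.
    by apply: (measurableT_comp (measurable_powR _)); exact: measurable_snd.
  apply: measurable_funM.
    exact: (measurableT_comp mstep measurable_snd).
  apply: (measurableT_comp mstep).
  exact: measurable_funB.
have E1 t : (\int[mu]_u K (t, u) = (expR (- t) * (step t * (t `^ x / x)))%:E)%E.
  rewrite EFinM -integral_step_powR// -ge0_integralZl//.
  - by apply: eq_integral => u _; rewrite -EFinM mulrC.
  - apply/measurable_EFinP; apply: measurable_funM; last exact: measurable_powR.
    apply: measurable_funM; first exact: measurable_step.
    by apply: (measurableT_comp mstep); exact: measurable_funB.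
  - by move=> u _; rewrite lee_fin mulr_ge0 ?powR_ge0// mulr_ge0 ?step_ge0.
have E2 u : (\int[mu]_t K (t, u) = (step u * u `^ (x - 1) * expR (- u))%:E)%E.
  rewrite EFinM -integral_expRN -ge0_integralZl//.
  - by apply: eq_integral => t _; rewrite -EFinM /K/=; congr EFin; ring.
  - apply/measurable_EFinP; apply: measurable_funM; last exact: measurableT_comp.
    by apply: (measurableT_comp mstep); exact: measurable_funB.
  - by move=> t _; rewrite lee_fin mulr_ge0 ?expR_ge0// step_ge0.
  - by rewrite lee_fin mulr_ge0 ?powR_ge0// step_ge0.
have H := @fubini_tonelli _ _ _ _ R mu mu K mK K0.
pose W (t : measurableTypeR R) : \bar R := (expR (- t) * (step t * (t `^ x / x)))%:E.
have mW : measurable_fun setT W.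
  apply/measurable_EFinP; apply: measurable_funM; first exact: measurableT_comp.
  apply: measurable_funM; first exact: measurable_step.
  by apply: measurable_funM => //; exact: measurable_powR.
have w0 (t : R) : 0 <= expR (- t) * (step t * (t `^ x / x)).
  apply: mulr_ge0; first exact: expR_ge0.
  by apply: mulr_ge0; [exact: step_ge0|apply: divr_ge0; [exact: powR_ge0|exact: ltW]].
have W0 t : (0 <= W t)%E by rewrite lee_fin; exact: w0.
have x0e : (0 <= x%:E)%E by rewrite lee_fin ltW.
transitivity (\int[mu]_t (x%:E * W t))%E.
  apply: eq_integral => t _; rewrite -EFinM; congr EFin.
  by rewrite /gammad addrK; field; rewrite gt_eqF.
rewrite (ge0_integralZl mu measurableT mW (fun t _ => W0 t) x0e).
congr (_ * _)%E.
transitivity (\int[mu]_t \int[mu]_u K (t, u))%E.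
  by apply: eq_integral => t _; rewrite E1.
rewrite H; apply: eq_integral => u _; rewrite E2 /gammad.
by rewrite mulrA.
Qed.

(** For y between x / 2 and x + 1 the integrand is below the one at x / 2 when t < 1 and below the
    one at x + 1 when t >= 1; their sum dominates. *)
Lemma Gamma_continuous (x : R) : 0 < x -> {for x, continuous (@Gamma R)}.
Proof.
move=> x0; rewrite (_ : @Gamma R = fun x => \int[mu]_t gammad x t); last first.
  by apply/funext => y; rewrite GammaE.
have h0 : 0 < x / 2 by rewrite divr_gt0.
apply: (@continuity_under_integral R _ _ mu gammad setT measurableT (x / 2) (x + 1) _ _
   (fun t => gammad (x / 2) t + gammad (x + 1) t)).
- move=> y; rewrite /= in_itv/= => /andP[y0 _]; apply: integrable_gammad.
  exact: lt_trans y0.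
- apply: aeW => t _ y _; rewrite /gammad.
  rewrite /step; case: ltP => t0; last first.
    under eq_fun do rewrite mul0r.
    exact: cvg_cst.
  apply: cvgM; first exact: cvg_cst.
  apply: cvgM; last exact: cvg_cst.
  rewrite /powR gt_eqF//.
  apply: continuous_cvg; first exact: continuous_expR.
  apply: cvgM; last exact: cvg_cst.
  by apply: cvgB; [exact: cvg_id|exact: cvg_cst].
- have := integrableD measurableT (integrable_gammad h0) (integrable_gammad (addr_gt0 x0 ltr01)).
  by apply: eq_integrable.
- move=> y; rewrite /= in_itv/= => /andP[y1 y2]; apply: aeW => t _.
  rewrite ger0_norm ?gammad_ge0// /gammad.
  rewrite /step; case: ltP => t0; last by rewrite !mul0r addr0.
  rewrite !mul1r -mulrDl ler_wpM2r ?expR_ge0//.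
  have [t1|t1] := leP 1 t.
    by rewrite ler_wpDl ?powR_ge0// ler_powR// lerD2r ltW.
  rewrite ler_wpDr ?powR_ge0// /powR gt_eqF// ler_expR.
  rewrite ler_wnM2r// ?lerD2r ?ltW//.
  by apply: ln_lt0; rewrite t0.
by rewrite inE/= in_itv/=; apply/andP; split; lra.
Qed.

End gamma_function.

(** * Superposition of compactly supported kernels *)

Section scaling.
Variables (R : realType) (n : nat).
Notation lam := (lebesgue_rV R n).
Notation mu := (@lebesgue_measure R).
Notation rprod := (lam \x mu)%E.
Implicit Types (z : 'rV[R]_n).

Lemma dotvZ (l : R) z : dotv (l *: z) (l *: z) = l ^+ 2 * dotv z z.
Proof.
by rewrite /dotv mulr_sumr; apply: eq_bigr => i _; rewrite !mxE expr2 mulrACA.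
Qed.

Lemma normrZ_rV (l : R) z : `|l *: z| = `|l| * `|z|.
Proof. exact: (@mx_normZ R 1 n l z). Qed.

Lemma measurable_dotv : measurable_fun setT (fun z : 'rV[R]_n => dotv z z).
Proof. by apply: continuous_measurable_rV; exact: continuous_dotv. Qed.

Lemma measurable_normr_rV : measurable_fun setT (fun z : 'rV[R]_n => `|z| : R).
Proof.
apply: continuous_measurable_rV => z; exact: (@norm_continuous R 'rV[R]_n z).
Qed.

(** At fixed t > 0 the substitution of sqrt t z for z extracts the power t^(- (k + n) / 2), which
    decouples the two variables. The case k = 0 gives masses, k = 1 first moments, and k = 2 the
    absolute integrability of the singular part. *)
Lemma integral_scale (b G : R -> R) (p : R) (k : nat) :
  measurable_fun setT b -> measurable_fun setT G ->
  (forall t, 0 <= b t) -> (forall t, t <= 0 -> b t = 0) -> (forall u, 0 <= G u) ->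
  (\int[rprod]_u (b u.2 * u.2 `^ p * (`|u.1| ^+ k * G (u.2 * dotv u.1 u.1)))%:E =
   (\int[mu]_t (b t * t `^ (p - (k + n)%:R / 2))%:E) *
   \int[lam]_z (`|z| ^+ k * G (dotv z z))%:E)%E.
Proof.
move=> mb mG b0 b_le0 G0.
have mf : measurable_fun setT (fun u : ('rV[R]_n * measurableTypeR R)%type =>
    (b u.2 * u.2 `^ p * (`|u.1| ^+ k * G (u.2 * dotv u.1 u.1)))%:E).
  apply/measurable_EFinP; apply: measurable_funM.
    apply: measurable_funM; first exact: (measurableT_comp mb measurable_snd).
    exact: (measurableT_comp (measurable_powR p) measurable_snd).
  apply: measurable_funM.
    apply: measurable_funX; exact: (measurableT_comp measurable_normr_rV measurable_fst).
  apply: (measurableT_comp mG); apply: measurable_funM; first exact: measurable_snd.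
  exact: (measurableT_comp measurable_dotv measurable_fst).
rewrite fubini_tonelli2//=; last first.
  by move=> u; rewrite lee_fin !mulr_ge0 ?powR_ge0 ?exprn_ge0.
pose Q z : R := `|z| ^+ k * G (dotv z z).
have mQ : measurable_fun setT Q.
  apply: measurable_funM; first by apply: measurable_funX; exact: measurable_normr_rV.
  exact: (measurableT_comp mG measurable_dotv).
have Q0 z : 0 <= Q z by rewrite mulr_ge0 ?exprn_ge0.
have mQ' : measurable_fun setT (EFin \o Q) by exact/measurable_EFinP.
have E (t : R) : (\int[lam]_z (b t * t `^ p * (`|z| ^+ k * G (t * dotv z z)))%:E =
    (b t * t `^ (p - (k + n)%:R / 2))%:E * \int[lam]_z (Q z)%:E)%E.
  have [t0|t0] := leP t 0.
    rewrite b_le0// !mul0r mul0e; under eq_integral do rewrite !mul0r.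
    exact: integral0.
  pose l := Num.sqrt t; have l0 : 0 < l by rewrite sqrtr_gt0.
  have lt : l ^+ 2 = t by rewrite sqr_sqrtr// ltW.
  have lp m : l ^+ m = t `^ (m%:R / 2).
    by rewrite -powR_mulrn ?ltW// /l -powR12_sqrt ?ltW// -powRrM mulrC.
  transitivity (\int[lam]_z ((b t * t `^ p * l ^- k)%:E * (Q (l *: z + 0))%:E))%E.
    apply: eq_integral => z _; rewrite -EFinM addr0; congr EFin.
    rewrite /Q normrZ_rV dotvZ lt gtr0_norm// exprMn.
    by field; rewrite gt_eqF// exprn_gt0.
  have mQl : measurable_fun setT (fun z => (Q (l *: z + 0))%:E).
    apply/measurable_EFinP; apply: (measurableT_comp mQ).
    apply: measurable_fun_rV => i; under eq_fun do rewrite addr0 mxE.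
    by apply: measurable_funM => //; exact: measurable_coord_rV.
  have cpos : (0 <= (b t * t `^ p * l ^- k)%:E)%E.
    by rewrite lee_fin !mulr_ge0 ?powR_ge0// invr_ge0 exprn_ge0// ltW.
  rewrite (ge0_integralZl lam measurableT mQl _ cpos); last by move=> z _; rewrite lee_fin.
  have := @ge0_integral_rV_affine R n l 0 _ l0 mQ' (fun z => Q0 z).
  move=> ->.
  rewrite muleA -EFinM; congr (_%:E * _)%E.
  rewrite !lp -!powRN -!mulrA; congr (_ * _).
  rewrite -!powRD ?(gt_eqF t0) ?implybT//; congr (_ `^ _).
  by rewrite natrD; field.
transitivity (\int[mu]_t ((\int[lam]_z (Q z)%:E) * (b t * t `^ (p - (k + n)%:R / 2))%:E))%E.
  by apply: eq_integral => t _; exact: (etrans (E t) (muleC _ _)).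
rewrite ge0_integralZl//; last 3 first.
- by apply/measurable_EFinP; apply: measurable_funM => //; exact: measurable_powR.
- by move=> t _; rewrite lee_fin mulr_ge0 ?powR_ge0.
- by apply: integral_ge0 => z _; rewrite lee_fin.
by rewrite muleC.
Qed.

End scaling.

Section hat_kernels.
Variables (R : realType) (n : nat).
Notation lam := (lebesgue_rV R n).
Notation mu := (@lebesgue_measure R).
Notation rprod := (lam \x mu)%E.
Implicit Types (z : 'rV[R]_n).

Definition hat (u : R) : R := Num.max 0 (1 - u).
(** The primitive of - [hat] that vanishes for u >= 1. It is C^1, so the gradient of hat2 (t |z|^2)
    is the continuous field - 2 t z hat (t |z|^2). *)
Definition hat2 (u : R) : R := hat u ^+ 2 / 2.

Lemma hatE u : hat u = if u < 1 then 1 - u else 0.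
Proof.
rewrite /hat /Num.max; case: ltP => h; case: ltP => h' //; lra.
Qed.

Lemma hat_ge0 u : 0 <= hat u.
Proof. by rewrite /hat le_max lexx. Qed.

Lemma hat2_ge0 u : 0 <= hat2 u.
Proof. by rewrite divr_ge0// exprn_ge0// hat_ge0. Qed.

Lemma hat_eq0 u : 1 <= u -> hat u = 0.
Proof. by rewrite hatE; case: ltP => // h h'; lra. Qed.

Lemma hat2_eq0 u : 1 <= u -> hat2 u = 0.
Proof. by move=> /hat_eq0; rewrite /hat2 => ->; rewrite expr0n/= mul0r. Qed.

Lemma continuous_hat : continuous hat.
Proof.
have -> : hat = (fun u => (1 - u + `|1 - u|) / 2).
  apply/funext => u; rewrite hatE; case: ltP => h.
    by rewrite ger0_norm; lra.
  by rewrite ler0_norm; lra.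
have c1 : continuous (fun u : R => 1 - u).
  by move=> u; apply: cvgB; [exact: cvg_cst|exact: cvg_id].
move=> u; apply: cvgM; last exact: cvg_cst.
apply: cvgD; first exact: c1.
by apply: cvg_norm; exact: c1.
Qed.

Lemma continuous_hat2 : continuous hat2.
Proof.
apply: continuous_mulr; last exact: continuous_cstr.
by apply: continuous_mulr; exact: continuous_hat.
Qed.

(** The slope - [hat] is nondecreasing and 1-Lipschitz, so the first-order Taylor remainder is at
    most h^2 / 2. This handles the kink of [hat] at 1 together with all other points. *)
Lemma hat2_expansion (u h : R) : `|hat2 (u + h) - hat2 u + h * hat u| <= h ^+ 2 / 2.
Proof.
rewrite /hat2 !hatE ler_norml; case: ltP => a; case: ltP => b.
all: by rewrite ?expr2; nra.
Qed.

Lemma is_derive_hat2 (u : R) : is_derive u 1 hat2 (- hat u).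
Proof.
suff H : h^-1 *: (hat2 (h *: 1 + u) - hat2 u) @[h --> (0:R)^'] --> - hat u.
  by split; [apply/cvg_ex; exists (- hat u)|exact/cvg_lim].
apply/cvgrPdist_le => e e0; near=> h.
have h0 : h != 0 by near: h; exact: nbhs_dnbhs_neq.
rewrite [h%:A]mulr1 distrC opprK [_ *: _]mulrC (addrC h u).
have -> : (hat2 (u + h) - hat2 u) * h^-1 + hat u =
    (hat2 (u + h) - hat2 u + h * hat u) / h by field.
rewrite normrM normfV ler_pdivrMr ?normr_gt0//.
apply: le_trans (hat2_expansion u h) _.
rewrite -real_normK ?num_real// expr2.
have he : `|h| <= e by near: h; apply: dnbhs0_le.
by have := normr_ge0 h; nra.
Unshelve. all: by end_near. Qed.

(* The part 0 < t < 1 gives [far_remainder], the part t >= 1 gives [near_smoothing]. *)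
Definition itv1y (t : R) : R := (1 <= t)%R%:R.
Definition itv01 (t : R) : R := step t * step (1 - t).

Lemma measurable_itv1y : measurable_fun setT itv1y.
Proof.
rewrite (_ : itv1y = \1_(`[1, +oo[%classic : set R)); first exact: measurable_indic.
by apply/funext => t; rewrite indicE mem_setE in_itv/= andbT.
Qed.

Lemma measurable_itv01 : measurable_fun setT itv01.
Proof.
apply: measurable_funM; first exact: measurable_step.
by apply: measurableT_comp; [exact: measurable_step|exact: measurable_funB].
Qed.

Lemma itv1y_le0 t : t <= 0 -> itv1y t = 0.
Proof. by rewrite /itv1y; case: (leP 1 t) => // h h'; lra. Qed.

Lemma itv01_le0 t : t <= 0 -> itv01 t = 0.
Proof. by rewrite /itv01 /step; case: (ltP 0 t) => h h'; rewrite ?mul0r//; lra. Qed.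

Lemma step_split t : step t = itv01 t + itv1y t.
Proof.
rewrite /itv01 /itv1y /step.
case: (ltP 0 t) => h0; case: (ltP 0 (1 - t)) => h1; case: (leP 1 t) => h2 /=;
  rewrite ?mulr1 ?mulr0 ?mul0r ?addr0 ?add0r//; lra.
Qed.

(** The factor |z| is the maximum norm, suited to Lipschitz bounds and coordinates, while [dotv] is
    Euclidean. Both are homogeneous, so the mixture rescales like a power. *)
Definition radial_moment (k : nat) (G : R -> R) : R :=
  \int[lam]_z (`|z| ^+ k * G (dotv z z)).

Lemma radial_integrable k (G : R -> R) : continuous G ->
  (forall u, 1 <= u -> G u = 0) ->
  lam.-integrable setT (EFin \o (fun z => `|z| ^+ k * G (dotv z z))).
Proof.
move=> cG G0; apply: (@supported_integrable _ _ 1).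
  move=> z z1; rewrite G0 ?mulr0//.
  apply: le_trans (sqr_normr_le_dotv z).
  by rewrite -[leLHS](expr1n _ 2) ler_pXn2r ?nnegrE// ltW.
apply: continuous_mulr.
  move=> z; apply: (@continuous_comp _ _ _ (fun z : 'rV[R]_n => `|z| : R) (fun t : R => t ^+ k)).
    exact: (@norm_continuous R 'rV[R]_n z).
  exact: exprn_continuous.
move=> z; apply: (continuous_comp (f := fun z => dotv z z)); last exact: cG.
exact: continuous_dotv.
Qed.

Lemma scale_integrable (b G : R -> R) (p C : R) (k : nat) :
  measurable_fun setT b -> continuous G ->
  (forall t, 0 <= b t) -> (forall t, t <= 0 -> b t = 0) -> (forall u, 0 <= G u) ->
  (forall u, 1 <= u -> G u = 0) ->
  (\int[mu]_t (b t * t `^ (p - (k + n)%:R / 2))%:E = C%:E)%E ->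
  rprod.-integrable setT
    (EFin \o (fun u => b u.2 * u.2 `^ p * (`|u.1| ^+ k * G (u.2 * dotv u.1 u.1)))) /\
  \int[rprod]_u (b u.2 * u.2 `^ p * (`|u.1| ^+ k * G (u.2 * dotv u.1 u.1))) =
    C * radial_moment k G.
Proof.
move=> mb cG b0 b_le0 G0 G1 EC.
have mG : measurable_fun setT G by exact: continuous_measurable_fun.
have E := @integral_scale R n b G p k mb mG b0 b_le0 G0.
have iQ := radial_integrable k cG G1.
have EQ : (\int[lam]_z (`|z| ^+ k * G (dotv z z))%:E = (radial_moment k G)%:E)%E.
  by rewrite /radial_moment /Rintegral fineK//; exact: integrable_fin_num iQ.
rewrite EC EQ -EFinM in E.
split; last by rewrite /Rintegral E.
apply/integrableP; split.
  apply/measurable_EFinP; apply: measurable_funM.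
    apply: measurable_funM; first exact: (measurableT_comp mb measurable_snd).
    exact: (measurableT_comp (measurable_powR p) measurable_snd).
  apply: measurable_funM.
    apply: measurable_funX; exact: (measurableT_comp (@measurable_normr_rV R n) measurable_fst).
  apply: (measurableT_comp mG); apply: measurable_funM; first exact: measurable_snd.
  exact: (measurableT_comp (@measurable_dotv R n) measurable_fst).
rewrite (_ : (\int[_]_x _)%E = (C * radial_moment k G)%:E) ?ltry// -E.
apply: eq_integral => u _; rewrite /= ger0_norm//.
by rewrite !mulr_ge0 ?powR_ge0 ?exprn_ge0.
Qed.

Lemma integral_itv1y_powR (p : R) : 1 < p ->
  (\int[mu]_t (itv1y t * t `^ (- p))%:E = ((p - 1)^-1)%:E)%E.
Proof.
move=> p1; rewrite -integral_powR_1y//; apply/esym; apply: integral_step => t.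
by rewrite /= in_itv/= andbT.
Qed.

Lemma integral_itv01_powR (p : R) : 0 < p ->
  (\int[mu]_t (itv01 t * t `^ (p - 1))%:E = (p^-1)%:E)%E.
Proof.
move=> p0; rewrite (integral_step_powR 1 p0); congr EFin.
by rewrite /step ltr01 mul1r powR1 mul1r.
Qed.

(* Integrating t^(s - 1) (1 - t r) over 0 < t < 1 / r gives r^(-s) (1 / s - 1 / (s + 1)). *)
Lemma integral_powR_hat (s r : R) : 0 < s -> 0 < r ->
  (\int[mu]_t (step t * t `^ (s - 1) * hat (t * r))%:E =
   (r `^ (- s) / (s * (s + 1)))%:E)%E.
Proof.
move=> s0 r0.
have s10 : 0 < s + 1 by rewrite addr_gt0.
have r1 : 0 < r^-1 by rewrite invr_gt0.
have ir (q : R) : 0 < q ->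
    (\int[mu]_t (step t * step (r^-1 - t) * t `^ (q - 1))%:E = (r `^ (- q) / q)%:E)%E.
  move=> q0; rewrite integral_step_powR// /step r1 mul1r.
  by rewrite -powR_inv1 ?ltW// -powRrM mulN1r.
have mw (q : R) : measurable_fun setT (fun t : R => step t * step (r^-1 - t) * t `^ (q - 1)).
  apply: measurable_funM; last exact: measurable_powR.
  apply: measurable_funM; first exact: measurable_step.
  by apply: measurableT_comp; [exact: measurable_step|exact: measurable_funB].
have iw (q : R) : 0 < q ->
    mu.-integrable setT (fun t => (step t * step (r^-1 - t) * t `^ (q - 1))%:E).
  move=> q0; apply/integrableP; split; first by apply/measurable_EFinP; exact: mw.
  rewrite (_ : (\int[_]_x _)%E = (r `^ (- q) / q)%:E) ?ltry// -ir//.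
  apply: eq_integral => t _; rewrite /= ger0_norm//.
  by rewrite !mulr_ge0 ?powR_ge0 ?step_ge0.
have i1 := iw s s0; have i2 := integrableZl measurableT r (iw (s + 1) s10).
transitivity (\int[mu]_t ((step t * step (r^-1 - t) * t `^ (s - 1))%:E -
    r%:E * (step t * step (r^-1 - t) * t `^ (s + 1 - 1))%:E))%E.
  apply: eq_integral => t _; rewrite -EFinM -EFinB; congr EFin.
  rewrite /step; have [t0|t0] := ltP 0 t; last by rewrite !(mul0r, mulr0) subr0.
  rewrite hatE subr_gt0 -[t < r^-1](ltr_pM2r r0) mulVf ?gt_eqF//.
  case: ifPn => _; last by rewrite !(mul0r, mulr0) subr0.
  have ts : t `^ s = t `^ (s - 1) * t.
    rewrite -[X in _ * X](powRr1 (ltW t0)) -powRD ?subrK//.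
    by rewrite (gt_eqF t0) implybT.
  by rewrite !mul1r addrK ts; ring.
rewrite integralB// integralZl//; last exact: iw.
rewrite !ir// -EFinM -EFinB; congr EFin.
rewrite opprD powRD ?(gt_eqF r0) ?implybT// powR_inv1 ?ltW//.
by field; rewrite !gt_eqF.
Qed.

End hat_kernels.

(** * Gaussian integral and mass of the radial profile *)

Section gaussian.
Variable R : realType.
Notation mu := (@lebesgue_measure R).

Lemma integral_gauss_rV n :
  (\int[lebesgue_rV R n]_z (expR (- dotv z z))%:E = (Num.sqrt pi ^+ n)%:E)%E.
Proof.
elim: n => [|n IH].
  rewrite expr0 /=; under eq_integral do rewrite /dotv big_ord0 oppr0 expR0.
  by rewrite integral_cst//= diracT mul1e.
have mE m : measurable_fun setT (fun z : 'rV[R]_m => (expR (- dotv z z))%:E).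
  apply/measurable_EFinP; apply: measurableT_comp => //.
  by apply: measurableT_comp => //; exact: measurable_dotv.
rewrite ge0_integral_rVS//.
transitivity (\int[mu]_x ((Num.sqrt pi ^+ n)%:E * (gauss_fun x)%:E))%E.
  apply: eq_integral => x _.
  have f0 (v : 'rV[R]_n) : setT v -> (0 <= (expR (- dotv v v))%:E)%E.
    by rewrite lee_fin expR_ge0.
  have x0 : (0 <= (gauss_fun x)%:E)%E by rewrite lee_fin gauss_fun_ge0.
  rewrite -IH muleC -(ge0_integralZl (lebesgue_rV R n) measurableT (mE n) f0 x0).
  apply: eq_integral => v _; rewrite -EFinM; congr EFin.
  rewrite /gauss_fun -expRD; congr expR.
  rewrite /dotv big_ord_recl mxE unlift_none/= opprD expr2; congr (_ - _).
  by apply: eq_bigr => i _; rewrite !mxE liftK.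
have mg : measurable_fun setT (EFin \o @gauss_fun R).
  by apply/measurable_EFinP; exact: measurable_gauss_fun.
have g0 (x : R) : setT x -> (0 <= (EFin \o @gauss_fun R) x)%E.
  by rewrite lee_fin gauss_fun_ge0.
rewrite (ge0_integralZl mu measurableT mg g0); last by rewrite lee_fin exprn_ge0.
by rewrite integralT_gauss -EFinM exprSr.
Qed.

Lemma radial_scale n (r : R) (G : R -> R) : 0 < r -> measurable_fun setT G ->
  (forall u, 0 <= G u) ->
  (\int[lebesgue_rV R n]_z (G (dotv z z / r))%:E =
   (r `^ (n%:R / 2))%:E * \int[lebesgue_rV R n]_z (G (dotv z z))%:E)%E.
Proof.
move=> r0 mG G0; pose l := Num.sqrt r^-1.
have ri : 0 < r^-1 by rewrite invr_gt0.
have l0 : 0 < l by rewrite sqrtr_gt0.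
have lr : l ^+ 2 = r^-1 by rewrite sqr_sqrtr// ltW.
pose Q (z : 'rV[R]_n) := (G (dotv z z))%:E.
have mQ : measurable_fun setT Q.
  by apply/measurable_EFinP; exact: (measurableT_comp mG (@measurable_dotv R n)).
have Q0 z : (0 <= Q z)%E by rewrite lee_fin.
have := @ge0_integral_rV_affine R n l 0 Q l0 mQ Q0.
rewrite (_ : l ^- n = r `^ (n%:R / 2)) => [<-|].
  by apply: eq_integral => z _; rewrite /Q addr0 dotvZ lr mulrC.
rewrite -powR_mulrn ?ltW// /l -powR12_sqrt ?ltW// -powRrM -powR_inv1 ?ltW//.
by rewrite -powRrM -powRN; congr (_ `^ _); field.
Qed.

(* Both sides are the double integral of (t - |z|^2)^2 / 2 * exp (- t) over |z|^2 < t: integrating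
   in t first leaves the Gaussian in z, integrating in z first rescales z by the square root of t. *)
Lemma radial_moment_hat2 n :
  radial_moment n 0 (@hat2 R) * Gamma (n%:R / 2 + 3) = pi `^ (n%:R / 2).
Proof.
pose lam := lebesgue_rV R n.
pose K (p : 'rV[R]_n * measurableTypeR R) : \bar R :=
  (step (p.2 - dotv p.1 p.1) * ((p.2 - dotv p.1 p.1) ^+ 2 / 2) * expR (- p.2))%:E.
have K0 p : (0 <= K p)%E.
  rewrite lee_fin; apply: mulr_ge0; last exact: expR_ge0.
  by apply: mulr_ge0; [exact: step_ge0|rewrite divr_ge0// sqr_ge0].
have md : measurable_fun setT (fun p : ('rV[R]_n * measurableTypeR R)%type =>
    p.2 - dotv p.1 p.1 : measurableTypeR R).
  apply: measurable_funB; first exact: measurable_snd.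
  exact: (measurableT_comp (@measurable_dotv R n) measurable_fst).
have mstep : measurable_fun setT (@step R : measurableTypeR R -> measurableTypeR R).
  exact: measurable_step.
have mK : measurable_fun setT K.
  apply/measurable_EFinP; apply: measurable_funM; last first.
    apply: measurableT_comp => //.
    exact: (measurableT_comp (@oppr_measurable R setT) measurable_snd).
  apply: measurable_funM; first exact: (measurableT_comp mstep md).
  by apply: measurable_funM => //; exact: measurable_funX.
have H := @fubini_tonelli _ _ _ _ R lam mu K mK K0.
have mG : measurable_fun setT (@hat2 R).
  exact: continuous_measurable_fun (@continuous_hat2 R).
pose Q (z : 'rV[R]_n) := (hat2 (dotv z z))%:E.
have mQ : measurable_fun setT Q.
  by apply/measurable_EFinP; exact: (measurableT_comp mG (@measurable_dotv R n)).
have EQ : (\int[lam]_z Q z = (radial_moment n 0 (@hat2 R))%:E)%E.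
  have iQ := radial_integrable n 0 (@continuous_hat2 R) (@hat2_eq0 R).
  rewrite /radial_moment /Rintegral fineK; last exact: integrable_fin_num iQ.
  by apply: eq_integral => z _; rewrite expr0 mul1r.
have E2 (t : R) : (\int[lam]_z K (z, t) =
    (gammad (n%:R / 2 + 3) t * radial_moment n 0 (@hat2 R))%:E)%E.
  rewrite EFinM -EQ /gammad /step; have [t0|t0] := ltP 0 t; last first.
    rewrite mul0r mul0e; apply: integral0_eq => z _.
    have := dotv_ge0 z => q0.
    by rewrite /K/= /step ltNge (_ : t - dotv z z <= 0) ?mul0r//; lra.
  have mQr : measurable_fun setT (fun z : 'rV[R]_n => (hat2 (dotv z z / t))%:E).
    apply/measurable_EFinP; apply: (measurableT_comp mG).
    by apply: measurable_funM => //; exact: measurable_dotv.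
  have Q0 (z : 'rV[R]_n) : setT z -> (0 <= (hat2 (dotv z z / t))%:E)%E.
    by rewrite lee_fin hat2_ge0.
  have c0 : (0 <= (t ^+ 2 * expR (- t))%:E)%E.
    by rewrite lee_fin mulr_ge0 ?expR_ge0// sqr_ge0.
  transitivity (\int[lam]_z ((t ^+ 2 * expR (- t))%:E * (hat2 (dotv z z / t))%:E))%E.
    apply: eq_integral => z _; rewrite -EFinM; congr EFin.
    rewrite /K/= /step subr_gt0 /hat2 hatE ltr_pdivrMr// mul1r.
    case: ifPn => _; last by rewrite !(mul0r, mulr0, expr0n).
    rewrite mul1r (_ : t - dotv z z = t * (1 - dotv z z / t)).
      by rewrite exprMn; ring.
    by rewrite mulrBr mulr1 mulrCA divff ?mulr1// gt_eqF.
  rewrite (ge0_integralZl lam measurableT mQr Q0 c0).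
  rewrite (radial_scale n t0 mG (@hat2_ge0 R)) muleA -EFinM; congr (_%:E * _)%E.
  rewrite mul1r mulrAC; congr (_ * _).
  rewrite -(powR_mulrn 2 (ltW t0)) -powRD ?(gt_eqF t0) ?implybT//.
  by congr (_ `^ _); ring.
have s0 : 0 < n%:R / 2 + 3 :> R by rewrite ltr_wpDl// divr_ge0.
apply: EFin_inj.
rewrite mulrC EFinM -integral_gammad//.
have gi := integrable_gammad s0.
have EG : (\int[mu]_t (gammad (n%:R / 2 + 3) t * radial_moment n 0 (@hat2 R))%:E =
    (radial_moment n 0 (@hat2 R))%:E * \int[mu]_t (gammad (n%:R / 2 + 3) t)%:E)%E.
  rewrite -(integralZl measurableT gi); apply: eq_integral => t _.
  by rewrite -EFinM mulrC.
rewrite muleC -EG.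
transitivity (\int[mu]_t \int[lam]_z K (z, t))%E.
  by apply: eq_integral => t _; rewrite E2.
rewrite -H.
transitivity (\int[lam]_z (expR (- dotv z z))%:E)%E.
  by apply: eq_integral => z _; rewrite -integral_sqr_expRN.
rewrite integral_gauss_rV; congr EFin.
by rewrite -powR_mulrn ?sqrtr_ge0// -powR12_sqrt ?pi_ge0// -powRrM mulrC.
Qed.

End gaussian.

(** * Behaviour of the constants as a tends to 1 *)

Section constants.
Variables (R : realType) (n : nat).

Definition kexp (a : R) : R := (n%:R + a + 1) / 2.

(** The constant in front of the superposition: the normalization of the fractional divergence times
    the factor s (s + 1) from the kernel formula. *)
Definition kscale (a : R) : R := frac_const n a * (kexp a * (kexp a + 1)).

(** The integral of t^((a - 3) / 2) over t >= 1 is 2 / (1 - a); its factor 2 cancels the 1 / 2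
    produced by the integration by parts. *)
Definition near_mass (a : R) : R :=
  kscale a * (radial_moment n 0 (@hat2 R) / (1 - a)).

Lemma kexp_gt0 a : 0 < a -> 0 < kexp a.
Proof. by move=> a0; rewrite divr_gt0// addr_gt0// ltr_wpDl. Qed.

Let Gamma_neq0 : Gamma (n%:R / 2 + 3 : R) != 0.
Proof.
apply/eqP => G0; have := radial_moment_hat2 R n; rewrite G0 mulr0 => /eqP.
by rewrite eq_sym (gt_eqF (powR_gt0 _ (pi_gt0 R))).
Qed.

Let moment_neq0 : radial_moment n 0 (@hat2 R) != 0.
Proof.
apply/eqP => G0; have := radial_moment_hat2 R n; rewrite G0 mul0r => /eqP.
by rewrite eq_sym (gt_eqF (powR_gt0 _ (pi_gt0 R))).
Qed.

(** The functional equation removes the pole: s (s + 1) Gamma s is Gamma (s + 2), and (1 - a) / 2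
    merges with Gamma ((1 - a) / 2). The powers of pi cancel against the mass of [hat2]. What
    remains is continuous at a = 1. *)
Lemma near_massE a : 0 < a < 1 ->
  near_mass a = 2 `^ (a - 1) * (Gamma (kexp a + 1 + 1) / Gamma (n%:R / 2 + 3)) /
                Gamma ((1 - a) / 2 + 1).
Proof.
move=> /andP[a0 a1]; have s0 := kexp_gt0 a0.
have s10 : 0 < kexp a + 1 by rewrite addr_gt0.
have b0 : 0 < (1 - a) / 2 by rewrite divr_gt0// subr_gt0.
rewrite !Gamma_rec//.
have -> : (2 : R) `^ (a - 1) = 2 `^ a / 2.
  by rewrite powRB ?powRr1// pnatr_eq0 implybT.
have HE : radial_moment n 0 (@hat2 R) = pi `^ (n%:R / 2) / Gamma (n%:R / 2 + 3).
  by rewrite -radial_moment_hat2 mulfK.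
rewrite /near_mass /kscale /frac_const HE powRN -/(kexp a).
have p0 : pi `^ (n%:R / 2) != 0 :> R by rewrite gt_eqF// powR_gt0// pi_gt0.
rewrite invfM.
have := subr_gt0 a 1; rewrite a1 => /gt_eqF/negbT h.
(* Only nonvanishing matters for the cancellation below; if this value were 0, both sides would be 0
   because the inverse of 0 is 0. *)
have [G0|G0] := eqVneq (Gamma ((1 - a) / 2)) 0.
  by rewrite G0 !(invr0, mulr0, mul0r).
have := Gamma_neq0; move: G0 h p0; move: (Gamma ((1 - a) / 2)) (Gamma (kexp a))
  (Gamma _) (pi `^ _) (2 `^ a) (kexp a) (1 - a) => A B C p e k d A0 d0 p0 C0.
by field; rewrite d0 p0 C0 A0.
Qed.

Lemma near_mass_cvg : near_mass a @[a --> (1 : R)^'-] --> (1 : R).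
Proof.
pose m (a : R) := 2 `^ (a - 1) * (Gamma (kexp a + 1 + 1) / Gamma (n%:R / 2 + 3)) /
                Gamma ((1 - a) / 2 + 1).
have ck : {for 1, continuous (fun a : R => kexp a + 1 + 1)}.
  apply: cvgD; last exact: cvg_cst.
  apply: cvgD; last exact: cvg_cst.
  apply: cvgM; last exact: cvg_cst.
  apply: cvgD; last exact: cvg_cst.
  by apply: cvgD; [exact: cvg_cst|exact: cvg_id].
have cb : {for 1, continuous (fun a : R => (1 - a) / 2 + 1)}.
  apply: cvgD; last exact: cvg_cst.
  apply: cvgM; last exact: cvg_cst.
  by apply: cvgB; [exact: cvg_cst|exact: cvg_id].
(* At a = 1 the argument s + 2 becomes n / 2 + 3, the argument of Gamma in the mass of [hat2]: this
   coincidence makes the limit exactly 1. *)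
have k1 : kexp 1 + 1 + 1 = n%:R / 2 + 3 by rewrite /kexp; field.
have b1 : (1 - 1) / 2 + 1 = 1 :> R by rewrite subrr mul0r add0r.
have m1 : m 1 = 1.
  by rewrite /m k1 b1 Gamma1 divff// subrr powRr0 !mulr1 divr1.
have cm : {for 1, continuous m}.
  rewrite /m; apply: cvgM.
    apply: cvgM.
      rewrite /powR; under eq_fun do rewrite pnatr_eq0/=.
      rewrite pnatr_eq0/=.
      apply: continuous_cvg; first exact: continuous_expR.
      apply: cvgM; last exact: cvg_cst.
      by apply: cvgB; [exact: cvg_id|exact: cvg_cst].
    apply: cvgM; last exact: cvg_cst.
    apply: (continuous_cvg _ _ ck); apply: Gamma_continuous.
    by rewrite k1 ltr_wpDl// divr_ge0.
  apply: cvgV; first by rewrite b1 Gamma1 oner_neq0.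
  by apply: (continuous_cvg _ _ cb); apply: Gamma_continuous; rewrite b1.
have := @cvg_at_left_filter _ _ _ _ _ cm; rewrite m1.
apply: cvg_trans; apply: near_eq_cvg; near=> a.
have a0 : 0 < a by near: a; exact: nbhs_left_gt.
by rewrite /m near_massE// a0 /=.
Unshelve. all: by end_near. Qed.

(** By definition [kscale] is [near_mass] times (1 - a) divided by a nonzero moment, so its decay
    follows from the limit of the mass. *)
Lemma kscale_cvg0 : kscale a @[a --> (1 : R)^'-] --> (0 : R).
Proof.
have : near_mass a * ((1 - a) / radial_moment n 0 (@hat2 R)) @[a --> (1 : R)^'-] -->
    (1 * ((1 - 1) / radial_moment n 0 (@hat2 R)) : R).
  apply: cvgM; first exact: near_mass_cvg.
  apply: cvgM; last exact: cvg_cst.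
  apply: cvgB; first exact: cvg_cst.
  exact: cvg_at_left_filter.
rewrite subrr mul0r mulr0.
apply: cvg_trans; apply: near_eq_cvg; near=> a.
have a1 : 1 - a != 0 by rewrite subr_eq0 gt_eqF.
by rewrite /near_mass; field; rewrite a1 moment_neq0.
Unshelve. all: by end_near. Qed.

End constants.

Lemma continuous_translate (R : realType) (V : normedModType R) (x : V) :
  continuous (fun z : V => x + z).
Proof. by move=> z; apply: cvgD; [exact: cvg_cst|exact: cvg_id]. Qed.

Lemma Rintegral_sum d (T : measurableType d) (R : realType)
    (m : {measure set T -> \bar R}) n (f : 'I_n -> T -> R) :
  (forall i, m.-integrable setT (EFin \o f i)) ->
  \int[m]_t (\sum_(i < n) f i t) = \sum_(i < n) \int[m]_t f i t.
Proof.
move=> fi; elim: n f fi => [|n IH] f fi.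
  rewrite big_ord0; under eq_Rintegral do rewrite big_ord0.
  by rewrite Rintegral_cst// mul0r.
rewrite big_ord_recr/= -IH//; under eq_Rintegral do rewrite big_ord_recr/=.
rewrite RintegralD//.
have := @integrable_sum _ _ _ m setT measurableT _ (index_enum _) xpredT
  (fun i : 'I_n => EFin \o f (widen_ord (leqnSn n) i)).
move=> H; have {}H := H (fun i _ => fi _); apply: eq_integrable H => //= t _.
by rewrite sumEFin.
Qed.

(** * Integration by parts at a fixed scale *)

Section fixed_scale.
Variables (R : realType) (n : nat).
Notation lam := (lebesgue_rV R n).
Notation "''e_' i" := (delta_mx ord0 i : 'rV[R]_n) (at level 8, i at level 2).
Implicit Types (x y z : 'rV[R]_n) (g : 'rV[R]_n -> R).

Definition Ccook (k : nat) (phi : 'rV[R]_n -> 'rV[R]_n) : Prop :=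
  (forall i, smooth (fun x => phi x ord0 i)) /\ Cck k phi.

Lemma continuous_comp_translate g x : continuous g -> continuous (fun z => g (x + z)).
Proof.
move=> cg z; apply: (@continuous_comp _ _ _ (fun z : 'rV[R]_n => x + z) g).
  exact: continuous_translate.
exact: cg.
Qed.

Lemma is_derive_translate g x z v : derivable g (x + z) v ->
  is_derive z v (fun z => g (x + z)) ('D_v g (x + z)).
Proof.
move=> dg; apply: is_derive_of_line.
have := @is_derive_line R n g v (x + z) 0; rewrite scale0r add0r => /(_ dg).
rewrite (_ : (fun h : R => g (h *: v + (x + z))) =
  (fun h : R => g (x + (h *: v + z))))//.
by apply/funext => h; rewrite addrCA.
Qed.

Lemma is_derive_hat2_dotv (t : R) z i :
  is_derive z 'e_i (fun z => hat2 (t * dotv z z)) (- (2 * z ord0 i * (t * hat (t * dotv z z)))).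
Proof.
have E : (fun z : 'rV[R]_n => hat2 (t * dotv z z)) =
    (fun z => (fun v : R => hat2 (- t * v)) (0 - dotv z z)).
  by apply/funext => y; rewrite sub0r mulrNN.
have d1 : is_derive (0 - dotv z z : R) 1 (fun v : R => - t * v) (- t).
  by have := @is_deriveZ R R R id (- t) (0 - dotv z z) 1 1 (is_derive_id (0 - dotv z z : R) (1 : R));
    rewrite [_ *: 1]mulr1.
have d2 := is_derive_hat2 (- t * (0 - dotv z z)).
have d12 := @is_derive1_comp R (@hat2 R) _ _ _ _ d2 d1.
have := @is_derive_comp_dotv R n _ _ 0 z i d12.
by rewrite /comp E sub0r !mulrNN [hat _ * t]mulrC.
Qed.

Lemma hat_dotv_eq0 (t : R) z : 1 <= t -> 1 <= `|z| -> 1 <= t * dotv z z.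
Proof.
move=> t1 z1; apply: (@le_trans _ _ (1 * `|z| ^+ 2)).
  by rewrite mul1r -[leLHS](expr1n _ 2) ler_pXn2r ?nnegrE.
by rewrite ler_pM// ?sqr_ge0// sqr_normr_le_dotv.
Qed.

Lemma continuous_hat_dotv (G : R -> R) (t : R) : continuous G ->
  continuous (fun z : 'rV[R]_n => G (t * dotv z z)).
Proof.
move=> cG z; apply: (@continuous_comp _ _ _ (fun z : 'rV[R]_n => t * dotv z z) G).
  by apply: continuous_mulr; [exact: continuous_cstr|exact: continuous_dotv].
exact: cG.
Qed.

(** The partial derivative of hat2 (t |z|^2) (g (x + z) - g x) has integral 0. The derivative of the
    first factor yields - 2 t z_i hat (t |z|^2); in the second factor the constant g x disappears.
    With t >= 1 everything is supported in |z| <= 1. *)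
Lemma hat_ibp_coord (t : R) k g x i : 1 <= t -> smooth g -> supported k g ->
  t * \int[lam]_z (hat (t * dotv z z) * (z ord0 i * (g (x + z) - g x))) =
  2^-1 * \int[lam]_z (hat2 (t * dotv z z) * partial i g (x + z)).
Proof.
move=> t1 sg rg.
have cg := smooth_continuous sg.
have cd := @continuous_comp_translate _ x cg.
have cD : continuous (fun z => g (x + z) - g x).
  by apply: continuous_subr => //; exact: continuous_cstr.
have cp j := @continuous_comp_translate _ x (smooth_continuous (smooth_partial j sg)).
have ch := @continuous_hat_dotv _ t (@continuous_hat R).
have ch2 := @continuous_hat_dotv _ t (@continuous_hat2 R).
have cz j : continuous (fun z : 'rV[R]_n => z ord0 j) by exact: coord_continuous.
pose G z := hat2 (t * dotv z z) * (g (x + z) - g x).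
pose dG j z := hat2 (t * dotv z z) * partial j g (x + z) -
  (2 * t) * (hat (t * dotv z z) * (z ord0 j * (g (x + z) - g x))).
have DG (j : 'I_n) z : is_derive z 'e_j G (dG j z).
  have d1 := is_derive_hat2_dotv t z j.
  have d2 := is_derive_translate (smooth_derivable sg : derivable g (x + z) 'e_j).
  have d3 := is_deriveB d2 (is_derive_cst (g x) z 'e_j).
  have := is_deriveM d1 d3.
  rewrite [X in is_derive _ _ _ X -> _](_ : _ = dG j z)//.
  rewrite /dG /GRing.scale/= /partial ?fctE/= subr0; congr (_ + _); ring.
have sG : supported 1 G.
  by move=> z z1; rewrite /G hat2_eq0 ?mul0r//; apply: hat_dotv_eq0 => //; exact: ltW.
have pG j : partial j G = dG j.
  by apply/funext => z; have D := DG j z; rewrite /partial derive_val.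
have c1 j : continuous (fun z => hat2 (t * dotv z z) * partial j g (x + z)).
  exact: continuous_mulr.
have c2 j : continuous (fun z => hat (t * dotv z z) * (z ord0 j * (g (x + z) - g x))).
  by apply: continuous_mulr => //; exact: continuous_mulr.
have CG : C1c 1 G.
  split => //; first exact: continuous_mulr.
  move=> j; split; first by move=> z; have [] := DG j z.
  rewrite pG; apply: continuous_subr => //.
  by apply: continuous_mulr => //; exact: continuous_cstr.
have i1 : lam.-integrable setT (EFin \o (fun z => hat2 (t * dotv z z) * partial i g (x + z))).
  apply: (@supported_integrable _ _ 1) => // z z1.
  by rewrite hat2_eq0 ?mul0r//; apply: hat_dotv_eq0 => //; exact: ltW.
have i2 : lam.-integrable setT
    (EFin \o (fun z => hat (t * dotv z z) * (z ord0 i * (g (x + z) - g x)))).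
  apply: (@supported_integrable _ _ 1) => // z z1.
  by rewrite hat_eq0 ?mul0r//; apply: hat_dotv_eq0 => //; exact: ltW.
have := Rintegral_partial i CG; rewrite pG /dG RintegralB//; last first.
  exact: (integrableZl measurableT (2 * t) i2).
rewrite RintegralZl// => /eqP; rewrite subr_eq0 => /eqP ->.
by rewrite -mulrA mulKf.
Qed.

Lemma hat_ibp (t : R) k (phi : 'rV[R]_n -> 'rV[R]_n) x : 1 <= t -> Ccook k phi ->
  t * \int[lam]_z (hat (t * dotv z z) * dotv z (phi (x + z) - phi x)) =
  2^-1 * \int[lam]_z (hat2 (t * dotv z z) * divergence phi (x + z)).
Proof.
move=> t1 [sphi Cphi].
have cphi i := (Cphi i).2.
have i1 i : lam.-integrable setT (EFin \o
    (fun z => hat2 (t * dotv z z) * partial i (fun x => phi x ord0 i) (x + z))).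
  apply: (@supported_integrable _ _ 1) => [z z1|].
    by rewrite hat2_eq0 ?mul0r//; apply: hat_dotv_eq0 => //; exact: ltW.
  apply: continuous_mulr; first exact: continuous_hat_dotv (@continuous_hat2 R).
  apply: continuous_comp_translate; apply: smooth_continuous.
  exact: smooth_partial.
have i2 i : lam.-integrable setT (EFin \o
    (fun z => hat (t * dotv z z) * (z ord0 i * (phi (x + z) ord0 i - phi x ord0 i)))).
  apply: (@supported_integrable _ _ 1) => [z z1|].
    by rewrite hat_eq0 ?mul0r//; apply: hat_dotv_eq0 => //; exact: ltW.
  apply: continuous_mulr; first exact: continuous_hat_dotv (@continuous_hat R).
  apply: continuous_mulr; first exact: coord_continuous.
  apply: continuous_subr; last exact: continuous_cstr.
  exact: (@continuous_comp_translate _ x (cphi i)).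
transitivity (t * \sum_(i < n)
   \int[lam]_z (hat (t * dotv z z) * (z ord0 i * (phi (x + z) ord0 i - phi x ord0 i)))).
  congr (_ * _); rewrite -Rintegral_sum//; apply: eq_Rintegral => z _.
  by rewrite -mulr_sumr; congr (_ * _); apply: eq_bigr => i _; rewrite !mxE.
transitivity (2^-1 * \sum_(i < n)
   \int[lam]_z (hat2 (t * dotv z z) * partial i (fun x => phi x ord0 i) (x + z))).
  rewrite !mulr_sumr; apply: eq_bigr => i _.
  exact: (hat_ibp_coord x i t1 (sphi i) (Cphi i).1).
congr (_ * _); rewrite -Rintegral_sum//; apply: eq_Rintegral => z _.
by rewrite -mulr_sumr.
Qed.

End fixed_scale.

Section real_fubini.
Context d1 d2 (T1 : measurableType d1) (T2 : measurableType d2) (R : realType).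
Variables (m1 : {sigma_finite_measure set T1 -> \bar R})
          (m2 : {sigma_finite_measure set T2 -> \bar R}) (f : T1 * T2 -> R).
Hypothesis fi : (m1 \x m2)%E.-integrable setT (EFin \o f).

Lemma Rintegral_prod1 (g : T1 -> R) :
  (forall x, \int[m2]_y (f (x, y))%:E = (g x)%:E)%E ->
  m1.-integrable setT (EFin \o g) /\ \int[(m1 \x m2)%E]_u f u = \int[m1]_x g x.
Proof.
move=> fg; have E : fubini_F m2 (EFin \o f) = EFin \o g.
  by apply/funext => x; exact: fg.
have h1 := integrable_fubini_F fi; have h2 := integral12_prod_meas1 fi.
by rewrite E in h1 h2; split => //; rewrite /Rintegral -h2.
Qed.

Lemma Rintegral_prod2 (g : T2 -> R) :
  (forall y, \int[m1]_x (f (x, y))%:E = (g y)%:E)%E ->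
  \int[(m1 \x m2)%E]_u f u = \int[m2]_y g y.
Proof.
move=> fg; have E : fubini_G m1 (EFin \o f) = EFin \o g.
  by apply/funext => x; exact: fg.
by have := integral21_prod_meas1 fi; rewrite E /Rintegral => <-.
Qed.

End real_fubini.

(** * Decomposition of the fractional divergence *)

Section fractional_divergence.
Variables (R : realType) (n : nat).
Notation lam := (lebesgue_rV R n).
Notation mu := (@lebesgue_measure R).
Notation rprod := (lam \x mu)%E.
Implicit Types (x y z : 'rV[R]_n) (phi : 'rV[R]_n -> 'rV[R]_n) (a : R).

Lemma normr_dotv_le (z w : 'rV[R]_n) (B : R) : (forall i, `|w ord0 i| <= B) ->
  `|dotv z w| <= n%:R * B * `|z|.
Proof.
move=> wB; apply: le_trans (ler_norm_sum _ _ _) _.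
apply: (@le_trans _ _ (\sum_(i < n) (B * `|z|))).
  apply: ler_sum => i _; rewrite normrM mulrC ler_pM//; exact: normr_coord_le.
by rewrite sumr_const card_ord -[_ *+ n]mulr_natl mulrA.
Qed.

Lemma kscale_ge0 a : 0 < a -> 0 <= kscale n a.
Proof.
move=> a0; have s0 := @kexp_gt0 R n a a0; rewrite /kscale /frac_const.
have G0 (x : R) : 0 <= Gamma x by rewrite GammaE; apply: Rintegral_ge0 => t _; exact: gammad_ge0.
apply: mulr_ge0; last by rewrite mulr_ge0 ?addr_ge0 // ltW.
by apply: mulr_ge0; [rewrite mulr_ge0 ?powR_ge0|rewrite divr_ge0].
Qed.

(* The trivial factor |z|^0 is the k = 0 case of the weights of [scale_integrable]. *)
Definition near_w a (u : 'rV[R]_n * measurableTypeR R) : R :=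
  kscale n a / 2 * (itv1y u.2 * u.2 `^ (kexp n a - 2) *
                    (`|u.1| ^+ 0 * hat2 (u.2 * dotv u.1 u.1))).

Lemma near_w_ge0 a u : 0 < a -> 0 <= near_w a u.
Proof.
move=> a0; apply: mulr_ge0; first by rewrite divr_ge0// kscale_ge0.
apply: mulr_ge0; first by apply: mulr_ge0; [exact: ler0n|exact: powR_ge0].
by apply: mulr_ge0; [rewrite exprn_ge0|exact: hat2_ge0].
Qed.

Let scale1y k (G : R -> R) (p : R) : continuous G -> (forall u, 0 <= G u) ->
  (forall u, 1 <= u -> G u = 0) -> 1 < (k + n)%:R / 2 - p ->
  rprod.-integrable setT
    (EFin \o (fun u => itv1y u.2 * u.2 `^ p * (`|u.1| ^+ k * G (u.2 * dotv u.1 u.1)))) /\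
  \int[rprod]_u (itv1y u.2 * u.2 `^ p * (`|u.1| ^+ k * G (u.2 * dotv u.1 u.1))) =
    ((k + n)%:R / 2 - p - 1)^-1 * radial_moment n k G.
Proof.
move=> cG G0 G1 p1.
have b0 (t : R) : 0 <= itv1y t by exact: ler0n.
have := @scale_integrable R n (@itv1y R) G p ((k + n)%:R / 2 - p - 1)^-1 k
  (@measurable_itv1y R) cG b0 (@itv1y_le0 R) G0 G1.
apply; rewrite -(integral_itv1y_powR p1); apply: eq_integral => t _.
by rewrite opprB.
Qed.

Lemma itv01_ge0 t : 0 <= itv01 t :> R.
Proof. by rewrite mulr_ge0 ?step_ge0. Qed.

Lemma scale_integrable01 k (G : R -> R) (p : R) : continuous G -> (forall u, 0 <= G u) ->
  (forall u, 1 <= u -> G u = 0) -> 0 < p + 1 - (k + n)%:R / 2 ->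
  rprod.-integrable setT
    (EFin \o (fun u => itv01 u.2 * u.2 `^ p * (`|u.1| ^+ k * G (u.2 * dotv u.1 u.1)))) /\
  \int[rprod]_u (itv01 u.2 * u.2 `^ p * (`|u.1| ^+ k * G (u.2 * dotv u.1 u.1))) =
    (p + 1 - (k + n)%:R / 2)^-1 * radial_moment n k G.
Proof.
move=> cG G0 G1 p1.
have := @scale_integrable R n (@itv01 R) G p (p + 1 - (k + n)%:R / 2)^-1 k
  (@measurable_itv01 R) cG itv01_ge0 (@itv01_le0 R) G0 G1.
apply; rewrite -(integral_itv01_powR p1); apply: eq_integral => t _.
by congr ((_ * _ `^ _)%:E); ring.
Qed.

Lemma near_w_integral a : 0 < a < 1 ->
  rprod.-integrable setT (EFin \o near_w a) /\ \int[rprod]_u near_w a u = near_mass n a.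
Proof.
move=> /andP[a0 a1].
have p1 : 1 < (0 + n)%:R / 2 - (kexp n a - 2).
  by rewrite /kexp add0n; lra.
have [i1 E1] := scale1y (@continuous_hat2 R) (@hat2_ge0 R) (@hat2_eq0 R) p1.
split; first exact: (integrableZl measurableT (kscale n a / 2) i1).
rewrite /near_w RintegralZl// E1 /near_mass /kexp add0n.
have d0 : 1 - a != 0 by rewrite subr_eq0 gt_eqF.
rewrite (_ : n%:R / 2 - ((n%:R + a + 1) / 2 - 2) - 1 = (1 - a) / 2); last by field.
by field.
Qed.

(** The additional |z| gains the factor t^(-1/2), so the pole at a = 1 is replaced by 1 / (2 - a)
    and the first moment vanishes with [kscale]. *)
Lemma near_w_integral1 a : 0 < a < 1 ->
  rprod.-integrable setT (EFin \o (fun u => near_w a u * `|u.1|)) /\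
  \int[rprod]_u (near_w a u * `|u.1|) = kscale n a / (2 - a) * radial_moment n 1 (@hat2 R).
Proof.
move=> /andP[a0 a1].
have p1 : 1 < (1 + n)%:R / 2 - (kexp n a - 2).
  by rewrite /kexp natrD; lra.
have [i1 E1] := scale1y (@continuous_hat2 R) (@hat2_ge0 R) (@hat2_eq0 R) p1.
have E : (fun u => near_w a u * `|u.1|) = (fun u => kscale n a / 2 *
    (itv1y u.2 * u.2 `^ (kexp n a - 2) * (`|u.1| ^+ 1 * hat2 (u.2 * dotv u.1 u.1)))).
  by apply/funext => u; rewrite /near_w expr0 expr1; ring.
rewrite E; split; first exact: (integrableZl measurableT (kscale n a / 2) i1).
rewrite RintegralZl// E1 /kexp natrD.
have d0 : 2 - a != 0 by rewrite subr_eq0 gt_eqF//; lra.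
rewrite (_ : (1 + n%:R) / 2 - ((n%:R + a + 1) / 2 - 2) - 1 = (2 - a) / 2); last by field.
by field.
Qed.

Lemma near_w_support a u : near_w a u != 0 -> `|u.1| <= 1.
Proof.
apply: contraNT; rewrite -ltNge => u1; rewrite /near_w /itv1y.
case: leP => t1; last by rewrite !mul0r mulr0.
by rewrite hat2_eq0 ?mulr0//; apply: hat_dotv_eq0 => //; exact: ltW.
Qed.

Definition near_smoothing a phi x : 'rV[R]_n :=
  \row_i superpose rprod (near_w a) fst (fun y => phi y ord0 i) x.

Definition far_remainder a phi x : R :=
  kscale n a * \int[rprod]_u (itv01 u.2 * u.2 `^ (kexp n a - 1) *
     hat (u.2 * dotv u.1 u.1) * dotv u.1 (phi (x + u.1) - phi x)).

Let mD phi x : (forall i, continuous (fun y => phi y ord0 i)) ->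
  continuous (fun z => dotv z (phi (x + z) - phi x)).
Proof.
move=> cphi; apply: continuous_sumr => i.
apply: continuous_mulr; first exact: coord_continuous.
rewrite (_ : (fun z => _) = (fun z => phi (x + z) ord0 i - phi x ord0 i)).
  apply: continuous_subr; last exact: continuous_cstr.
  exact: (@continuous_comp_translate _ _ _ x (cphi i)).
by apply/funext => z; rewrite !mxE.
Qed.

Let mF (b : R -> R) (p : R) phi x : measurable_fun setT b ->
  (forall i, continuous (fun y => phi y ord0 i)) ->
  measurable_fun setT (fun u : ('rV[R]_n * measurableTypeR R)%type =>
    b u.2 * u.2 `^ p * hat (u.2 * dotv u.1 u.1) * dotv u.1 (phi (x + u.1) - phi x)).
Proof.
move=> mb cphi; apply: measurable_funM; last first.
  exact: (measurableT_comp (continuous_measurable_rV (@mD phi x cphi)) measurable_fst).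
apply: measurable_funM.
  apply: measurable_funM; first exact: (measurableT_comp mb measurable_snd).
  exact: (measurableT_comp (measurable_powR _) measurable_snd).
apply: (measurableT_comp (continuous_measurable_fun (@continuous_hat R))).
apply: measurable_funM; first exact: measurable_snd.
exact: (measurableT_comp (@measurable_dotv R n) measurable_fst).
Qed.

Lemma hat_weight_le (b : R -> R) (p C : R) (k : nat) (D : 'rV[R]_n -> R)
    (u : ('rV[R]_n * measurableTypeR R)%type) :
  (forall t, 0 <= b t) -> `|D u.1| <= C * `|u.1| ^+ k ->
  `|b u.2 * u.2 `^ p * hat (u.2 * dotv u.1 u.1) * D u.1| <=
  `|C * (b u.2 * u.2 `^ p * (`|u.1| ^+ k * hat (u.2 * dotv u.1 u.1)))|.
Proof.
move=> b0 DC; rewrite normrM.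
have w0 : 0 <= b u.2 * u.2 `^ p * hat (u.2 * dotv u.1 u.1).
  by apply: mulr_ge0; [rewrite mulr_ge0 ?powR_ge0|exact: hat_ge0].
rewrite (ger0_norm w0); apply: le_trans (ler_wpM2l w0 DC) _.
by apply: le_trans (ler_norm _); rewrite le_eqVlt; apply/orP; left; apply/eqP; ring.
Qed.

(** Boundedness of phi leaves a single power of |z|, and with k = 1 the exponent of t at 0 is a / 2
    - 1, integrable because a > 0. *)
Lemma far_integrable a phi x (M : R) : 0 < a < 1 ->
  (forall i, continuous (fun y => phi y ord0 i)) ->
  (forall i y, `|phi y ord0 i| <= M) ->
  rprod.-integrable setT (EFin \o (fun u => itv01 u.2 * u.2 `^ (kexp n a - 1) *
     hat (u.2 * dotv u.1 u.1) * dotv u.1 (phi (x + u.1) - phi x))).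
Proof.
have i0 := itv01_ge0.
move=> /andP[a0 a1] cphi phiM.
have p1 : 0 < kexp n a - 1 + 1 - (1 + n)%:R / 2.
  by rewrite /kexp natrD; lra.
have [i1 _] := scale_integrable01 (@continuous_hat R) (@hat_ge0 R) (@hat_eq0 R) p1.
apply: le_integrable (integrableZl measurableT (n%:R * (M + M)) i1) => //.
  by apply/measurable_EFinP; apply: mF => //; exact: measurable_itv01.
move=> u _; rewrite /= lee_fin.
apply: (@hat_weight_le (@itv01 R) _ _ 1 (fun z => dotv z (phi (x + z) - phi x))) => //.
rewrite expr1; apply: normr_dotv_le => i; rewrite !mxE.
by apply: le_trans (ler_normB _ _) _; exact: lerD.
Qed.

Lemma far_remainder_le a phi x (M : R) : 0 < a < 1 ->
  (forall i, continuous (fun y => phi y ord0 i)) ->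
  (forall i y, `|phi y ord0 i| <= M) ->
  `|far_remainder a phi x| <=
    kscale n a * (n%:R * (M + M)) * ((a / 2)^-1 * radial_moment n 1 (@hat R)).
Proof.
have i0 := itv01_ge0.
move=> a01 cphi phiM; have /andP[a0 a1] := a01.
have iF := far_integrable x a01 cphi phiM.
have p1 : 0 < kexp n a - 1 + 1 - (1 + n)%:R / 2.
  by rewrite /kexp natrD; lra.
have [i1 E1] := scale_integrable01 (@continuous_hat R) (@hat_ge0 R) (@hat_eq0 R) p1.
have pE : kexp n a - 1 + 1 - (1 + n)%:R / 2 = a / 2 by rewrite /kexp natrD; field.
rewrite pE in E1.
rewrite /far_remainder normrM ger0_norm ?kscale_ge0// -mulrA ler_wpM2l ?kscale_ge0//.
apply: le_trans (le_normr_Rintegral measurableT iF) _.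
rewrite -E1 -RintegralZl//; apply: le_Rintegral => //.
- exact: integrable_norm iF.
- exact: (integrableZl measurableT (n%:R * (M + M)) i1).
move=> u _.
have M0 : 0 <= n%:R * (M + M).
  have [n0|n0] := posnP n; first by rewrite n0 mul0r.
  have := phiM (Ordinal n0) 0 => /(le_trans (normr_ge0 _)) M0.
  by rewrite mulr_ge0// addr_ge0.
apply: le_trans (@hat_weight_le (@itv01 R) _ (n%:R * (M + M)) 1
  (fun z => dotv z (phi (x + z) - phi x)) u _ _) _ => //.
  rewrite expr1; apply: normr_dotv_le => i; rewrite !mxE.
  by apply: le_trans (ler_normB _ _) _; exact: lerD.
rewrite ger0_norm//; apply: mulr_ge0 => //.
apply: mulr_ge0; first by rewrite mulr_ge0 ?powR_ge0.
by rewrite mulr_ge0 ?hat_ge0.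
Qed.

(** One power of |z| comes from the scalar product, a second one from the Lipschitz bound. With k =
    2 the exponent of t at infinity is - 1 - (1 - a) / 2, integrable because a < 1. *)
Lemma near_integrable a phi x (L : R) : 0 < a < 1 ->
  (forall i, continuous (fun y => phi y ord0 i)) ->
  (forall i y y', `|phi y ord0 i - phi y' ord0 i| <= L * `|y - y'|) ->
  rprod.-integrable setT (EFin \o (fun u => itv1y u.2 * u.2 `^ (kexp n a - 1) *
     hat (u.2 * dotv u.1 u.1) * dotv u.1 (phi (x + u.1) - phi x))).
Proof.
move=> /andP[a0 a1] cphi phiL.
have p1 : 1 < (2 + n)%:R / 2 - (kexp n a - 1).
  by rewrite /kexp natrD; lra.
have [i1 _] := scale1y (@continuous_hat R) (@hat_ge0 R) (@hat_eq0 R) p1.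
apply: le_integrable (integrableZl measurableT (n%:R * L) i1) => //.
  by apply/measurable_EFinP; apply: mF => //; exact: measurable_itv1y.
move=> u _; rewrite /= lee_fin.
apply: (@hat_weight_le (@itv1y R) _ _ 2 (fun z => dotv z (phi (x + z) - phi x))) => //.
rewrite expr2 mulrA -(mulrA n%:R); apply: normr_dotv_le => i; rewrite !mxE.
by apply: le_trans (phiL _ _ _) _; rewrite addrAC subrr add0r.
Qed.

Lemma divergence_near_smoothing k a phi x : 0 < a < 1 -> Ccook k phi ->
  divergence (near_smoothing a phi) x =
  \int[rprod]_u (near_w a u * divergence phi (x + u.1)).
Proof.
move=> a01 [sphi Cphi]; have [iw _] := near_w_integral a01.
have C i := smooth_C1c (sphi i) (Cphi i).1.
have mfst : measurable_fun setT (fst : 'rV[R]_n * measurableTypeR R -> 'rV[R]_n).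
  exact: measurable_fst.
rewrite /divergence.
transitivity (\sum_(i < n) superpose rprod (near_w a) fst
    (partial i (fun y => phi y ord0 i)) x).
  apply: eq_bigr => i _; have [_ <-] := superpose_is_derive iw mfst i x (C i).
  by congr (partial i _ x); apply/funext => y; rewrite mxE.
rewrite /superpose -Rintegral_sum.
  by apply: eq_Rintegral => u _; rewrite mulr_sumr.
move=> i; have [M M0 [_ pM]] := C1c_bounds (C i).
apply: (integrable_superpose iw mfst x _ (pM i)).
by have [_ _ /(_ i)[_ cp]] := C i; exact: continuous_measurable_rV.
Qed.

(** With z = y - x and |z|^(n + a + 1) = (|z|^2)^s the kernel becomes a power of [dotv z z], the
    form matched by [integral_powR_hat]. *)
Lemma frac_div_shift a phi x :
  (forall i, continuous (fun y => phi y ord0 i)) ->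
  frac_div a phi x = frac_const n a *
    \int[lam]_z (dotv z z `^ (- kexp n a) * dotv z (phi (x + z) - phi x)).
Proof.
move=> cphi; congr (_ * _).
rewrite -[RHS](@Rintegral_rV_shift R n (- x)); last first.
  apply: measurable_funM; last exact: (continuous_measurable_rV (@mD phi x cphi)).
  exact: (measurableT_comp (measurable_powR _) (@measurable_dotv R n)).
apply: eq_Rintegral => y _; rewrite mulrC (addrC x) subrK; congr (_ * _).
rewrite /enorm -powR12_sqrt ?dotv_ge0// -powRrM powRN; congr (_ `^ _)^-1.
by rewrite /kexp mulrC.
Qed.

(** Fubini is used in both orders: integrating in t at fixed z restores the singular kernel, and
    integrating in z at fixed t >= 1 allows the integration by parts. Splitting at t = 1 supplies
    absolute integrability, by boundedness on one side and by the Lipschitz bound on the other. *)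
Lemma frac_div_decomposition k a phi x : 0 < a < 1 -> Ccook k phi ->
  frac_div a phi x = divergence (near_smoothing a phi) x + far_remainder a phi x.
Proof.
move=> a01 Cp; have [sphi Cphi] := Cp; have /andP[a0 a1] := a01.
have s0 := @kexp_gt0 R n a a0.
have C i := smooth_C1c (sphi i) (Cphi i).1.
have cphi i := (Cphi i).2.
have /choice[L HL] (i : 'I_n) : exists L, 0 <= L /\
    forall y y', `|phi y' ord0 i - phi y ord0 i| <= L * `|y' - y|.
  by have [L L0 HL] := C1c_lipschitz (C i); exists L.
have /choice[M HM] (i : 'I_n) : exists M, 0 <= M /\ forall y, `|phi y ord0 i| <= M.
  by have [M M0 [HM _]] := C1c_bounds (C i); exists M.
pose L' := \sum_i L i; pose M' := \sum_i M i.
have phiL i y y' : `|phi y ord0 i - phi y' ord0 i| <= L' * `|y - y'|.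
  apply: le_trans ((HL i).2 _ _) _; rewrite ler_wpM2r// /L' (bigD1 i)//= lerDl.
  by apply: sumr_ge0 => j _; exact: (HL j).1.
have phiM i y : `|phi y ord0 i| <= M'.
  apply: le_trans ((HM i).2 _) _; rewrite /M' (bigD1 i)//= lerDl.
  by apply: sumr_ge0 => j _; exact: (HM j).1.
have iN := near_integrable x a01 cphi phiL.
have iF := far_integrable x a01 cphi phiM.
pose D z := dotv z (phi (x + z) - phi x).
(* The factor b is the window in t: [step] gives the full kernel, [itv01] the far part and [itv1y]
   the near part. *)
pose F b (u : 'rV[R]_n * measurableTypeR R) : R :=
  b u.2 * u.2 `^ (kexp n a - 1) * hat (u.2 * dotv u.1 u.1) * D u.1.
have iS : rprod.-integrable setT (EFin \o F (@step R)).
  have := integrableD measurableT iF iN; apply: eq_integrable => //= u _.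
  by rewrite -EFinD /F /D step_split; congr EFin; ring.
have ES : \int[rprod]_u F (@step R) u =
    \int[rprod]_u F (@itv01 R) u + \int[rprod]_u F (@itv1y R) u.
  rewrite -RintegralD//; apply: eq_Rintegral => u _.
  by rewrite /F step_split; ring.
have E1 z : (\int[mu]_t (F (@step R) (z, t))%:E =
    (dotv z z `^ (- kexp n a) / (kexp n a * (kexp n a + 1)) * D z)%:E)%E.
  (* The kernel formula requires |z| > 0; at the origin both sides are 0 because D vanishes
     there. *)
  have [->|z0] := eqVneq z 0.
    have D0 : D 0 = 0 by rewrite /D addr0 subrr /dotv big1// => i _; rewrite !mxE mul0r.
    rewrite D0 mulr0; apply: integral0_eq => t _.
    by rewrite /F /= D0 mulr0.
  have q0 : 0 < dotv z z.
    apply: lt_le_trans (sqr_normr_le_dotv z).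
    by rewrite exprn_gt0// normr_gt0.
  have H := integral_powR_hat s0 q0.
  rewrite mulrC EFinM -H -integralZl//.
    by apply: eq_integral => t _; rewrite -EFinM mulrC.
  apply/integrableP; split.
    apply/measurable_EFinP; apply: measurable_funM.
      by apply: measurable_funM; [exact: measurable_step|exact: measurable_powR].
    apply: (measurableT_comp (continuous_measurable_fun (@continuous_hat R))).
    exact: measurable_funM.
  rewrite (_ : (\int[_]_x _)%E = (dotv z z `^ (- kexp n a) / (kexp n a * (kexp n a + 1)))%:E) ?ltry//.
  rewrite -H; apply: eq_integral => t _ /=; rewrite ger0_norm//.
  by rewrite !mulr_ge0 ?step_ge0 ?powR_ge0 ?hat_ge0.
have [ig Eg] := Rintegral_prod1 iS E1.
have -> : frac_div a phi x = kscale n a * \int[rprod]_u F (@step R) u.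
  rewrite (frac_div_shift a x cphi) Eg /kscale -mulrA; congr (_ * _).
  have s1 : kexp n a * (kexp n a + 1) != 0.
    by rewrite mulf_neq0// gt_eqF// addr_gt0.
  rewrite -RintegralZl//; apply: eq_Rintegral => z _.
  by rewrite -/(D z); field; move: s1; rewrite mulf_eq0 negb_or => /andP[-> ->].
rewrite ES mulrDr addrC; congr (_ + _).
rewrite (divergence_near_smoothing x a01 Cp).
(* From here on z is integrated first: both sides of the goal are shown to be the integral over t of
   [kscale n a * r t], which reduces the identity to one at each scale. *)
pose r (t : R) : R := \int[lam]_z F (@itv1y R) (z, t).
have hatD t : 1 <= t -> lam.-integrable setT (EFin \o (fun z => hat (t * dotv z z) * D z)).
  move=> t1; apply: (@supported_integrable _ _ 1) => [z z1|].
    by rewrite hat_eq0 ?mul0r//; apply: hat_dotv_eq0 => //; exact: ltW.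
  apply: continuous_mulr; first exact: continuous_hat_dotv (@continuous_hat R).
  exact: mD.
have E2 t : (\int[lam]_z (kscale n a * F (@itv1y R) (z, t))%:E = (kscale n a * r t)%:E)%E.
  rewrite /r /F /itv1y/=; case: (leP 1 t) => t1; last first.
    under eq_Rintegral do rewrite !mul0r.
    rewrite Rintegral_cst// mul0r mulr0.
    by apply: integral0_eq => z _; rewrite !(mul0r, mulr0).
  have iFt : lam.-integrable setT (EFin \o
      (fun z => 1%:R * t `^ (kexp n a - 1) * hat (t * dotv z z) * D z)).
    have := integrableZl measurableT (t `^ (kexp n a - 1)) (hatD t t1).
    by apply: eq_integrable => //= z _; rewrite mul1r -mulrA EFinM.
  rewrite EFinM /Rintegral fineK; last exact: integrable_fin_num iFt.
  by rewrite -(integralZl measurableT iFt).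
have ikN := integrableZl measurableT (kscale n a) iN.
rewrite -RintegralZl//.
rewrite (Rintegral_prod2 (f := fun u => kscale n a * F (@itv1y R) u) ikN E2).
have cpart i : continuous (partial i (fun y => phi y ord0 i)).
  exact/smooth_continuous/smooth_partial.
have cdiv : continuous (divergence phi) by exact: continuous_sumr.
have sdiv : supported k%:R (divergence phi).
  move=> y ky; rewrite /divergence big1// => i _.
  exact: (supported_partial i (Cphi i).1).
have [N N0 divN] := supported_bounded sdiv cdiv.
have [iw _] := near_w_integral a01.
have mfst : measurable_fun setT (fst : 'rV[R]_n * measurableTypeR R -> 'rV[R]_n).
  exact: measurable_fst.
have iwd := integrable_superpose iw mfst x (continuous_measurable_rV cdiv) divN.
have cdx : continuous (fun z => divergence phi (x + z)) by exact: continuous_comp_translate.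
have hat2D t : 1 <= t ->
    lam.-integrable setT (EFin \o (fun z => hat2 (t * dotv z z) * divergence phi (x + z))).
  move=> t1; apply: (@supported_integrable _ _ 1) => [z z1|].
    by rewrite hat2_eq0 ?mul0r//; apply: hat_dotv_eq0 => //; exact: ltW.
  by apply: continuous_mulr => //; exact: continuous_hat_dotv (@continuous_hat2 R).
have E3 t : (\int[lam]_z (near_w a (z, t) * divergence phi (x + z))%:E =
    (kscale n a * r t)%:E)%E.
  rewrite /r /F /near_w /itv1y/=; case: (leP 1 t) => t1; last first.
    under [X in _ = (_ * X)%:E]eq_Rintegral do rewrite !mul0r.
    rewrite Rintegral_cst// mul0r mulr0.
    by apply: integral0_eq => z _; rewrite !(mul0r, mulr0).
  have t0 : 0 < t by exact: lt_le_trans t1.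
  (* The factor t on the left of [hat_ibp] is taken from the power; hence the exponent
     [kexp n a - 2] in [near_w], whose factor 1 / 2 is also the one in [hat_ibp]. *)
  have ts : t `^ (kexp n a - 1) = t `^ (kexp n a - 2) * t.
    rewrite -[X in _ * X](powRr1 (ltW t0)) -powRD ?(gt_eqF t0) ?implybT//.
    by congr (_ `^ _); ring.
  transitivity ((kscale n a / 2 * t `^ (kexp n a - 2))%:E *
      \int[lam]_z (hat2 (t * dotv z z) * divergence phi (x + z))%:E)%E.
    rewrite -(integralZl measurableT (hat2D t t1)).
    by apply: eq_integral => z _; rewrite -EFinM expr0 !mul1r; congr EFin; ring.
  rewrite -[X in (_ * X)%E]fineK; last exact: integrable_fin_num (hat2D t t1).
  rewrite -EFinM; congr EFin.
  rewrite (@eq_Rintegral _ _ _ _ _ (fun z => t `^ (kexp n a - 1) * (hat (t * dotv z z) * D z))).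
    rewrite RintegralZl//; last exact: hatD.
    have h := hat_ibp x t1 Cp; rewrite -/D in h.
    transitivity (kscale n a * t `^ (kexp n a - 2) *
      (2^-1 * \int[lam]_z (hat2 (t * dotv z z) * divergence phi (x + z)))).
      by rewrite /Rintegral; ring.
    by rewrite -h ts; ring.
  by move=> z _; rewrite mul1r mulrA.
by rewrite (Rintegral_prod2 iwd E3).
Qed.

End fractional_divergence.

(** * Integral bounds for superpositions and for the far part *)

Section superpose_integrable.
Context d (T : measurableType d) (R : realType) (n : nat).
Variables (m : {sigma_finite_measure set T -> \bar R}) (w : T -> R) (Z : T -> 'rV[R]_n).
Hypothesis iw : m.-integrable setT (EFin \o w).
Hypothesis mZ : measurable_fun setT Z.
Variables (g : 'rV[R]_n -> R) (M : R).
Notation lam := (lebesgue_rV R n).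
Hypothesis mg : measurable_fun setT g.
Hypothesis gM : forall x, `|g x| <= M.
Hypothesis ig : lam.-integrable setT (EFin \o g).

Let h (u : 'rV[R]_n * T) : R := w u.2 * g (u.1 + Z u.2).

Let mh : measurable_fun setT h.
Proof.
have mw : measurable_fun setT w by apply/measurable_EFinP; exact: (measurable_int m).
apply: measurable_funM; first exact: (measurableT_comp mw measurable_snd).
apply: (measurableT_comp mg); apply: measurable_fun_rV => i.
under eq_fun do rewrite mxE.
apply: measurable_funD.
  exact: (measurableT_comp (measurable_coord_rV i) measurable_fst).
exact: (measurableT_comp (measurable_coord_rV i) (measurableT_comp mZ measurable_snd)).
Qed.

Let inner t : (\int[lam]_x `|h (x, t)|%:E = (`|w t| * \int[lam]_x `|g x|)%:E)%E.
Proof.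
have ia : lam.-integrable setT (EFin \o (fun x => `|g x|)) by exact: integrable_norm ig.
rewrite EFinM /Rintegral fineK; last exact: integrable_fin_num ia.
rewrite -(integral_rV_shift (Z t) (q := EFin \o (fun x => `|g x|))); last first.
  by apply/measurable_EFinP; exact: measurableT_comp.
rewrite -ge0_integralZl//; last first.
    by move=> x _; rewrite lee_fin.
  apply/measurable_EFinP; apply: measurableT_comp => //.
  apply: (measurableT_comp mg).
  have E : (fun x : 'rV[R]_n => x + Z t) = (fun x => x + Z t) by [].
  exact: measurable_fun_addrV.
by apply: eq_integral => x _; rewrite /h /= normrM EFinM.
Qed.

Let h_integral : (\int[m]_t \int[lam]_x `|(EFin \o h) (x, t)| =
  ((\int[m]_t `|w t|) * \int[lam]_x `|g x|)%:E)%E.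
Proof.
have ia : m.-integrable setT (EFin \o (fun x => `|w x|)) by exact: integrable_norm iw.
transitivity (\int[m]_t ((`|w t| * \int[lam]_x `|g x|)%R)%:E)%E.
  by apply: eq_integral => t _; rewrite -inner.
rewrite EFinM {2}/Rintegral fineK; last exact: integrable_fin_num ia.
rewrite -(integralZr measurableT ia).
by apply: eq_integral => t _; rewrite EFinM.
Qed.

(** The L^1 case of Young's inequality: by translation invariance the inner integral over x at fixed
    t is |w t| times the norm of g, and Tonelli exchanges the integrals. *)
Lemma superpose_integrable :
  lam.-integrable setT (EFin \o superpose m w Z g) /\
  \int[lam]_x `|superpose m w Z g x| <= (\int[m]_t `|w t|) * \int[lam]_x `|g x|.
Proof.
have ih : (lam \x m)%E.-integrable setT (EFin \o h).
  apply/integrable21ltyP; first exact/measurable_EFinP.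
  by rewrite h_integral ltry.
have hx x : m.-integrable setT (EFin \o (fun t => h (x, t))).
  exact: (integrable_superpose iw mZ x mg gM).
have [iS _] : lam.-integrable setT (EFin \o superpose m w Z g) /\
    \int[(lam \x m)%E]_u h u = \int[lam]_x superpose m w Z g x.
  apply: (Rintegral_prod1 ih) => x.
  by rewrite /superpose /Rintegral fineK//; exact: integrable_fin_num (hx x).
split => //; rewrite -lee_fin -h_integral.
have iaS : lam.-integrable setT (EFin \o (fun x => `|superpose m w Z g x|)).
  exact: integrable_norm iS.
rewrite {1}/Rintegral fineK; last exact: integrable_fin_num iaS.
have mah : measurable_fun setT (fun u => `|(EFin \o h) u|)%E.
  by apply: measurableT_comp => //; exact/measurable_EFinP.
have ah0 u : (0 <= `|(EFin \o h) u|)%E by exact: abse_ge0.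
have mF := @measurable_fun_fubini_tonelli_F _ _ _ _ R m _ mah ah0.
rewrite -(@fubini_tonelli _ _ _ _ R lam m _ mah ah0).
apply: ge0_le_integral => //.
  exact: measurable_int iaS.
move=> x _; rewrite -abse_EFin.
have -> : (superpose m w Z g x)%:E = (\int[m]_t (EFin \o (fun t => h (x, t))) t)%E.
  by rewrite /superpose /Rintegral fineK//; exact: integrable_fin_num (hx x).
by apply: le_abse_integral => //; exact: measurable_int (hx x).
Qed.

End superpose_integrable.

Section rprod.
Variables (R : realType) (n : nat).
Notation lam := (lebesgue_rV R n).
Notation mu := (@lebesgue_measure R).

Lemma sigma_finite_rprod : sigma_finite setT (lam \x mu)%E.
Proof.
exists (fun k => @cube R n k `*` `[- k%:R, k%:R]%classic) => [|k].
  apply/seteqP; split => // -[z t] _.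
  have [k zk] := radius_lt_nat `|z|; have [l tl] := radius_lt_nat `|t|.
  exists (maxn k l) => //; split => /=.
    by rewrite /cube/= (le_trans zk)// ler_nat leq_maxl.
  by rewrite in_itv/= -ler_norml (le_trans tl)// ler_nat leq_maxr.
have mk := @measurable_cube R n k; split; first exact: measurableX.
rewrite product_measure1E// lte_mul_pinfty//.
  by rewrite ge0_fin_numE//; exact: lebesgue_rV_cube.
suff : (mu `[(- k%:R)%R, k%:R%R]%classic < +oo)%E by [].
by rewrite lebesgue_measure_itv/=; case: ifP => _ //; rewrite ltry.
Qed.

(* The library attaches the canonical sigma-finite structure of a product to products of
   probabilities only. *)
Definition rprod_sigma_finite :
    {sigma_finite_measure set ('rV[R]_n * measurableTypeR R)%type -> \bar R} :=
  HB.pack (lam \x mu)%E (Measure_isSigmaFinite.Build _ _ _ (lam \x mu)%E sigma_finite_rprod).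

End rprod.

Section far_remainder_integrable.
Variables (R : realType) (n : nat).
Notation lam := (lebesgue_rV R n).
Notation mu := (@lebesgue_measure R).
Notation rprod := (lam \x mu)%E.
Implicit Types (x y z : 'rV[R]_n) (phi : 'rV[R]_n -> 'rV[R]_n) (a : R).

(** The scalar product is split into coordinates, so that the far part becomes a combination of
    scalar superpositions and multiples of phi x. *)
Definition far_w a (i : 'I_n) (u : 'rV[R]_n * measurableTypeR R) : R :=
  itv01 u.2 * u.2 `^ (kexp n a - 1) * hat (u.2 * dotv u.1 u.1) * u.1 ord0 i.

Lemma far_w_integrable a i : 0 < a < 1 ->
  rprod.-integrable setT (EFin \o far_w a i) /\
  \int[rprod]_u `|far_w a i u| <= (a / 2)^-1 * radial_moment n 1 (@hat R).
Proof.
move=> /andP[a0 a1].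
have p1 : 0 < kexp n a - 1 + 1 - (1 + n)%:R / 2.
  by rewrite /kexp natrD; lra.
have [i1 E1] := scale_integrable01 (@continuous_hat R) (@hat_ge0 R) (@hat_eq0 R) p1.
have pE : kexp n a - 1 + 1 - (1 + n)%:R / 2 = a / 2 by rewrite /kexp natrD; field.
rewrite pE in E1.
have wle u : `|far_w a i u| <= itv01 u.2 * u.2 `^ (kexp n a - 1) *
    (`|u.1| ^+ 1 * hat (u.2 * dotv u.1 u.1)).
  apply: le_trans (@hat_weight_le R n (@itv01 R) _ 1 1 (fun z => z ord0 i) u (@itv01_ge0 R) _) _.
    by rewrite expr1 mul1r; exact: normr_coord_le.
  rewrite mul1r ger0_norm//; apply: mulr_ge0.
    by rewrite mulr_ge0 ?powR_ge0 ?itv01_ge0.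
  by rewrite mulr_ge0 ?hat_ge0.
have iw : rprod.-integrable setT (EFin \o far_w a i).
  apply: le_integrable i1 => //; last first.
    by move=> u _ /=; rewrite lee_fin (le_trans (wle u))// ler_norm.
  apply/measurable_EFinP; apply: measurable_funM; last first.
    exact: (measurableT_comp (measurable_coord_rV i) measurable_fst).
  apply: measurable_funM.
    apply: measurable_funM; first exact: (measurableT_comp (@measurable_itv01 R) measurable_snd).
    exact: (measurableT_comp (measurable_powR _) measurable_snd).
  apply: (measurableT_comp (continuous_measurable_fun (@continuous_hat R))).
  apply: measurable_funM; first exact: measurable_snd.
  exact: (measurableT_comp (@measurable_dotv R n) measurable_fst).
split => //; rewrite -E1; apply: le_Rintegral => //.
exact: integrable_norm iw.
Qed.

Lemma far_remainderE a phi x (e : R) : 0 < a < 1 ->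
  (forall i, continuous (fun y => phi y ord0 i)) ->
  (forall i y, `|phi y ord0 i| <= e) ->
  far_remainder a phi x = kscale n a * \sum_(i < n)
    (superpose rprod (far_w a i) fst (fun y => phi y ord0 i) x -
     (\int[rprod]_u far_w a i u) * phi x ord0 i).
Proof.
move=> a01 cphi phie; congr (_ * _).
have mfst : measurable_fun setT (fst : 'rV[R]_n * measurableTypeR R -> 'rV[R]_n).
  exact: measurable_fst.
have iw i := (far_w_integrable i a01).1.
have is_ i := integrable_superpose (iw i) mfst x (continuous_measurable_rV (cphi i)) (phie i).
have iZ i : rprod.-integrable setT (EFin \o (fun u => far_w a i u * phi x ord0 i)).
  by under eq_fun do rewrite mulrC; exact: (integrableZl measurableT (phi x ord0 i) (iw i)).
transitivity (\int[rprod]_u \sum_(i < n)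
    (far_w a i u * phi (x + u.1) ord0 i - far_w a i u * phi x ord0 i)).
  apply: eq_Rintegral => u _; rewrite /dotv mulr_sumr; apply: eq_bigr => i _.
  by rewrite !mxE /far_w; ring.
rewrite Rintegral_sum; last by move=> i; have := integrableB measurableT (is_ i) (iZ i).
apply: eq_bigr => i _; rewrite -RintegralZr//; exact: RintegralB.
Qed.

Lemma supported_integral_le k (g : 'rV[R]_n -> R) (e : R) : supported k%:R g ->
  continuous g -> (forall x, `|g x| <= e) ->
  \int[lam]_x `|g x| <= e * fine (lam (@cube R n k)).
Proof.
move=> sg cg ge; have e0 : 0 <= e by exact: le_trans (ge 0).
have mk := @measurable_cube R n k.
have ig := supported_integrable sg cg.
rewrite (_ : e * _ = \int[lam]_x (e * \1_(@cube R n k) x)).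
  apply: le_Rintegral => //; first exact: integrable_norm ig.
    exact: integrable_indic_cube.
  by move=> x _; exact: (bounded_supported_le e0 (lexx k%:R)).
have i1 := @integrable_indic_cube R n 1 k.
rewrite RintegralZl//; last first.
  by apply: eq_integrable i1 => //= x _; rewrite mul1r.
by congr (_ * _); rewrite /Rintegral integral_indic// setIT.
Qed.

(** The translate phi (x + z) and the value phi x contribute the same bound, whence the doubling:
    the norm of the weight times the norm of a component of phi, which is at most e times the volume
    of the cube. *)
Lemma far_remainder_integrable k a phi (e : R) : 0 < a < 1 -> Cck k phi ->
  (forall i y, `|phi y ord0 i| <= e) ->
  lam.-integrable setT (EFin \o far_remainder a phi) /\
  \int[lam]_x `|far_remainder a phi x| <= kscale n a *
    (n%:R * (((a / 2)^-1 * radial_moment n 1 (@hat R)) *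
             (e * fine (lam (@cube R n k))) *+ 2)).
Proof.
move=> a01 Cphi phie; have /andP[a0 a1] := a01.
have cphi i := (Cphi i).2.
have mfst : measurable_fun setT (fst : 'rV[R]_n * measurableTypeR R -> 'rV[R]_n).
  exact: measurable_fst.
have iw i := (far_w_integrable i a01).1.
have wle i := (far_w_integrable i a01).2.
pose W i : R := \int[rprod]_u far_w a i u.
pose S i x := superpose rprod (far_w a i) fst (fun y => phi y ord0 i) x.
have ig i := supported_integrable (Cphi i).1 (Cphi i).2.
have [iS Sle] : (forall i, lam.-integrable setT (EFin \o S i)) /\
    (forall i, \int[lam]_x `|S i x| <=
       (\int[rprod]_u `|far_w a i u|) * \int[lam]_x `|phi x ord0 i|).
  by split => i; have [] := @superpose_integrable _ _ R n (rprod_sigma_finite R n) (far_w a i) fst (iw i) mfst _ e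
    (continuous_measurable_rV (cphi i)) (phie i) (ig i).
have iB i : lam.-integrable setT (EFin \o (fun x => S i x - W i * phi x ord0 i)).
  by have := integrableB measurableT (iS i) (integrableZl measurableT (W i) (ig i)).
have E : far_remainder a phi =
    (fun x => kscale n a * \sum_(i < n) (S i x - W i * phi x ord0 i)).
  by apply/funext => x; exact: far_remainderE phie.
have iF : lam.-integrable setT (EFin \o far_remainder a phi).
  rewrite E; apply: (integrableZl measurableT (kscale n a)
    (f := EFin \o (fun x => \sum_(i < n) (S i x - W i * phi x ord0 i)))).
  have := @integrable_sum _ _ _ lam setT measurableT _ (index_enum _) xpredT
    (fun i : 'I_n => EFin \o (fun x => S i x - W i * phi x ord0 i)).
  move=> H; have {}H := H (fun i _ => iB i); apply: eq_integrable H => //= x _.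
  by rewrite sumEFin.
split => //.
have iaS i : lam.-integrable setT (EFin \o (fun x => `|S i x|)).
  exact: integrable_norm (iS i).
have iag i : lam.-integrable setT (EFin \o (fun x => `|phi x ord0 i|)).
  exact: integrable_norm (ig i).
have iT i : lam.-integrable setT (EFin \o (fun x => `|S i x| + `|W i| * `|phi x ord0 i|)).
  have := integrableD measurableT (iaS i) (integrableZl measurableT `|W i| (iag i)).
  by apply: eq_integrable.
have iR : lam.-integrable setT (EFin \o
    (fun x => \sum_(i < n) (`|S i x| + `|W i| * `|phi x ord0 i|))).
  have := @integrable_sum _ _ _ lam setT measurableT _ (index_enum _) xpredT
    (fun i : 'I_n => EFin \o (fun x => `|S i x| + `|W i| * `|phi x ord0 i|)).
  move=> H; have {}H := H (fun i _ => iT i); apply: eq_integrable H => //= x _.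
  by rewrite sumEFin.
apply: (@le_trans _ _ (\int[lam]_x (kscale n a *
    \sum_(i < n) (`|S i x| + `|W i| * `|phi x ord0 i|)))).
  apply: le_Rintegral => //; first exact: integrable_norm iF.
    exact: (integrableZl measurableT (kscale n a) iR).
  move=> x _; rewrite E normrM ger0_norm ?kscale_ge0// ler_wpM2l ?kscale_ge0//.
  apply: le_trans (ler_norm_sum _ _ _) _; apply: ler_sum => i _.
  by rewrite -normrM; exact: ler_normB.
rewrite RintegralZl// ler_wpM2l ?kscale_ge0// Rintegral_sum//.
set B := (a / 2)^-1 * _; set I := e * _.
have -> : n%:R * (B * I *+ 2) = \sum_(i < n) (B * I + B * I).
  by rewrite sumr_const card_ord -mulr2n mulr_natl.
apply: ler_sum => i _.
have I0 : 0 <= \int[lam]_x `|phi x ord0 i| by exact: Rintegral_ge0.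
have w0 : 0 <= \int[rprod]_u `|far_w a i u| by exact: Rintegral_ge0.
have Ile := supported_integral_le (Cphi i).1 (cphi i) (phie i).
rewrite RintegralD//; last exact: (integrableZl measurableT `|W i| (iag i)).
rewrite RintegralZl//; apply: lerD.
  by apply: le_trans (Sle i) _; apply: ler_pM => //; exact: wle.
apply: ler_pM => //; apply: le_trans (wle i).
exact: (le_normr_Rintegral measurableT (iw i)).
Qed.

End far_remainder_integrable.

Section test_functions_rV.
Variables (R : realType) (n : nat).
Implicit Types (x y : 'rV[R]_n) (phi : 'rV[R]_n -> 'rV[R]_n).

Lemma Cck_compact_support k phi : Cck k phi -> compact_support phi.
Proof.
move=> Cphi; apply: (subclosed_compact _ (@compact_cube R n k)).
  exact: closed_closure.
have ck : closed (@cube R n k).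
  exact: compact_closed (@norm_hausdorff _ _) (@compact_cube R n k).
rewrite ((closure_id _).1 ck); apply: closureS => x /= phix0.
rewrite /cube/= leNgt; apply: contra phix0 => kx; apply/eqP/rowP => i.
by rewrite mxE (Cphi i).1.
Qed.

Lemma Cc0_Cck phi : Cc0 phi -> exists k, Cck k phi.
Proof.
move=> [cphi /compact_bounded[r [_ /(_ (r + 1))]]]; rewrite ltrDl ltr01 => /(_ isT) H.
have [k rk] := radius_lt_nat (r + 1); exists k => i; split => [x kx|].
  suff -> : phi x = 0 by rewrite mxE.
  apply/eqP/negPn/negP => phix0.
  have /= := H x (@subset_closure _ [set x | phi x != 0] x phix0).
  by apply/negP; rewrite -ltNge (le_lt_trans rk).
move=> x; apply: (@continuous_comp _ _ _ phi (fun v : 'rV[R]_n => v ord0 i)).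
  exact: cphi.
exact: coord_continuous.
Qed.

Lemma Ccook_Ccoo k phi : Ccook k phi -> Ccoo phi.
Proof.
by move=> [sphi Cphi]; split; [move=> l i; exact: sphi|exact: Cck_compact_support Cphi].
Qed.

Lemma Ccook_bounds k phi : Ccook k phi -> exists L, [/\ 0 <= L,
  forall i x, `|phi x ord0 i| <= L &
  forall i x y, `|phi y ord0 i - phi x ord0 i| <= L * `|y - x|].
Proof.
move=> [sphi Cphi]; have C i := smooth_C1c (sphi i) (Cphi i).1.
have /choice[L HL] (i : 'I_n) : exists L : R, [/\ 0 <= L,
    forall x, `|phi x ord0 i| <= L &
    forall x y, `|phi y ord0 i - phi x ord0 i| <= L * `|y - x|].
  have [L L0 HL] := C1c_lipschitz (C i); have [M M0 [HM _]] := C1c_bounds (C i).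
  exists (L + M); split; first exact: addr_ge0.
    by move=> x; rewrite ler_wpDl.
  by move=> x y; rewrite (le_trans (HL x y))// ler_wpM2r// lerDl.
have Lle i : L i <= \sum_j L j.
  rewrite (bigD1 i)//= lerDl; apply: sumr_ge0 => j _; by have [] := HL j.
exists (\sum_i L i); split.
- by apply: sumr_ge0 => j _; have [] := HL j.
- by move=> i x; have [_ + _] := HL i => /(_ x)/le_trans; apply.
- move=> i x y; have [_ _ /(_ x y)] := HL i => /le_trans; apply.
  by rewrite ler_wpM2r.
Qed.

Lemma Ccook_Lipc k phi : Ccook k phi -> Lipc phi.
Proof.
move=> Cp; have [L [L0 _ phiL]] := Ccook_bounds Cp.
split; last exact: Cck_compact_support Cp.2.
exists L; split; first exact: num_real.
move=> M /ltW LM [x y] /= _; apply/normr_rV_le.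
  by rewrite mulr_ge0// (le_trans L0).
by move=> i; rewrite !mxE (le_trans (phiL i y x))// ler_wpM2r.
Qed.

End test_functions_rV.

(** * Bounds for the near part *)

Section near_smoothing_bounds.
Variables (R : realType) (n : nat).
Notation lam := (lebesgue_rV R n).
Notation mu := (@lebesgue_measure R).
Notation rprod := (lam \x mu)%E.
Implicit Types (x y : 'rV[R]_n) (phi : 'rV[R]_n -> 'rV[R]_n).

Let mfst : measurable_fun setT (fst : 'rV[R]_n * measurableTypeR R -> 'rV[R]_n).
Proof. exact: measurable_fst. Qed.

(** The weight lives on |z| <= 1, so the support grows by one cube, uniformly in a. A single
    constant of Df on the cube k + 1 then serves all a. *)
Lemma Ccook_near_smoothing k a phi : 0 < a < 1 -> Ccook k phi ->
  Ccook k.+1 (near_smoothing a phi).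
Proof.
move=> a01 [sphi Cphi]; have [iw _] := @near_w_integral R n a a01.
have E i : (fun x => near_smoothing a phi x ord0 i) =
    superpose rprod (near_w a) fst (fun y => phi y ord0 i).
  by apply/funext => x; rewrite mxE.
have S i : smooth (fun x => near_smoothing a phi x ord0 i).
  by rewrite E; exact: (superpose_smooth iw mfst (sphi i) (Cphi i).1).
split => // i; split; last exact: smooth_continuous (S i).
rewrite E -natr1; apply: (@superpose_supported _ _ _ _ rprod _ _ k%:R 1 _ (Cphi i).1).
exact: near_w_support.
Qed.

Lemma near_smoothing_le a phi (e : R) : 0 < a < 1 ->
  (forall i, continuous (fun y => phi y ord0 i)) ->
  (forall i y, `|phi y ord0 i| <= e) ->
  forall x i, `|near_smoothing a phi x ord0 i| <= near_mass n a * e.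
Proof.
move=> a01 cphi phie x i; have [iw <-] := @near_w_integral R n a a01.
have /andP[a0 _] := a01.
have is_ := integrable_superpose iw mfst x (continuous_measurable_rV (cphi i)) (phie i).
rewrite mxE (le_trans (le_normr_Rintegral measurableT is_))//.
rewrite -RintegralZr//; apply: le_Rintegral => //.
- exact: integrable_norm is_.
- by under eq_fun do rewrite mulrC; exact: (integrableZl measurableT e iw).
move=> u _; rewrite normrM (ger0_norm (near_w_ge0 _ a0)) ler_wpM2l//.
exact: near_w_ge0.
Qed.

(** The error splits into the weighted average of phi (x + z) - phi x, controlled by the Lipschitz
    constant and the first moment, and the defect of the mass from 1 times phi x. *)
Lemma near_smoothing_dist a phi (L : R) : 0 < a < 1 ->
  (forall i x, `|phi x ord0 i| <= L) ->
  (forall i x y, `|phi y ord0 i - phi x ord0 i| <= L * `|y - x|) ->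
  forall x i, `|near_smoothing a phi x ord0 i - phi x ord0 i| <=
    L * (kscale n a / (2 - a) * radial_moment n 1 (@hat2 R) + `|near_mass n a - 1|).
Proof.
move=> a01 phiM phiL x i; have [iw Ew] := @near_w_integral R n a a01.
have [iw1 Ew1] := @near_w_integral1 R n a a01.
have /andP[a0 _] := a01.
have cphi j : continuous (fun y => phi y ord0 j) by exact: lipschitz_fun_continuous (phiL j).
have is_ := integrable_superpose iw mfst x (continuous_measurable_rV (cphi i)) (phiM i).
have ic : rprod.-integrable setT (EFin \o (fun u => near_w a u * phi x ord0 i)).
  by under eq_fun do rewrite mulrC; exact: (integrableZl measurableT (phi x ord0 i) iw).
have iB : rprod.-integrable setT
    (EFin \o (fun u => near_w a u * phi (x + u.1) ord0 i - near_w a u * phi x ord0 i)).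
  by have := integrableB measurableT is_ ic.
have -> : near_smoothing a phi x ord0 i - phi x ord0 i =
    \int[rprod]_u (near_w a u * phi (x + u.1) ord0 i - near_w a u * phi x ord0 i) +
    (near_mass n a - 1) * phi x ord0 i.
  rewrite mxE RintegralB// -Ew RintegralZr// /superpose mulrBl mul1r.
  by rewrite addrA subrK.
rewrite mulrDr; apply: le_trans (ler_normD _ _) _; apply: lerD; last first.
  by rewrite normrM mulrC ler_wpM2r.
rewrite (le_trans (le_normr_Rintegral measurableT iB))//.
rewrite -Ew1 -RintegralZl//; apply: le_Rintegral => //.
- exact: integrable_norm iB.
- exact: (integrableZl measurableT L iw1).
move=> u _; rewrite -mulrBr normrM (ger0_norm (near_w_ge0 _ a0)) mulrCA.
rewrite ler_wpM2l ?near_w_ge0//.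
by apply: le_trans (phiL _ _ _) _; rewrite addrAC subrr add0r.
Qed.

End near_smoothing_bounds.

Section smooth_difference.
Variables (R : realType) (n : nat).
Implicit Types (phi psi : 'rV[R]_n -> 'rV[R]_n).

Lemma smoothB (g h : 'rV[R]_n -> R) : smooth g -> smooth h ->
  smooth (fun x => g x - h x).
Proof.
move=> sg sh; pose S : set ('rV[R]_n -> R) :=
  [set p | exists g h, [/\ smooth g, smooth h & p = (fun x => g x - h x)]].
suff HS p : S p -> continuous p /\
    forall i, (forall x, derivable p x (delta_mx ord0 i)) /\ S (partial i p).
  by apply: (smooth_coind HS); exists g, h.
move=> [{sg}g [{sh}h [sg sh ->]]]; split.
  by apply: continuous_subr; exact: smooth_continuous.
move=> i; have dg x := @smooth_derivable R n g i x sg; have dh x := @smooth_derivable R n h i x sh.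
split=> [x|]; first exact: derivableB.
exists (partial i g), (partial i h); split; try exact: smooth_partial.
by apply/funext => x; rewrite /partial deriveB.
Qed.

Lemma CcookB k phi psi : Ccook k phi -> Ccook k psi ->
  Ccook k (fun x => phi x - psi x).
Proof.
move=> [sphi Cphi] [spsi Cpsi]; split; last exact: CckB.
by move=> i; under eq_fun do rewrite !mxE; exact: smoothB.
Qed.

End smooth_difference.

(** * Pairing with f and passage to the limit *)

Section pairing.
Variables (R : realType) (n : nat).
Notation lam := (lebesgue_rV R n).
Implicit Types (f g : 'rV[R]_n -> R) (phi : 'rV[R]_n -> 'rV[R]_n).

Lemma L1_L1loc f : L1 f -> L1loc f.
Proof.
move=> fi K cK; apply: integrableS fi => //; apply: closed_measurable_rV.
exact: compact_closed (@norm_hausdorff _ _) cK.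
Qed.

Lemma L1loc_integrableM f g r : L1loc f -> supported r g -> continuous g ->
  lam.-integrable setT (EFin \o (fun x => f x * g x)).
Proof.
move=> fi sg cg; have [k rk] := radius_lt_nat r.
have mk := @measurable_cube R n k.
have [M M0 gM] := supported_bounded sg cg.
have /(integrable_mkcond _ mk) fk := fi _ (@compact_cube R n k).
have fk' : lam.-integrable setT (EFin \o (f \_ (@cube R n k))).
  apply: eq_integrable fk => //= x _; rewrite !patchE; by case: ifP.
have := integrableM_bounded fk' (continuous_measurable_rV cg) gM.
apply: eq_integrable => //= x _; rewrite patchE; case: ifPn => // /negP xk.
rewrite sg ?mulr0//; apply: le_lt_trans rk _; rewrite ltNge.
by apply/negP => xk'; apply: xk; rewrite inE.
Qed.

Lemma Loo_ae_bounded f : Loo f -> exists2 K : R, 0 <= K & {ae lam, forall x, `|f x| <= K}.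
Proof.
move=> [mf]; rewrite /finite_norm unlock; case: ifPn => [l0 foo|l0 _].
  have fge := ess_sup_ge lam (abse \o (EFin \o f)).
  move: foo fge; case: (ess_sup _ _) => [r _|//|_] fge.
    exists `|r| => //; apply: filterS fge => x /=.
    by rewrite lee_fin => /le_trans; apply; exact: ler_norm.
  by exists 0 => //; apply: filterS fge => x /=; rewrite leeNy_eq.
(* Degenerate branch in the definition of the norm: the whole space is then null, and any bound
   holds almost everywhere. *)
exists 0 => //; exists setT; split => //.
by apply/eqP; rewrite eq_le measure_ge0 andbT leNgt.
Qed.

Lemma radial_moment_ge0 k (G : R -> R) : (forall u, 0 <= G u) -> 0 <= radial_moment n k G.
Proof.
by move=> G0; apply: Rintegral_ge0 => z _; rewrite mulr_ge0// exprn_ge0.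
Qed.

(** Keeping a > 1/2 bounds (a / 2)^-1 by 4, so that C does not depend on a and all the smallness
    sits in [kscale]. *)
Lemma far_pairing k f : L1 f \/ Loo f -> exists2 C : R, 0 <= C &
  forall a phi (e : R), 2^-1 < a < 1 -> Cck k phi -> 0 <= e ->
    (forall i x, `|phi x ord0 i| <= e) ->
    lam.-integrable setT (EFin \o (fun x => f x * far_remainder a phi x)) /\
    `|\int[lam]_x (f x * far_remainder a phi x)| <= C * kscale n a * e.
Proof.
have rm0 : 0 <= radial_moment n 1 (@hat R) by exact/radial_moment_ge0/hat_ge0.
have a4 (a : R) : 2^-1 < a < 1 -> [/\ 0 < a < 1, (a / 2)^-1 <= 4 & 0 <= kscale n a].
  move=> /andP[ha a1]; have a0 : 0 < a by rewrite (lt_trans _ ha).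
  rewrite a0 a1 kscale_ge0//; split => //.
  by rewrite invf_ple ?posrE ?divr_gt0//; lra.
move=> [fi|/[dup] foo [mf _]].
- exists (n%:R * 2 * 4 * radial_moment n 1 (@hat R) * \int[lam]_x `|f x|).
    by rewrite mulr_ge0 ?Rintegral_ge0// mulr_ge0.
  move=> a phi e /a4[a01 ainv k0] Cphi e0 phie.
  have [iF _] := far_remainder_integrable a01 Cphi phie.
  have mF : measurable_fun setT (far_remainder a phi).
    by apply/measurable_EFinP; exact: measurable_int iF.
  have cphi i := (Cphi i).2.
  pose B := kscale n a * (n%:R * (e + e)) * (4 * radial_moment n 1 (@hat R)).
  have FB x : `|far_remainder a phi x| <= B.
    apply: le_trans (far_remainder_le x a01 cphi phie) _.
    have ee : 0 <= e + e by exact: addr_ge0.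
    rewrite /B; apply: ler_wpM2l; first by rewrite mulr_ge0// mulr_ge0.
    by rewrite ler_wpM2r.
  have ifF := integrableM_bounded fi mF FB.
  split => //; apply: le_trans (le_normr_Rintegral measurableT ifF) _.
  have iaf : lam.-integrable setT (EFin \o (fun x => `|f x|)) by exact: integrable_norm fi.
  rewrite (_ : _ * e = \int[lam]_x (B * `|f x|)); last first.
    by rewrite RintegralZl// /B; ring.
  apply: le_Rintegral => //; first exact: integrable_norm ifF.
    exact: (integrableZl measurableT B iaf).
  by move=> x _; rewrite normrM mulrC ler_wpM2r.
have [K K0 fK] := Loo_ae_bounded foo; have V0 := fine_ge0 (measure_ge0 lam (@cube R n k)).
pose V := fine (lam (@cube R n k)).
exists (K * (n%:R * (4 * radial_moment n 1 (@hat R) * V *+ 2))).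
  by rewrite !mulr_ge0// mulrn_wge0// !mulr_ge0.
move=> a phi e /a4[a01 ainv k0] Cphi e0 phie.
have [iF Fle] := far_remainder_integrable a01 Cphi phie.
have mF : measurable_fun setT (far_remainder a phi).
  by apply/measurable_EFinP; exact: measurable_int iF.
have iaF : lam.-integrable setT (EFin \o (fun x => `|far_remainder a phi x|)).
  exact: integrable_norm iF.
have iKF : lam.-integrable setT (EFin \o (fun x => K * `|far_remainder a phi x|)).
  exact: (integrableZl measurableT K iaF).
have le1 : (\int[lam]_x `|(f x * far_remainder a phi x)%:E| <=
    \int[lam]_x (K * `|far_remainder a phi x|)%:E)%E.
  apply: ae_ge0_le_integral => //.
  - apply: measurableT_comp => //; apply/measurable_EFinP; exact: measurable_funM.
  - by move=> x _; rewrite lee_fin mulr_ge0.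
  - exact: measurable_int iKF.
  by apply: filterS fK => x fx _; rewrite /= lee_fin normrM ler_wpM2r.
have ifF : lam.-integrable setT (EFin \o (fun x => f x * far_remainder a phi x)).
  apply/integrableP; split; first by apply/measurable_EFinP; exact: measurable_funM.
  apply: le_lt_trans le1 _; have := integrable_fin_num measurableT iKF.
  by rewrite ge0_fin_numE// integral_ge0// => x _; rewrite lee_fin mulr_ge0.
split => //; apply: le_trans (le_normr_Rintegral measurableT ifF) _.
have ianF : lam.-integrable setT (EFin \o (fun x => `|f x * far_remainder a phi x|)).
  exact: integrable_norm ifF.
apply: (@le_trans _ _ (\int[lam]_x (K * `|far_remainder a phi x|))).
  by rewrite /Rintegral fine_le//; [exact: integrable_fin_num ianF|exact: integrable_fin_num iKF].
rewrite RintegralZl//; apply: le_trans (ler_wpM2l K0 Fle) _.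
rewrite (_ : _ * e = K * (kscale n a * (n%:R * (4 * radial_moment n 1 (@hat R) *
    (e * V) *+ 2)))); last by ring.
rewrite ler_wpM2l// ler_wpM2l// ler_wpM2l// lerMn2r//=.
by rewrite ler_wpM2r ?mulr_ge0// ler_wpM2r.
Qed.

End pairing.

Section fractional_gradient.
Variables (R : realType) (n : nat) (f : 'rV[R]_n -> R).
Variables (Df : radon_vmeasure R n) (Da : R -> radon_vmeasure R n).
Hypothesis f_loc : L1loc f.
Hypothesis f_glob : L1 f \/ Loo f.
Hypothesis hDf : is_gradient f Df.
Hypothesis hDa : forall a : R, 0 < a < 1 -> is_frac_gradient a f (Da a).
Notation lam := (lebesgue_rV R n).
Implicit Types (phi psi : 'rV[R]_n -> 'rV[R]_n).

Let half_lt1 (a : R) : 2^-1 < a < 1 -> 0 < a < 1.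
Proof. by move=> /andP[ha a1]; rewrite a1 (lt_trans _ ha). Qed.

(** Here the decomposition is paired with f. The averaged field is an admissible test field for Df,
    and the two terms are integrable separately: the near one by local integrability, the far one by
    [far_pairing]. The minus sign in both definitions of gradient produces the one before the far
    term. *)
Lemma vintegral_frac_gradient k a phi : 2^-1 < a < 1 -> Ccook k phi ->
  vintegral (Da a) phi = vintegral Df (near_smoothing a phi) -
    \int[lam]_x (f x * far_remainder a phi x).
Proof.
move=> ha Cp; have a01 := half_lt1 ha.
have Cn := Ccook_near_smoothing a01 Cp; have [sn Cckn] := Cn.
have [L [L0 phiL _]] := Ccook_bounds Cp.
have [C C0 HC] := far_pairing k f_glob.
have [iF _] := HC a phi L ha Cp.2 L0 phiL.
have iD : lam.-integrable setT (EFin \o (fun x => f x * divergence (near_smoothing a phi) x)).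
  apply: (@L1loc_integrableM _ _ _ _ k.+1%:R) => //.
    move=> x kx; rewrite /divergence big1// => i _.
    exact: (supported_partial i (Cckn i).1).
  apply: continuous_sumr => i; exact/smooth_continuous/smooth_partial.
have Ea := hDa a01 (Ccook_Lipc Cp); have Ef := hDf (Ccook_Ccoo Cn).
rewrite -[LHS]opprK -Ea -[vintegral Df _]opprK -Ef -opprD -RintegralD//; congr (- _).
by apply: eq_Rintegral => x _; rewrite (frac_div_decomposition x a01 Cp) mulrDr.
Qed.

Lemma near1_half : \forall a \near (1 : R)^'-, 2^-1 < a < 1.
Proof.
near=> a; apply/andP; split; near: a; last exact: nbhs_left_lt.
by apply: nbhs_left_gt; lra.
Unshelve. all: by end_near. Qed.

(** The closeness of a to 1 is chosen before phi, since it only has to ensure [near_mass] <= 2 and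
    [kscale] <= 1. These bounds give the factor 2 on the constant of Df and the factor 1 on that of
    the far part. *)
Lemma vintegral_frac_bounded k : exists2 C : R, 0 <= C &
  \forall a \near (1 : R)^'-, forall phi (e : R), Ccook k phi -> 0 <= e ->
    (forall x i, `|phi x ord0 i| <= e) -> `|vintegral (Da a) phi| <= C * e.
Proof.
have [C C0 HC] := far_pairing k f_glob.
have [D D0 HD] := vintegral_le Df k.+1.
exists (D * 2 + C); first by rewrite addr_ge0// mulr_ge0.
near=> a; move=> phi e Cp e0 phie.
have ha : 2^-1 < a < 1 by near: a; exact: near1_half.
have a01 := half_lt1 ha.
have m2 : near_mass n a <= 2.
  near: a; apply: (cvgr_le _ (@near_mass_cvg R n)); lra.
have k1 : kscale n a <= 1.
  near: a; apply: (cvgr_le _ (@kscale_cvg0 R n)); lra.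
have [_ Fle] := HC a phi e ha Cp.2 e0 (fun i x => phie x i).
have [_ Cn] := Ccook_near_smoothing a01 Cp.
have Dle := HD _ _ Cn (near_smoothing_le a01 (fun i => (Cp.2 i).2) (fun i x => phie x i)).
rewrite (vintegral_frac_gradient ha Cp) (le_trans (ler_normB _ _))// mulrDl lerD//.
  by rewrite (le_trans Dle)// -mulrA ler_wpM2l// ler_wpM2r.
by rewrite (le_trans Fle)// ler_wpM2r// -[leRHS]mulr1 ler_wpM2l.
Unshelve. all: by end_near. Qed.

Lemma vintegral_frac_cvg_smooth k phi : Ccook k phi ->
  vintegral (Da a) phi @[a --> (1 : R)^'-] --> vintegral Df phi.
Proof.
move=> Cp; have [L [L0 phiM phiL]] := Ccook_bounds Cp.
have [C C0 HC] := far_pairing k f_glob.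
have [D D0 HD] := vintegral_dist Df k.+1.
pose r := radial_moment n 1 (@hat2 R).
pose h (a : R) := D * (L * (kscale n a * r + `|near_mass n a - 1|)) + C * kscale n a * L.
have h0 : h a @[a --> (1 : R)^'-] --> (0 : R).
  have -> : (0 : R) = D * (L * (0 * r + `|1 - 1|)) + C * 0 * L.
    by rewrite subrr normr0; ring.
  have ck := @kscale_cvg0 R n.
  apply: cvgD; last by apply: cvgMl; apply: cvgMr.
  apply: cvgMr; apply: cvgMr; apply: cvgD; first exact: cvgMl.
  by apply: cvg_norm; apply: cvgB; [exact: near_mass_cvg|exact: cvg_cst].
apply/cvgrPdist_le => e e0; near=> a.
have ha : 2^-1 < a < 1 by near: a; exact: near1_half.
have a01 := half_lt1 ha; have /andP[a0 a1] := a01.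
apply: (@le_trans _ _ (h a)); last by near: a; exact: (cvgr_le _ h0).
have [_ Cn] := Ccook_near_smoothing a01 Cp.
have [_ Fle] := HC a phi L ha Cp.2 L0 phiM.
rewrite distrC (vintegral_frac_gradient ha Cp) addrAC (le_trans (ler_normB _ _))//.
apply: lerD => //; apply: le_trans (HD _ _ _ Cn (Cck_le (leqnSn k) Cp.2)
  (near_smoothing_dist a01 phiM phiL)) _.
rewrite ler_wpM2l// ler_wpM2l// lerD2r ler_wpM2r//.
  exact/radial_moment_ge0/hat2_ge0.
(* Since 2 - a >= 1, the division by 2 - a in the first moment can only decrease it. *)
rewrite ler_pdivrMr ?subr_gt0; last lra.
by rewrite ler_peMr ?kscale_ge0//; lra.
Unshelve. all: by end_near. Qed.

(** The field psi approximates phi, and convergence is known at psi. The delicate term compares psi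
    and phi under D^a f, because their difference is merely continuous while the uniform bound
    concerns smooth fields. *)
Lemma vintegral_frac_cvg phi : Cc0 phi ->
  vintegral (Da a) phi @[a --> (1 : R)^'-] --> vintegral Df phi.
Proof.
move=> /Cc0_Cck[k Cphi]; have Cphi1 := Cck_le (leqnSn k) Cphi.
have [C C0 HC] := vintegral_frac_bounded k.+1.
have [D D0 HD] := vintegral_dist Df k.+1.
apply/cvgrPdist_le => e e0.
(* Half of e is reserved for the convergence at psi, the other half for replacing phi by psi on both
   sides, as (C + D) d <= e / 2; the added 1 keeps the denominator positive. *)
pose d := e / (2 * (C + D + 1)).
have CD0 : 0 < C + D + 1 by rewrite ltr_wpDl// addr_ge0.
have d0 : 0 < d by rewrite divr_gt0// mulr_gt0.
have [psi [spsi Cpsi psid]] := mollify d0 Cphi.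
have /cvgrPdist_le cvg_psi := vintegral_frac_cvg_smooth (conj spsi Cpsi).
near=> a.
have Vpsi : `|vintegral Df psi - vintegral (Da a) psi| <= e / 2.
  by near: a; apply: cvg_psi; rewrite divr_gt0.
have Va : `|vintegral (Da a) psi - vintegral (Da a) phi| <= C * d.
  have [A A0 HA] := vintegral_dist (Da a) k.+1.
  have CA0 : 0 < C + A + 1 by rewrite ltr_wpDl// addr_ge0.
  (* The constant A depends on a. A second smooth field chi, within s of phi and chosen after a,
     costs at most C (d + s) + A s, and s makes the excess over C d at most the arbitrary t. *)
  apply/ler_addgt0Pr => t t0; pose s := t / (C + A + 1).
  have s0 : 0 < s by rewrite divr_gt0.
  have [chi [schi Cchi chis]] := mollify s0 Cphi.
  have Cd := CcookB (conj spsi Cpsi) (conj schi Cchi).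
  have H1 : `|vintegral (Da a) psi - vintegral (Da a) chi| <= C * (d + s).
    rewrite (vintegralB _ Cpsi Cchi).
    have HCa : forall phi (e : R), Ccook k.+1 phi -> 0 <= e ->
        (forall x i, `|phi x ord0 i| <= e) -> `|vintegral (Da a) phi| <= C * e.
      by near: a.
    apply: HCa => //; first by rewrite addr_ge0// ltW.
    move=> x i; rewrite !mxE.
    have := psid x i; have := chis x i; rewrite !ler_norml; lra.
  have H2 := HA _ _ _ Cchi Cphi1 chis.
  have sE : s * (C + A + 1) = t by rewrite /s divfK// gt_eqF.
  apply: le_trans (ler_distD (vintegral (Da a) chi) _ _) _.
  apply: le_trans (lerD H1 H2) _.
  rewrite mulrDr -addrA lerD2l -mulrDl -sE mulrC ler_wpM2l ?(ltW s0)//.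
  by rewrite lerDl.
have Vphi := HD _ _ _ Cpsi Cphi1 psid.
have dE : d * (C + D + 1) = e / 2.
  by rewrite /d; field; rewrite gt_eqF.
have : (C + D) * d <= e / 2 by rewrite -dE mulrC ler_wpM2l ?(ltW d0)// lerDl.
move: Vphi Vpsi Va.
move: (vintegral Df phi) (vintegral Df psi) (vintegral (Da a) phi)
  (vintegral (Da a) psi) => p q p' q' Vphi Vpsi Va H.
apply: le_trans (ler_distD q _ _) _; rewrite distrC.
apply: le_trans (lerD Vphi (ler_distD q' _ _)) _.
apply: le_trans (lerD (lexx _) (lerD Vpsi Va)) _.
rewrite addrCA [leRHS]splitr lerD2l (le_trans _ H)//.
by rewrite mulrDl addrC.
Unshelve. all: by end_near. Qed.

End fractional_gradient.

Theorem theorem4p7 (R : realType) (n : nat) (n_ge1 : (1 <= n)%N)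
    (f : 'rV[R]_n -> R) (hf : BV f \/ (BVloc f /\ Loo f))
    (Df : radon_vmeasure R n) (hDf : is_gradient f Df)
    (Da : R -> radon_vmeasure R n)
    (hDa : forall a : R, 0 < a < 1 -> is_frac_gradient a f (Da a)) :
  weak_star_cvg Da 1^'- Df.
Proof.
move=> phi Cphi; apply: (vintegral_frac_cvg _ _ hDf hDa Cphi).
  by case: hf => [[/L1_L1loc]|[[]]].
by case: hf => [[]|[]]; [left|right].
Qed.
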